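(* Let $d\ge 3$ and let $\mathcal{T}_d$ be the infinite $d$-regular real tree with unit edge lengths. The Poisson balloon process on $\mathcal{T}_d$ is transient: almost surely, for every $x\in\mathcal{T}_d$, the set of times $\{t\ge 0: x\in S_t\}$ is bounded. Moreover, for a fixed origin $o\in\mathcal{T}_d$ (not necessarily a vertex), almost surely $$R_t\ \ge\ 2t-O(\log t)\qquad\text{as } t\to\infty$$ (that is, almost surely there is a finite constant $C$ such that $R_t\ge 2t-C\log t$ for all sufficiently large $t$), and $$\liminf_{t\to\infty}\frac{R_t}{t}=2\quad\text{almost surely.}$$
   Context: $\mathcal{T}_d$ is the $d$-regular tree in which each edge is a copy of the unit interval $[0,1]$ and endpoints are identified at each vertex; it is a metric measure space with the path metric $\rho$ and the length (Lebesgue) measure $\mu$ on the edges. Balloon process. Let $(\Omega,\rho)$ be a metric space and let $\Pi$ be a point process on $\Omega$, with $[\Pi]$ its set of points. Around each $x\in[\Pi]$ a ball (balloon) grows at rate 1, so that at time $t$ it has radius $t$; whenever two balloons touch, both immediately pop and are removed. Formally, each $x\in[\Pi]$ has a popping time $T_x\in(0,\infty]$ and is active at time $t$ iff $t<T_x$, where (i) any two distinct points $x,y$ active at time $t$ satisfy $\rho(x,y)>2t$; (ii) if $T_x<\infty$, then there is $y\in[\Pi]$, $y\ne x$, with $T_y=T_x$ and $\rho(x,y)=2T_x$. For the Poisson process considered here, almost surely there is exactly one such family of popping times, so the process is well defined. The Poisson balloon process on a metric measure space $(\Omega,\rho,\mu)$ is the balloon process started from a Poisson point process $\Pi$ with intensity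 measure $\mu$. Notation: $\Pi_t$ is the point process of centers of balloons active at time $t$, with $[\Pi_t]$ its set of points; $S_t=\{x\in\Omega:\rho(x,[\Pi_t])\le t\}$ is the set covered by balloons at time $t$; $R_t=\rho(o,[\Pi_t])$ is the distance from the origin $o$ to the nearest active center at time $t$ (where $\rho(x,S)=\inf_{y\in S}\rho(x,y)$). *)

(* Defs.v *)
From HB Require Import structures.
From mathcomp Require Import all_boot all_order all_algebra.
From mathcomp Require Import all_classical all_reals all_analysis.

Set Implicit Arguments.
Unset Strict Implicit.
Unset Printing Implicit Defensive.

Import Order.TTheory GRing.Theory Num.Theory.
Import numFieldNormedType.Exports.

Local Open Scope classical_set_scope.
Local Open Scope card_scope.
Local Open Scope ring_scope.

(* The d-regular combinatorial tree is the Cayley graph of the free product of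
   d copies of Z/2: vertices are the words over 'I_d without two equal
   consecutive letters, and the parent of a nonempty word is its tail. *)
Definition reduced (d : nat) (w : seq 'I_d) : bool :=
  sorted (fun i j => i != j) w.

Definition vertex (d : nat) : Type := {w : seq 'I_d | reduced w}.

Lemma reduced_behead (d : nat) (w : seq 'I_d) : reduced w -> reduced (behead w).
Proof. by case: w => //= i w; exact: path_sorted. Qed.

Definition parent (d : nat) (v : vertex d) : vertex d :=
  exist _ (behead (val v)) (reduced_behead (valP v)).

Definition tree_root (d : nat) : vertex d := exist (@reduced d) [::] isT.

(* Each non-root vertex v stands for the edge joining [parent v] to v. *)
Definition edge (d : nat) : Type := {v : vertex d | val v != [::]}.

Definition edge_src (d : nat) (e : edge d) : vertex d := parent (val e).
Definition edge_tgt (d : nat) (e : edge d) : vertex d := val e.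

Lemma edge_src_neq_tgt (d : nat) (e : edge d) : edge_src e != edge_tgt e.
Proof.
apply/eqP => /(congr1 (fun v : vertex d => size (val v))) /=.
by case: e => -[[|i w] /= rw] //= _; elim: (size w) => // n IH [].
Qed.

Lemma degree_vertex (d : nat) (v : vertex d) :
  exists f : 'I_d -> edge d,
    set_bij [set: 'I_d] [set e | edge_src e = v \/ edge_tgt e = v] f.
Proof.
have ne i (h : ohead (val v) != Some i) : reduced (i :: val v).
  case: v h => -[|j w] //= rw h; rewrite /reduced /= in rw *.
  by rewrite rw andbT; apply: contra h => /eqP ->.
have f0 i : {e : edge d | (edge_src e = v \/ edge_tgt e = v) /\
   ohead (val (val e)) = Some i}.
  case: (boolP (ohead (val v) == Some i)) => [/eqP h|h].
    have vn : val v != [::] by case: (val v) h.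
    by exists (exist _ v vn); split; [right|].
  exists (exist _ (exist _ (i :: val v) (ne _ h)) isT); split => //; left.
  exact/val_inj.
exists (fun i => sval (f0 i)); split.
- by move=> i _ /=; case: (f0 i) => e /= [].
- move=> i j _ _ /=; case: (f0 i) => e /= [_ he]; case: (f0 j) => e' /= [_ he'].
  by move=> ee; move: he; rewrite ee he' => -[].
- move=> e /= he; case h: (ohead (val (val e))) => [i|]; last first.
    by case: e h {he} => -[[|]].
  exists i => //; case: (f0 i) => e' /= [he' h'].
  apply/val_inj/val_inj => /=.
  have szE (b : edge d) : val (val b) =
     (if ohead (val (val b)) is Some k then [:: k] else [::])
       ++ val (edge_src b) by case: b => -[[|k w]] //.
  case: he he' => [he|he] [he'|he'].
  + by rewrite szE h' he' [RHS]szE h he.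
  + have := valP (val e); rewrite szE h he -he' /= /edge_tgt.
    rewrite [val (val e')]szE h' /reduced /=; case: (val (edge_src e')) => [|? ?] //=;
    by rewrite eqxx.
  + have := valP (val e'); rewrite szE h' he' -he /= /edge_tgt.
    rewrite [val (val e)]szE h /reduced /=; case: (val (edge_src e)) => [|? ?] //=;
    by rewrite eqxx.
  + by rewrite -/(edge_tgt e) -/(edge_tgt e') he he'.
Qed.

(* The geometric realization: the vertices together with one open unit interval
   per edge. *)
Definition regular_tree (R : realType) (d : nat) : Type :=
  (vertex d + edge d * {s : R | 0 < s < 1})%type.
HB.instance Definition _ (R : realType) (d : nat) :=
  Choice.on (regular_tree R d).

(* The point at position s of the closed edge e, for s in [0, 1]. *)
Definition edge_point (R : realType) (d : nat) (e : edge d) (s : R) :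
    regular_tree R d :=
  if insub s is Some s' then inr (e, s')
  else if s <= 0 then inl (edge_src e) else inl (edge_tgt e).

(* [path_length x y l]: some concatenation of finitely many segments, each
   contained in a closed edge, leads from x to y and has total length l. *)
Inductive path_length (R : realType) (d : nat) :
    regular_tree R d -> regular_tree R d -> R -> Prop :=
| path_length_nil x : path_length x x 0
| path_length_cons e a b y l :
    0 <= a <= 1 -> 0 <= b <= 1 -> path_length (edge_point e b) y l ->
    path_length (edge_point e a) y (`|a - b| + l).

Definition tree_dist (R : realType) (d : nat) (x y : regular_tree R d) : R :=
  inf [set l | path_length x y l].

Section tree_metric.
Variables (R : realType) (d : nat).
Implicit Types (x y z : regular_tree R d) (e : edge d) (s l : R).

Lemma edge_point0 e : edge_point e (0 : R) = inl (edge_src e).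
Proof. by rewrite /edge_point insubF ?lexx// ltxx. Qed.

Lemma edge_point1 e : edge_point e (1 : R) = inl (edge_tgt e).
Proof. by rewrite /edge_point insubF ?ltxx ?andbF// ler10. Qed.

Lemma edge_point_inner e (s : {s : R | 0 < s < 1}) :
  edge_point e (val s) = inr (e, s).
Proof. by rewrite /edge_point valK. Qed.

Lemma path_length_ge0 x y l : path_length x y l -> 0 <= l.
Proof. by elim=> // {}x e a b {}y {}l *; rewrite addr_ge0. Qed.

Lemma path_length_cat x y z l l' :
  path_length x y l -> path_length y z l' -> path_length x z (l + l').
Proof.
elim=> [{}x|e a b {}y {}l ha hb _ IH]; first by rewrite add0r.
by move=> /IH h; rewrite -addrA; exact: path_length_cons.
Qed.

Lemma path_length1 e (a b : R) : 0 <= a <= 1 -> 0 <= b <= 1 ->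
  path_length (edge_point e a) (edge_point e b) `|a - b|.
Proof.
move=> ha hb; rewrite -[`|_|]addr0; apply: path_length_cons => //.
exact: path_length_nil.
Qed.

Lemma path_length_sym x y l : path_length x y l -> path_length y x l.
Proof.
elim=> [{}x|e a b {}y {}l ha hb _ IH]; first exact: path_length_nil.
by rewrite addrC distrC; apply: path_length_cat IH (path_length1 _ _ _).
Qed.

Lemma path_length_root x :
  exists l, path_length x (inl (tree_root d)) l.
Proof.
have hv (v : vertex d) :
    exists l : R, path_length (inl v) (inl (tree_root d)) l.
  case: v => w; elim: w => [|i w IH] rw.
    exists 0; rewrite (_ : exist (@reduced d) _ rw = tree_root d); last exact/val_inj.
    exact: path_length_nil.
  have [l hl] := IH (reduced_behead rw).
  pose e : edge d := exist _ (exist (@reduced d) (i :: w) rw) isT.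
  exists (`|1 - 0| + l); rewrite (_ : inl _ = edge_point e 1).
    apply: path_length_cons; rewrite ?lexx ?ler01//.
    by rewrite edge_point0 (_ : edge_src e = exist (@reduced d) w (reduced_behead rw))//;
       exact/val_inj.
  by rewrite edge_point1.
case: x => [v|[e s]]; first exact: hv.
have [l hl] := hv (edge_src e); exists (`|val s - 0| + l).
rewrite -edge_point_inner; apply: path_length_cons; rewrite ?lexx ?ler01//.
- by case: s => s /= /andP[? ?]; rewrite !ltW.
- by rewrite edge_point0.
Qed.

Lemma has_inf_path_length x y : has_inf [set l | path_length x y l].
Proof.
split; last by exists 0 => l /path_length_ge0.
have [l hl] := path_length_root x; have [l' hl'] := path_length_root y.
by exists (l + l'); exact: path_length_cat hl (path_length_sym hl').
Qed.

Lemma tree_dist_le x y l : path_length x y l -> tree_dist x y <= l.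
Proof. by move=> h; apply: ge_inf => //; have [] := has_inf_path_length x y. Qed.

Lemma tree_dist_ge x y (m : R) :
  (forall l, path_length x y l -> m <= l) -> m <= tree_dist x y.
Proof. by move=> h; apply: lb_le_inf => //; case: (has_inf_path_length x y). Qed.

Lemma tree_distxx x : tree_dist x x = 0.
Proof.
apply/eqP; rewrite eq_le tree_dist_le /=; last exact: path_length_nil.
by apply: tree_dist_ge => l /path_length_ge0.
Qed.

Lemma tree_dist_sym x y : tree_dist x y = tree_dist y x.
Proof.
by congr inf; apply/seteqP; split=> l /=; exact: path_length_sym.
Qed.

Lemma tree_dist_triangle y x z :
  tree_dist x z <= tree_dist x y + tree_dist y z.
Proof.
rewrite -lerBlDr; apply: tree_dist_ge => l hl.
rewrite lerBlDr addrC -lerBlDr; apply: tree_dist_ge => l' hl'.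
by rewrite lerBlDr addrC; apply: tree_dist_le; exact: path_length_cat hl hl'.
Qed.

Lemma tree_dist_lipschitz (f : regular_tree R d -> R) :
  (forall e a b, 0 <= a <= 1 -> 0 <= b <= 1 ->
     f (edge_point e a) - f (edge_point e b) <= `|a - b|) ->
  forall x y, f x - f y <= tree_dist x y.
Proof.
move=> hf x y; apply: tree_dist_ge => l; elim=> [{}x|e a b {}y {}l ha hb _ IH].
  by rewrite subrr.
by rewrite -(subrKA (f (edge_point e b))) lerD// hf.
Qed.

Definition vertex_bump (v : vertex d) x : R :=
  match x with
  | inl u => (u == v)%:R
  | inr (e, s) =>
      (edge_src e == v)%:R * (1 - val s) + (edge_tgt e == v)%:R * val s
  end.

Lemma vertex_bumpE v e s : 0 <= s <= 1 ->
  vertex_bump v (edge_point e s) =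
    (edge_src e == v)%:R * (1 - s) + (edge_tgt e == v)%:R * s.
Proof.
move=> /andP[s0 s1]; rewrite /edge_point; case: insubP => [s' _ <-//|].
rewrite negb_and -!leNgt; case: ifPn => [sle _|]; last first.
  rewrite -ltNge => slt /orP[|sge]; first by [].
  by rewrite (le_anti (introT andP (conj s1 sge)))/= subrr mulr0 mulr1 add0r.
by rewrite (le_anti (introT andP (conj sle s0)))/= subr0 mulr0 mulr1 addr0.
Qed.

Definition inner_bump e (s : R) x : R :=
  match x with
  | inl _ => 0
  | inr (e', s') =>
      (e' == e)%:R * Num.max 0 (Num.min s (1 - s) - `|val s' - s|)
  end.

Lemma inner_bumpE e s e' (s' : R) : 0 <= s' <= 1 ->
  inner_bump e s (edge_point e' s') =
    (e' == e)%:R * Num.max 0 (Num.min s (1 - s) - `|s' - s|).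
Proof.
move=> /andP[s0 s1]; rewrite /edge_point; case: insubP => [t _ <-//|].
rewrite negb_and -!leNgt => h; have -> : Num.max 0 (Num.min s (1 - s) - `|s' - s|) = 0.
  apply/max_idPl; rewrite subr_le0 ge_min.
  case/orP: h => h.
  - by rewrite (le_anti (introT andP (conj h s0))) sub0r normrN ler_norm.
  - by rewrite (le_anti (introT andP (conj s1 h))) ler_norm orbT.
by rewrite mulr0; case: ifP.
Qed.

Lemma tree_dist_positivity x y : tree_dist x y = 0 -> x = y.
Proof.
move=> h; case: x h => [v|[e s]] h.
  have : vertex_bump v (inl v) - vertex_bump v y <= tree_dist (inl v) y.
    apply: (@tree_dist_lipschitz (vertex_bump v)) => e a b ha hb.
    rewrite !vertex_bumpE//.
    have : ~~ ((edge_src e == v) && (edge_tgt e == v)).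
      apply/negP => /andP[/eqP sv /eqP tv].
      by have := edge_src_neq_tgt e; rewrite sv tv eqxx.
    case: (edge_src e == v); case: (edge_tgt e == v) => //= _.
    - by rewrite !mul0r !addr0 !mul1r opprB addrC addrA subrK distrC ler_norm.
    - by rewrite !mul0r !add0r !mul1r ler_norm.
    - by rewrite !mul0r !addr0 subr0.
  rewrite h /= eqxx subr_le0; case: y {h} => [u|[e s]] /=.
    by case: eqVneq => [->//|_]; rewrite ler10.
  have /andP[s0 s1] := valP s.
  have : ~~ ((edge_src e == v) && (edge_tgt e == v)).
    apply/negP => /andP[/eqP sv /eqP tv].
    by have := edge_src_neq_tgt e; rewrite sv tv eqxx.
  case: (edge_src e == v); case: (edge_tgt e == v) => //= _.
  - by rewrite mul1r mul0r addr0 lerBrDl gerDr leNgt s0.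
  - by rewrite mul1r mul0r add0r leNgt s1.
  - by rewrite !mul0r addr0 ler10.
have /andP[s0 s1] := valP s.
have m0 : 0 < Num.min (val s) (1 - val s) by rewrite lt_min s0 subr_gt0.
have : inner_bump e (val s) (inr (e, s)) - inner_bump e (val s) y <=
    tree_dist (inr (e, s)) y.
  apply: (@tree_dist_lipschitz (inner_bump e (val s))) => e' a b ha hb.
  rewrite !inner_bumpE//; case: eqP => _; last by rewrite !mul0r subrr.
  rewrite !mul1r; set m := Num.min _ _.
  rewrite lerBlDr ge_max addr_ge0 ?le_max ?lexx//=.
  rewrite -lerBlDl le_max; apply/orP; right.
  rewrite -addrA lerD2l -opprD lerN2 [leRHS]addrC.
  by rewrite (distrC a b); exact: ler_distD.
rewrite h /= eqxx mul1r subrr normr0 subr0 subr_le0.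
rewrite (max_idPr (ltW m0)); case: y {h} => [u|[e' s']] /=.
  by rewrite leNgt m0.
case: eqP => [->|_]; last by rewrite mul0r leNgt m0.
rewrite mul1r le_max [X in X || _]leNgt m0 /= lerBrDl gerDr normr_le0 subr_eq0.
by move=> /eqP/val_inj ->.
Qed.

HB.instance Definition _ := @isMetric.Build R (regular_tree R d)
  (@tree_dist R d) tree_distxx tree_dist_positivity tree_dist_sym
  tree_dist_triangle.

Lemma mdist_treeE x y : mdist x y = tree_dist x y.
Proof. by []. Qed.

End tree_metric.

Definition length_measure (R : realType) (d : nat) (A : set (regular_tree R d)) :
    \bar R :=
  \esum_(e in [set: edge d])
    lebesgue_measure [set s : R | 0 <= s <= 1 /\ A (edge_point e s)].

Definition borel (T : topologicalType) : set (set T) := <<s @open T >>.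

Definition count_event (W T : Type) (Pi : W -> set T) (A : set T) (k : nat) :
    set W :=
  [set w | Pi w `&` A #= `I_k].

(* A point process without multiple points is identified with its random set of
   points. Note that [poisson_prob] ignores its second argument (and that
   [poisson_pmf] would not be the right mass function at rate 0). *)
Definition poisson_point_process (R : realType) (dW : measure_display)
    (W : measurableType dW) (P : probability W R) (T : metricType R)
    (mu : set T -> \bar R) (Pi : W -> set T) : Prop :=
  (forall A : set T, borel A -> (mu A < +oo)%E ->
     forall k, measurable (count_event Pi A k) /\
       P (count_event Pi A k) = poisson_prob (fine (mu A)) 0%N [set k]) /\
  (forall (n : nat) (A : 'I_n -> set T),
     (forall i, borel (A i) /\ (mu (A i) < +oo)%E) -> trivIset setT A ->
     forall k : 'I_n -> nat,
       P (\bigcap_(i in [set: 'I_n]) count_event Pi (A i) (k i)) =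
       (\prod_(i < n) P (count_event Pi (A i) (k i)))%E).

Section balloons.
Variables (R : realType) (T : metricType R).
Implicit Types (X : set T) (tau : T -> \bar R) (t : R).

(* The values of tau outside X are irrelevant. *)
Definition active X tau t : set T := [set x | X x /\ (t%:E < tau x)%E].

Definition popping_times X tau : Prop :=
  [/\ forall x, X x -> (0 < tau x)%E,
      forall t x y, 0 <= t -> active X tau t x -> active X tau t y -> x <> y ->
        2 * t < mdist x y
    & forall x, X x -> (tau x < +oo)%E ->
        exists y, [/\ X y, y <> x, tau y = tau x
                    & (mdist x y)%:E = (2%:E * tau x)%E] ].

Definition dist_set (x : T) (A : set T) : \bar R :=
  ereal_inf [set (mdist x y)%:E | y in A].

Definition covered X tau t : set T :=
  [set x | (dist_set x (active X tau t) <= t%:E)%E].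

Definition transient X tau : Prop :=
  forall x, bounded_set [set t : R | 0 <= t /\ covered X tau t x].

End balloons.

Definition poisson_balloon_process (R : realType) (dW : measure_display)
    (W : measurableType dW) (P : probability W R) (T : metricType R)
    (mu : set T -> \bar R) (Pi : W -> set T) (tau : W -> T -> \bar R) : Prop :=
  poisson_point_process P mu Pi /\
  {ae P, forall w, popping_times (Pi w) (tau w)}.

(* Main.v *)
(* Cut every edge into cells of length h, so that the set of occupied cells is a
   Bernoulli field of parameter q = 1 - exp(-h).  On the occupied cells run a
   thinning which, at time kh, removes at once all the cells having another
   remaining cell at distance about 2kh.  A balloon alive at time t is centered in
   a cell surviving the thinning, unless the configuration has three points with
   two almost equal mutual distances, or a long path with decreasing steps; as h
   goes to 0 these patterns have vanishing probability.

   Survivors at time t are 2t-separated, so a ball of radius k of vertices, with k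
   close to t, sees at most one of them.  Hence the entropy H of the restriction of
   the survivors to such a ball B, and H' of its restriction to the union of B and
   its image under an edge flip, are explicit in the density p of survivors.  The
   edge-vertex inequality for factors of independent seeds, 2 (d - 1) H <= d H' on
   average over the d colors (from the Shapley decomposition of H among the seeds
   and the monotonicity of the shares in B), then forces
   p = O(t (d - 1)^(-2t)).  A ball of radius 2t - C log t has too few vertices to
   meet an active center infinitely often, which gives the lower bound on R_t and
   transience.

   If R_s >= (2 + c) s for all s >= s0, remove the points at distance at most
   2 s0 + 1 from o together with their partners, and add a point at o: it never
   pops.  This surgery changes the weight of the field by a bounded factor, so the
   probability of the event is at most a constant times the density of survivors
   at time t, for every large t, hence is zero. *)
Require Import Defs.
From mathcomp Require Import all_boot all_order all_algebra.
From mathcomp Require Import ring lra zify.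
From mathcomp Require Import reals exp.

Set Implicit Arguments.
Unset Strict Implicit.
Unset Printing Implicit Defensive.

Import Order.TTheory GRing.Theory Num.Theory.

Local Open Scope ring_scope.

(** * Bernoulli fields *)

(** The entropy inequality is decisive because its main terms cancel. If the ball has $N$ vertices
    and its union with a flipped copy has $M$, then $dM = 2(d-1)N+2$, so the terms $Np\ln p$ and
    $Mp\ln p$ leave only $2p\ln p$, and the second order term of $x\ln x$ near 1 gives $N^2p^2 =
    O(p\ln(1/p))$. Packing alone gives $Np\le 1$; the extra factor $N$ is what doubles the radius
    from $t$ to $2t$. Shapley shares need finitely many seeds, hence the cells and the restriction
    to a large finite ball, where a flip leaves in place the cells that it would push outside; these
    are too far away to matter. The fate of a balloon is explained along paths with decreasing
    steps. When step lengths are cut into $n$ slices, monotonicity leaves only exponentially many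
    slice patterns, so the expected number of paths of $n$ steps is of order $(c/n)^n$ and not
    $c^n$. A near tie involves three occupied cells but only two free positions, hence has
    probability $O(h)$. In the surgery the inserted point costs a factor of order $h$; this is
    recovered by letting it sit in any of the $K = 1/(2h)$ cells of a half edge. *)

Lemma big_set_mem (R : nmodType) (C : finType) (j : C) (F : {set C} -> R) :
  \sum_w F w = \sum_(w : {set C} | j \notin w) (F w + F (j |: w)).
Proof.
rewrite (bigID (fun w : {set C} => j \notin w)) /= big_split /=; congr (_ + _).
rewrite (reindex_onto (fun w => j |: w) (fun w => w :\ j)) /=.
  apply: eq_bigl => w; rewrite setU11 /=.
  by apply/eqP/idP => [<-|h]; rewrite ?setD11// setU1K.
by move=> w; rewrite negbK => jw; rewrite setD1K.
Qed.

Section bernoulli.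
Variables (R : realType) (C : finType) (q : R).
Hypothesis q01 : 0 <= q <= 1.
Implicit Types (w A : {set C}) (f g : {set C} -> R) (j : C).

Definition wt w : R := q ^+ #|w| * (1 - q) ^+ #|~: w|.

Definition Ex f : R := \sum_w wt w * f w.

(** The conditional expectation of [f] given the coordinates in [A], obtained by resampling the
    others. It is defined at every [w], so no null set has to be avoided when [q] is 0 or 1. *)
Definition cE A f w : R :=
  \sum_(w' : {set C}) wt w' * f ((w :&: A) :|: (w' :\: A)).

Let q0 : 0 <= q. Proof. by case/andP: q01. Qed.
Let p0 : 0 <= 1 - q. Proof. by rewrite subr_ge0; case/andP: q01. Qed.

Lemma wt_ge0 w : 0 <= wt w.
Proof. by rewrite mulr_ge0// exprn_ge0. Qed.

Lemma wtU1 w j : j \notin w -> q * wt w = (1 - q) * wt (j |: w).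
Proof.
move=> jw; rewrite /wt cardsU1 jw add1n exprS.
have -> : #|~: w| = #|~: (j |: w)|.+1.
  rewrite setCU setIC -setDE (cardsD1 j (~: w)) !inE jw add1n.
  by congr (#|pred_of_set _|.+1); apply/setP => x; rewrite !inE andbC.
by rewrite exprS; ring.
Qed.

Lemma sum_wt : \sum_w wt w = 1.
Proof.
have := @bigA_distr R 0 1 *%R +%R C (fun=> q) (fun=> 1 - q).
rewrite big1 => [->|i _]; last by rewrite /= addrC subrK.
apply: eq_bigr => w _; rewrite (bigID (mem w)) /=; congr (_ * _).
  by rewrite (eq_bigr (fun=> q)) => [|i ->//]; rewrite big_const iter_mulr_1.
rewrite (eq_bigr (fun=> 1 - q)) => [|i /negbTE ->//].
by rewrite big_const iter_mulr_1; congr (_ ^+ _); apply: eq_card => x; rewrite !inE.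
Qed.

Lemma two_point f j :
  Ex f = Ex (fun w => (1 - q) * f (w :\ j) + q * f (j |: w)).
Proof.
rewrite /Ex !(big_set_mem j); apply: eq_bigr => w jw.
have -> : w :\ j = w by apply/setDidPl; rewrite disjoint_sym disjoints1.
rewrite setU1K// setUA setUid; have := wtU1 jw => h.
set a := wt w in h *; set b := wt (j |: w) in h *.
have ha : a = (1 - q) * (a + b) by rewrite mulrDr -h; ring.
have hb : b = q * (a + b) by rewrite mulrDr h; ring.
by rewrite -[RHS]mulrDl mulrDr !mulrA ![(a + b) * _]mulrC -ha -hb.
Qed.

Lemma ExD f g : Ex (fun w => f w + g w) = Ex f + Ex g.
Proof. by rewrite -big_split; apply: eq_bigr => w _; rewrite mulrDr. Qed.

Lemma Ex_cst a : Ex (fun=> a) = a.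
Proof. by rewrite /Ex -mulr_suml sum_wt mul1r. Qed.

Lemma ler_Ex f g : (forall w, f w <= g w) -> Ex f <= Ex g.
Proof. by move=> h; apply: ler_sum => w _; rewrite ler_wpM2l ?wt_ge0. Qed.

Lemma Ex_ge0 f : (forall w, 0 <= f w) -> 0 <= Ex f.
Proof. by move=> h; rewrite -[0](Ex_cst 0) ler_Ex. Qed.

Lemma Ex_sum (I : Type) (s : seq I) (F : I -> {set C} -> R) :
  Ex (fun w => \sum_(i <- s) F i w) = \sum_(i <- s) Ex (F i).
Proof.
by rewrite /Ex exchange_big /=; apply: eq_bigr => w _; rewrite mulr_sumr.
Qed.

Lemma cE_0 f w : cE finset.set0 f w = Ex f.
Proof. by apply: eq_bigr => w' _; rewrite setI0 set0U setD0. Qed.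

Lemma cE_T f w : cE [set: C] f w = f w.
Proof.
rewrite -[RHS](Ex_cst (f w)); apply: eq_bigr => w' _.
by rewrite setIT setDT setU0.
Qed.

Lemma cE_sum (I : Type) (s : seq I) (F : I -> {set C} -> R) A w :
  cE A (fun w => \sum_(i <- s) F i w) w = \sum_(i <- s) cE A (F i) w.
Proof. exact: (@Ex_sum I s (fun i w' => F i ((w :&: A) :|: (w' :\: A)))). Qed.

Lemma cE_B f g A w : cE A (fun w => f w - g w) w = cE A f w - cE A g w.
Proof. by rewrite -sumrB; apply: eq_bigr => w' _; rewrite mulrBr. Qed.

Lemma cE_cst a A w : cE A (fun=> a) w = a.
Proof. exact: Ex_cst. Qed.

Lemma ler_cE f g A w : (forall w, f w <= g w) -> cE A f w <= cE A g w.
Proof. by move=> h; apply: ler_sum => w' _; rewrite ler_wpM2l ?wt_ge0. Qed.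

Lemma eq_cE f g A w : f =1 g -> cE A f w = cE A g w.
Proof. by move=> h; apply: eq_bigr => w' _; rewrite h. Qed.

Lemma cE_ge0 f A w : (forall w, 0 <= f w) -> 0 <= cE A f w.
Proof. by move=> h; rewrite -[0](cE_cst 0 A w) ler_cE. Qed.

(** The tower property, one seed at a time: monotonicity in the conditioning set reduces to this
    average of two values. *)
Lemma cE_tower f A j w : j \notin A ->
  cE A f w = (1 - q) * cE (j |: A) f (w :\ j) + q * cE (j |: A) f (j |: w).
Proof.
move=> jA; rewrite /cE -/(Ex (fun w' => f ((w :&: A) :|: (w' :\: A)))).
rewrite (two_point _ j) /Ex !mulr_sumr -big_split; apply: eq_bigr => w' _ /=.
have e1 : w :&: A :|: (w' :\ j) :\: A =
    (w :\ j) :&: (j |: A) :|: w' :\: (j |: A).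
  apply/setP => x; rewrite !inE; case: (eqVneq x j) => [->|_] //=.
  by rewrite (negbTE jA) !andbF.
have e2 : w :&: A :|: (j |: w') :\: A =
    (j |: w) :&: (j |: A) :|: w' :\: (j |: A).
  apply/setP => x; rewrite !inE; case: (eqVneq x j) => [->|_] //=.
  by rewrite (negbTE jA) !andbF ?orbT.
by rewrite e1 e2; ring.
Qed.

Definition indep j f := forall w, f (w :\ j) = f (j |: w).

Lemma cE_indep f A j w : j \notin A -> indep j f ->
  cE (j |: A) f w = cE A f w.
Proof.
move=> jA fj; rewrite /cE; apply: eq_bigr => w' _; congr (_ * _).
set x := (X in f X = _); set y := (X in _ = f X).
have indE u : f u = f (u :\ j).
  case: (boolP (j \in u)) => ju; first by rewrite fj (setUidPr _)// sub1set.
  by congr f; apply/esym/setDidPl; rewrite disjoint_sym disjoints1.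
rewrite (indE x) (indE y); congr f; apply/setP => z; rewrite !inE.
by case: (eqVneq z j).
Qed.

Lemma cE_inv (s : C -> C) f g A w : involutive s ->
  (forall w, g w = f (s @: w)) ->
  cE A g w = cE (s @: A) f (s @: w).
Proof.
move=> sK gf; have si : injective s by exact: inv_inj.
have sKi : involutive (fun B : {set C} => s @: B).
  by move=> B; rewrite -imset_comp (eq_imset _ sK) imset_id.
rewrite [RHS]/cE (reindex_inj (inv_inj sKi)) /=.
apply: eq_bigr => w' _; rewrite gf; congr (_ * f _).
  rewrite /wt (card_imset _ si); congr (_ * _ ^+ _).
  rewrite -(card_imset _ si); apply: eq_card => x.
  by rewrite -[x]sK !inE !mem_imset// inE.
by apply/setP => x; rewrite -[x]sK !inE !mem_imset// !inE.
Qed.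

End bernoulli.

(** * Entropy and Shapley shares *)

Section log_sum.
Variable R : realType.
Implicit Types a s r : R.

Definition xlnx a : R := a * ln a.

(** The perspective $a\ln(a/s)$ of $x\ln x$, homogeneous of degree one and jointly convex. Written
    as a difference of products, it vanishes at $a=0$ whatever value [ln] takes at 0. *)
Definition relent a s : R := a * ln a - a * ln s.

Lemma ln_ge_subinv a : 0 < a -> 1 - a^-1 <= ln a.
Proof.
move=> a0; have := @le_ln1Dx _ (a^-1 - 1).
rewrite addrCA subrr addr0 ltrBrDl subrr invr_gt0 => /(_ a0).
by rewrite lnV ?posrE// => h; lra.
Qed.

(** By homogeneity, the supporting plane along the ray $a = rs$ depends on the slope [r] only. *)
Lemma relent_tangent r a s : 0 < r -> 0 <= a <= s ->
  a * ln r + a - s * r <= relent a s.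
Proof.
move=> r0 /andP[a0 le_as]; rewrite /relent.
have [->|an0] := eqVneq a 0.
  by rewrite !mul0r !add0r oppr0 oppr_le0 mulr_ge0 ?(ltW r0)// (le_trans a0).
have {an0 a0} a0 : 0 < a by rewrite lt_def an0.
have s0 : 0 < s by exact: lt_le_trans le_as.
have := @ln_ge_subinv (a / (s * r)).
rewrite divr_gt0 ?mulr_gt0// => /(_ isT).
rewrite ln_div ?posrE ?mulr_gt0// lnM ?posrE// invf_div.
rewrite -(ler_pM2l a0) mulrBr mulr1 mulrCA divff ?gt_eqF// mulr1.
by move=> h; lra.
Qed.

Lemma relent_convex (q a s a' s' : R) : 0 <= q <= 1 ->
  0 <= a <= s -> 0 <= a' <= s' ->
  relent ((1 - q) * a + q * a') ((1 - q) * s + q * s') <=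
  (1 - q) * relent a s + q * relent a' s'.
Proof.
move=> /andP[q0 q1] has has'.
have p0 : 0 <= 1 - q by rewrite subr_ge0.
have /andP[a0 le_as] := has; have /andP[a'0 le_as'] := has'.
set b := (1 - q) * a + q * a'; set u := (1 - q) * s + q * s'.
have b0 : 0 <= b by rewrite addr_ge0// mulr_ge0.
(* A zero slope has no tangent plane; in this case both weighted numerators vanish, and with them
   both sides. *)
have [b00|bn0] := eqVneq b 0.
  have tri (c x y : R) : 0 <= c -> 0 <= x -> c * x = 0 -> c * relent x y = 0.
    move=> _ _ /eqP; rewrite mulf_eq0 => /orP[/eqP->|/eqP->]; rewrite ?mul0r//.
    by rewrite /relent !mul0r subrr mulr0.
  have h1 : (1 - q) * a = 0.
    by apply/eqP; rewrite eq_le mulr_ge0// andbT -b00 lerDl mulr_ge0.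
  have h2 : q * a' = 0.
    by apply/eqP; rewrite eq_le mulr_ge0// andbT -b00 lerDr mulr_ge0.
  by rewrite !tri// b00 /relent !mul0r subrr addr0.
have {}b0 : 0 < b by rewrite lt_def bn0.
have bu : b <= u by rewrite lerD// ler_wpM2l.
have u0 : 0 < u by exact: lt_le_trans bu.
(* The slope at the mixture: the two tangent bounds taken there add up exactly to the left-hand
   side. *)
have r0 : 0 < b / u by rewrite divr_gt0.
have h1 := ler_wpM2l p0 (relent_tangent r0 has).
have h2 := ler_wpM2l q0 (relent_tangent r0 has').
apply: le_trans (lerD h1 h2); rewrite /relent -mulrBr -ln_div ?posrE//.
have : u * (b / u) = b by rewrite mulrCA divff ?gt_eqF// mulr1.
set x := ln (b / u); set y := b / u; rewrite -/y => h.
by clearbody x y; rewrite /b /u in h *; lra.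
Qed.

End log_sum.

Section shapley.
Variables (R : realType) (C : finType).
Implicit Types (g : {set C} -> R) (j : C) (A B : {set C}).

(** The probability that, in a uniformly random order of [C], the elements preceding a given one
    form a given set of size [a]. *)
Definition shapley_weight (a : nat) : R :=
  a`!%:R * (#|C| - a.+1)`!%:R / #|C|`!%:R.

Definition shapley g j : R :=
  \sum_(A : {set C} | j \notin A) shapley_weight #|A| * (g (j |: A) - g A).

Lemma shapley_weight_ge0 a : 0 <= shapley_weight a.
Proof. by rewrite divr_ge0 ?mulr_ge0// ler0n. Qed.

Lemma ler_shapley g g' j :
  (forall A, j \notin A -> g (j |: A) - g A <= g' (j |: A) - g' A) ->
  shapley g j <= shapley g' j.
Proof.
by move=> h; apply: ler_sum => A jA; rewrite ler_wpM2l ?shapley_weight_ge0// h.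
Qed.

Lemma shapley0 g j : (forall A, j \notin A -> g (j |: A) = g A) ->
  shapley g j = 0.
Proof. by move=> h; apply: big1 => A jA; rewrite h// subrr mulr0. Qed.

Lemma shapley_inv g g' (s : C -> C) j : involutive s ->
  (forall A, g' A = g (s @: A)) -> shapley g' j = shapley g (s j).
Proof.
move=> sK gg'; have si := inv_inj sK.
have sKi : involutive (fun B : {set C} => s @: B).
  by move=> B; rewrite -imset_comp (eq_imset _ sK) imset_id.
rewrite [RHS](reindex_inj (inv_inj sKi)) /=.
apply: eq_big => A; first by rewrite mem_imset.
by move=> _; rewrite !gg' imsetU1 card_imset.
Qed.

(** Collect the coefficient of each [g B]: the gains of the members of [B] ([up]) and the losses of
    the non-members ([dn]) are equal unless [B] is empty or full. *)
Lemma sum_shapley g : \sum_j shapley g j = g [set: C] - g finset.set0.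
Proof.
pose n := #|C|.
pose up (B : {set C}) : R := \sum_(j in B) shapley_weight #|B|.-1 * g B.
pose dn (B : {set C}) : R := \sum_(j | j \notin B) shapley_weight #|B| * g B.
transitivity (\sum_(B : {set C}) (up B - dn B)).
  rewrite sumrB /up /dn [X in X - _](exchange_big_dep xpredT)//=.
  rewrite [X in _ - X](exchange_big_dep xpredT)//= -sumrB; apply: eq_bigr => j _.
  rewrite /shapley; under [LHS]eq_bigr do rewrite mulrBr.
  rewrite sumrB; congr (_ - _).
  rewrite [RHS]big_mkcond (big_set_mem j) /= [RHS]big_mkcond [LHS]big_mkcond.
  apply: eq_bigr => A _ /=; case: ifPn => // jA; rewrite (negbTE jA) add0r.
  by rewrite setU11 cardsU1 jA.
have n0 : (n`!%:R : R) != 0 by rewrite pnatr_eq0 -lt0n fact_gt0.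
have upE B : B != finset.set0 -> up B = (#|B|`!%:R * (n - #|B|)`!%:R / n`!%:R) * g B.
  rewrite -card_gt0 => B0; rewrite /up sumr_const -[LHS]mulr_natl mulrA; congr (_ * _).
  rewrite /shapley_weight prednK// -/n -(prednK B0) factS prednK// natrM.
  by rewrite -!mulrA.
have dnE B : B != [set: C] -> dn B = (#|B|`!%:R * (n - #|B|)`!%:R / n`!%:R) * g B.
  move=> BT; have Bn : (#|B| < n)%N.
    by rewrite /n -cardsT; apply: proper_card; rewrite properT.
  rewrite /dn sumr_const -[LHS]mulr_natl mulrA; congr (_ * _).
  have -> : #|fun j => j \notin B| = (n - #|B|)%N.
    by rewrite -[n](cardC B) addKn.
  rewrite /shapley_weight -/n -[in (n - #|B|)`!](subnSK Bn) factS subnSK// natrM.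
  by rewrite !mulrA; congr (_ / _); rewrite mulrAC mulrC !mulrA.
have upT : up [set: C] = (if #|C| == 0 then 0 else g [set: C]).
  case: eqP => [C0|/eqP C0].
    by rewrite /up big1// => j; have := card0_eq C0 j; rewrite !inE.
  rewrite upE; last by rewrite -card_gt0 cardsT lt0n.
  by rewrite cardsT -/n subnn fact0 mulr1 divff// mul1r.
have dn0 : dn finset.set0 = (if #|C| == 0 then 0 else g finset.set0).
  case: eqP => [C0|/eqP C0].
    by rewrite /dn big1// => j; have := card0_eq C0 j; rewrite !inE.
  rewrite dnE; last by rewrite eq_sym -card_gt0 cardsT lt0n.
  by rewrite cards0 -/n subn0 fact0 mul1r divff// mul1r.
have up0 : up finset.set0 = 0 by rewrite /up big1// => j; rewrite inE.
have dnT : dn [set: C] = 0 by rewrite /dn big1// => j; rewrite inE.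
(* For an empty [C] the two exceptional sets coincide and cannot be split off separately. *)
case: (eqVneq #|C| 0) => C0.
  have -> : [set: C] = finset.set0.
    by apply/setP => x; have := card0_eq C0 x; rewrite !inE.
  rewrite subrr big1// => B _; rewrite /up /dn.
  by rewrite !big1 ?subrr// => j; have := card0_eq C0 j; rewrite !inE.
have T0 : [set: C] != finset.set0 by rewrite -card_gt0 cardsT lt0n.
rewrite (bigD1 [set: C])//= (bigD1 finset.set0) 1?eq_sym//= big1.
  by rewrite upT dnT up0 dn0 (negbTE C0) subr0 sub0r addr0.
by move=> B /andP[BT B0]; rewrite upE// dnE// subrr.
Qed.

End shapley.

(** * The edge-vertex inequality *)

Section edge_vertex.
Variables (R : realType) (C : finType) (q : R) (V : eqType).
Variable Y : V -> {set C} -> R.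
Hypothesis q01 : 0 <= q <= 1.
Hypothesis Y01 : forall v w, (Y v w == 0) || (Y v w == 1).
Implicit Types (A w : {set C}) (B D : seq V) (f g : {set C} -> R).

Let Y0 v w : 0 <= Y v w.
Proof. by case/orP: (Y01 v w) => /eqP->. Qed.

(** Jensen's inequality: revealing one more seed spreads the pair of conditional expectations, and
    [relent] is jointly convex. *)
Lemma relent_cE A (j : C) f g : j \notin A ->
  (forall w, 0 <= f w <= g w) ->
  Ex q (fun w => relent (cE q A f w) (cE q A g w)) <=
  Ex q (fun w => relent (cE q (j |: A) f w) (cE q (j |: A) g w)).
Proof.
move=> jA fg; rewrite [leRHS](two_point q _ j); apply: ler_Ex => // w.
rewrite !(cE_tower q _ _ jA); apply: relent_convex => //.
- rewrite cE_ge0 ?ler_cE// => w'; by have /andP[] := fg w'.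
- rewrite cE_ge0 ?ler_cE// => w'; by have /andP[] := fg w'.
Qed.

Definition rest B w : R := 1 - \sum_(v <- B) Y v w.

(* Up to sign, the conditional entropy given the coordinates in [A] of the
   variable telling which v in B, if any, has Y v = 1. *)
Definition info B A : R :=
  Ex q (fun w => \sum_(v <- B) xlnx (cE q A (Y v) w) + xlnx (cE q A (rest B) w)).

Lemma info_perm B B' A : perm_eq B B' -> info B A = info B' A.
Proof.
move=> BB'; apply: eq_bigr => w _; congr (_ * (_ + xlnx _)).
  exact: perm_big.
by apply: eq_cE => w'; rewrite /rest (perm_big _ BB').
Qed.

(** The chain rule of entropy: adding [D] only splits the outcome that no point of [B] is chosen, so
    the terms of [B] cancel and relative terms with respect to [rest B] remain. *)
Lemma info_cat B D A :
  (forall w, \sum_(v <- B ++ D) Y v w <= 1) ->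
  info (B ++ D) A - info B A =
  \sum_(v <- D) Ex q (fun w => relent (cE q A (Y v) w) (cE q A (rest B) w)) +
  Ex q (fun w => relent (cE q A (rest (B ++ D)) w) (cE q A (rest B) w)).
Proof.
move=> _; rewrite -Ex_sum -ExD -sumrB; apply: eq_bigr => w _; rewrite -mulrBr.
congr (_ * _); rewrite big_cat /= addrAC -addrA (addrAC (\sum_(v <- B) _)).
rewrite [X in _ + X + _]addrC -!addrA.
have e : \sum_(v <- D) cE q A (Y v) w + cE q A (rest (B ++ D)) w
    = cE q A (rest B) w.
  rewrite -cE_sum -[LHS]big_split; apply: eq_bigr => w' _ /=.
  by rewrite -mulrDr /rest big_cat /=; congr (_ * _); ring.
rewrite /relent sumrB -mulr_suml /xlnx.
move: e; set a := \sum_(v <- D) _; set b := cE q A (rest (B ++ D)) w => <-.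
set x := \sum_(v <- B) _; set y := \sum_(v <- D) _.
move: (ln (a + b)) (ln b) => l m; ring.
Qed.

(** Exchanging the order of the two differences, the chain rule turns the claim into the growth of
    each relative term under further conditioning. This is what makes the Shapley shares grow with
    the set of observed vertices. *)
Lemma info_mono B D A (j : C) : j \notin A ->
  (forall w, \sum_(v <- B ++ D) Y v w <= 1) ->
  info B (j |: A) - info B A <= info (B ++ D) (j |: A) - info (B ++ D) A.
Proof.
move=> jA BD; rewrite -subr_ge0.
rewrite (_ : _ - _ = (info (B ++ D) (j |: A) - info B (j |: A)) -
  (info (B ++ D) A - info B A)); last by ring.
rewrite !info_cat// subr_ge0; have rBD w : 0 <= rest (B ++ D) w.
  by rewrite subr_ge0.
have rE w : rest B w = rest (B ++ D) w + \sum_(v <- D) Y v w.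
  by rewrite /rest big_cat opprD addrA subrK.
apply: lerD.
  rewrite big_seq [leRHS]big_seq; apply: ler_sum => v vD; apply: relent_cE => // w.
  rewrite Y0 rE (big_rem v)//= addrCA lerDl addr_ge0// sumr_ge0// => *; exact: Y0.
by apply: relent_cE => // w; rewrite rBD rE lerDl sumr_ge0.
Qed.

Lemma info_nil A : info [::] A = 0.
Proof.
rewrite -[RHS](Ex_cst C q _); apply: eq_bigr => w _; congr (_ * _).
rewrite big_nil add0r (eq_cE _ _ _ (g := fun=> 1)) ?cE_cst ?/xlnx ?ln1 ?mulr0//.
by move=> w'; rewrite /rest big_nil subr0.
Qed.

Lemma info_set0 B : info B finset.set0 =
  \sum_(v <- B) xlnx (Ex q (Y v)) + xlnx (1 - \sum_(v <- B) Ex q (Y v)).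
Proof.
rewrite -[RHS](Ex_cst C q _); apply: eq_bigr => w _; congr (_ * (_ + xlnx _)).
  by apply: eq_bigr => v _; rewrite cE_0.
by rewrite cE_B cE_cst// cE_sum; congr (_ - _); apply: eq_bigr => v _; rewrite cE_0.
Qed.

Lemma info_setT B : (forall w, \sum_(v <- B) Y v w <= 1) ->
  info B [set: C] = 0.
Proof.
have xlnx01 (x : R) : (x == 0) || (x == 1) -> xlnx x = 0.
  by case/orP => /eqP->; rewrite /xlnx ?mul0r// ln1 mulr0.
move=> h; rewrite -[RHS](Ex_cst C q _); apply: eq_bigr => w _; congr (_ * _).
rewrite big1 => [|v _]; last by rewrite cE_T// xlnx01.
rewrite add0r cE_T// xlnx01//.
have [n En] : exists n : nat, \sum_(v <- B) Y v w = n%:R.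
  elim: (B) => [|v B' [n IH]]; first by exists 0%N; rewrite big_nil.
  rewrite big_cons IH; case/orP: (Y01 v w) => /eqP->.
    by exists n; rewrite add0r.
  by exists n.+1; rewrite -natr1 addrC.
have := h w; rewrite /rest En (ler_nat R n 1).
by case: n {En} => [|[|//]] _; rewrite ?subr0 ?subrr eqxx ?orbT.
Qed.

Lemma sum_shapley_info B : (forall w, \sum_(v <- B) Y v w <= 1) ->
  \sum_j shapley (info B) j = - info B finset.set0.
Proof. by move=> h; rewrite sum_shapley info_setT// sub0r. Qed.

Lemma shapley_info_mono B B1 D j : perm_eq B1 (B ++ D) ->
  (forall w, \sum_(v <- B1) Y v w <= 1) ->
  shapley (info B) j <= shapley (info B1) j.
Proof.
move=> p h; apply: ler_shapley => A jA; rewrite !(info_perm _ p).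
by apply: info_mono => // w; rewrite -(perm_big _ p).
Qed.

Lemma shapley_info_ge0 B j : (forall w, \sum_(v <- B) Y v w <= 1) ->
  0 <= shapley (info B) j.
Proof.
move=> h; have := @shapley_info_mono [::] B B j (perm_refl _) h.
by rewrite [X in X <= _]shapley0// => A _; rewrite !info_nil.
Qed.

Lemma shapley_info_indep B j : (forall v, v \in B -> indep j (Y v)) ->
  shapley (info B) j = 0.
Proof.
move=> h; apply: shapley0 => A jA; apply: eq_bigr => w _.
congr (_ * (_ + xlnx _)).
  rewrite big_seq [RHS]big_seq.
  by apply: eq_bigr => v vB; rewrite cE_indep//; exact: h.
by apply: cE_indep => // w'; rewrite /rest !big_seq; congr (_ - _);
  apply: eq_bigr => v vB; rewrite h.
Qed.

Lemma shapley_info_flip (s : C -> C) (fl : V -> V) B j : involutive s ->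
  (forall v w, v \in B -> Y (fl v) w = Y v (s @: w)) ->
  shapley (info (map fl B)) j = shapley (info B) (s j).
Proof.
move=> sK Yfl; apply: shapley_inv => // A.
have sKi : involutive (fun B : {set C} => s @: B).
  by move=> w; rewrite -imset_comp (eq_imset _ sK) imset_id.
rewrite /info /Ex [RHS](reindex_inj (inv_inj sKi)) /=; apply: eq_bigr => w _.
congr (_ * (_ + xlnx _)).
- rewrite /wt card_imset; last exact: inv_inj.
  congr (_ * _ ^+ _); apply/eqP; rewrite -(card_imset _ (inv_inj sK)); apply/eqP.
  apply: eq_card => x; rewrite -[x]sK !inE !mem_imset ?inE//; exact: inv_inj.
- rewrite big_map big_seq [RHS]big_seq; apply: eq_bigr => v vB.
  by congr xlnx; apply: cE_inv => // w'; exact: Yfl.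
- apply: cE_inv => // w'; rewrite /rest big_map; congr (_ - _).
  by rewrite big_seq [RHS]big_seq; apply: eq_bigr => v vB; rewrite Yfl.
Qed.

(** [S] plays the role of the seeds on one side of an edge. In the entropy of [B1], the shares of
    seeds in [S] are bounded below through [B], those of the other seeds through the flipped copy of
    [B]. A seed with both [j] and [s j] in [S] is one that a truncated flip fails to carry across;
    it is harmless because [B] does not depend on it. *)
Lemma edge_info_ge (s : C -> C) (fl : V -> V) (S : {set C}) B B1 D D' :
  involutive s ->
  (forall v w, v \in B -> Y (fl v) w = Y v (s @: w)) ->
  perm_eq B1 (B ++ D) -> perm_eq B1 (map fl B ++ D') ->
  (forall w, \sum_(v <- B1) Y v w <= 1) ->
  (forall j, j \notin S -> s j \in S) ->
  (forall j v, j \in S -> s j \in S -> v \in B -> indep j (Y v)) ->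
  2 * \sum_(j in S) shapley (info B) j <= - info B1 finset.set0.
Proof.
move=> sK Yfl p p' h sS far; rewrite -sum_shapley_info//.
rewrite [leRHS](bigID (mem S)) /= mulr2n mulrDl mul1r; apply: lerD.
  by apply: ler_sum => j _; exact: shapley_info_mono p h.
apply: (@le_trans _ _ (\sum_(j | j \notin S) shapley (info B) (s j))); last first.
  apply: ler_sum => j _; rewrite -(shapley_info_flip j sK Yfl).
  exact: shapley_info_mono p' h.
rewrite le_eqVlt; apply/orP; left; apply/eqP.
(* Reflecting the second sum turns it into a sum over [j] with [s j] outside [S]; such [j] lie in
   [S], and the rest of [S] has zero share. *)
rewrite [RHS](reindex_inj (inv_inj sK)) /= [RHS](eq_bigr (shapley (info B))); last first.
  by move=> j _; rewrite sK.
rewrite (bigID (fun j => s j \in S)) /= big1 ?add0r; last first.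
  by move=> j /andP[jS sjS]; apply: shapley_info_indep => v; exact: far.
apply: eq_bigl => j; case: (boolP (s j \in S)) => //=; rewrite ?andbF//.
by move=> /sS; rewrite sK => ->.
Qed.

End edge_vertex.

(* The edge-vertex entropy inequality for a field [Y] built from independent
   seeds: [B] plays the role of a vertex, [B1 i] of its i-th edge. *)
Lemma edge_vertex (R : realType) (C : finType) (q : R) (V : eqType)
    (Y : V -> {set C} -> R) (I : finType) (s : I -> C -> C) (fl : I -> V -> V)
    (S : I -> {set C}) (B : seq V) (B1 D D' : I -> seq V) :
  0 <= q <= 1 -> (forall v w, (Y v w == 0) || (Y v w == 1)) ->
  (forall i, involutive (s i)) ->
  (forall i v w, v \in B -> Y (fl i v) w = Y v (s i @: w)) ->
  (forall i, perm_eq (B1 i) (B ++ D i)) ->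
  (forall i, perm_eq (B1 i) (map (fl i) B ++ D' i)) ->
  (forall i w, \sum_(v <- B1 i) Y v w <= 1) ->
  (forall i j, j \notin S i -> s i j \in S i) ->
  (forall i j v, j \in S i -> s i j \in S i -> v \in B -> indep j (Y v)) ->
  (forall j, (#|I|.-1 <= #|[pred i | j \in S i]|)%N) -> (0 < #|I|)%N ->
  2 * #|I|.-1%:R * - info q Y B finset.set0 <=
  \sum_i - info q Y (B1 i) finset.set0.
Proof.
move=> q01 Y01 sK Yfl p p' h sS far dS I0.
have hB w : \sum_(v <- B) Y v w <= 1.
  have [i _] : exists i : I, true by case/card_gt0P: I0 => i _; exists i.
  apply: le_trans (h i w); rewrite (perm_big _ (p i)) big_cat lerDl.
  by apply: sumr_ge0 => v _; case/orP: (Y01 v w) => /eqP->.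
apply: le_trans (ler_sum _ (fun i _ => edge_info_ge q01 Y01 (sK i) (Yfl i)
  (p i) (p' i) (h i) (sS i) (far i))).
rewrite -mulr_sumr -mulrA ler_wpM2l//.
under eq_bigr do rewrite big_mkcond.
(* After the exchange each seed is counted once for every [i] with [j] in [S i], hence at least
   [#|I|.-1] times, and its share is nonnegative. *)
rewrite exchange_big /= -sum_shapley_info// mulr_sumr; apply: ler_sum => j _.
rewrite -big_mkcond sumr_const -[leRHS]mulr_natl ler_wpM2r ?shapley_info_ge0//.
by rewrite ler_nat (leq_trans (dS j)).
Qed.

From mathcomp Require Import all_classical all_reals all_analysis.

Import numFieldNormedType.Exports.

Local Open Scope classical_set_scope.
Local Open Scope ring_scope.

(** * From the entropy inequality to an explicit density bound *)

Section density_bound.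
Variable R : realType.
Implicit Types (x y k p : R).

Lemma is_derive_xlnx_lin k x : 0 < 1 - k * x ->
  is_derive x 1 (fun z : R => xlnx (1 - k * z)) (- k * (ln (1 - k * x) + 1)).
Proof.
move=> h.
have d1 : is_derive x 1 (fun z : R => 1 - k * z) (- k).
  apply: (@is_derive_eq _ _ _ (cst 1 - k \*: (@id R))).
  by rewrite sub0r /GRing.scale /= mulr1.
have d2 := @is_derive1_comp R (@ln R) (fun z => 1 - k * z) x _ _ (is_derive1_ln h) d1.
have d3 := is_deriveM d1 d2.
apply: (@is_derive_eq _ _ _ _ _ _ _ _ d3); rewrite /GRing.scale /=.
by rewrite mulrA divff ?gt_eqF//; ring.
Qed.

(** The first order terms at 0 agree, and the gap is the second order gain on which the density
    estimate rests. The difference of the two sides vanishes at 0 and has nonnegative derivative. *)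
Lemma xlnx_gap k x : 1 <= k -> 0 <= x -> k * x < 1 ->
  k * (k - 1) * x ^+ 2 / 2 <= xlnx (1 - k * x) - k * xlnx (1 - x).
Proof.
move=> k1 x0 kx1.
pose F (z : R) := xlnx (1 - k * z) - k * xlnx (1 - 1 * z) - (k * (k - 1) / 2) * z ^+ 2.
pose dF (z : R) := - k * (ln (1 - k * z) + 1) - k * (- 1 * (ln (1 - 1 * z) + 1))
  - (k * (k - 1) / 2) * (2 * z).
have kz z : 0 <= z -> z <= x -> 0 < 1 - k * z /\ 0 < 1 - 1 * z.
  move=> z0 zx; have : k * z <= k * x by rewrite ler_wpM2l//; lra.
  have : 1 * z <= k * z by rewrite ler_wpM2r.
  by move=> *; split; lra.
have dFz z : z \in `[0, x]%R -> is_derive z 1 F (dF z).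
  rewrite in_itv /= => /andP[z0 zx]; have [h1 h2] := kz z z0 zx.
  have e1 := is_derive_xlnx_lin h1; have e2 := is_derive_xlnx_lin h2.
  have e3 := is_deriveB (is_deriveB e1 (is_deriveZ k e2))
    (is_deriveZ (k * (k - 1) / 2) (is_deriveX 2 (is_derive_id z 1))).
  apply: (@is_derive_eq _ _ _ _ _ _ _ _ e3).
  by rewrite /GRing.scale /= /dF expr1 mulr1.
have cF : {within `[0, x], continuous F}.
  by apply: derivable_within_continuous => z zx; have [] := dFz z zx.
have dFz' z : z \in `]0, x[%R -> is_derive z 1 F (dF z).
  by rewrite in_itv /= => /andP[z0 zx]; apply: dFz; rewrite in_itv /= !ltW.
have [c cx] := MVT_segment x0 dFz' cF.
have F0 : F 0 = 0 by rewrite /F !mulr0 subr0 /xlnx ln1; ring.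
rewrite F0 !subr0 => Fx.
suff : 0 <= F x by rewrite /F mul1r; lra.
rewrite Fx mulr_ge0//.
move: cx; rewrite in_itv /= => /andP[c0 cx]; have [h1 h2] := kz c c0 cx.
have := @ln_ge_subinv R ((1 - 1 * c) / (1 - k * c)); rewrite divr_gt0// => /(_ isT).
rewrite invf_div ln_div ?posrE// => h.
have -> : dF c = k * (ln (1 - 1 * c) - ln (1 - k * c) - (k - 1) * c) by rewrite /dF; field.
rewrite mulr_ge0//; first by lra.
rewrite subr_ge0; apply: le_trans h.
have : 1 - k * c <= (1 - (k - 1) * c) * (1 - 1 * c).
  suff : 0 <= (k - 1) * c * c by lra.
  by rewrite !mulr_ge0// subr_ge0.
by rewrite -ler_pdivrMr//; lra.
Qed.

Lemma xlnx_tangent x y : 0 < x -> 0 <= y ->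
  xlnx x + (y - x) * (1 + ln x) <= xlnx y.
Proof.
move=> x0; rewrite le0r => /orP[/eqP->|y0].
  by rewrite /xlnx mul0r; lra.
have := @ln_ge_subinv R (y / x); rewrite divr_gt0// => /(_ isT).
rewrite invf_div ln_div ?posrE// -(ler_pM2l y0) mulrBr mulr1 mulrCA divff ?gt_eqF// mulr1.
by rewrite /xlnx; lra.
Qed.

Lemma density_ineq (d N M : nat) p : (3 <= d)%N ->
  (d * M = 2 * d.-1 * N + 2)%N -> 0 <= p -> N%:R * p <= 4^-1 -> M%:R * p <= 1 ->
  2 * d.-1%:R * - (N%:R * xlnx p + xlnx (1 - N%:R * p)) <=
  d%:R * - (M%:R * xlnx p + xlnx (1 - M%:R * p)) ->
  (N%:R ^+ 2 * p ^+ 2) / 3 <= p - xlnx p.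
Proof.
move=> d3 dM p0 Np Mp H.
have dE : (d.-1%:R : R) = d%:R - 1 by case: d d3 {dM H} => // d _; rewrite -natr1 addrK.
have d3R : (3 : R) <= d%:R by rewrite (ler_nat R 3 d).
have d0 : (d%:R : R) != 0 by apply/lt0r_neq0; lra.
have dMR : d%:R * M%:R = 2 * (d%:R - 1) * N%:R + 2 :> R.
  by rewrite -dE -!natrM dM natrD !natrM.
rewrite dE in H.
(* The ratio for which $M = kN + 2/d$. As $d \ge 3$ it lies between $4/3$ and 2, and $Np \le 1/4$
   keeps $kNp$ below 1. *)
pose k : R := 2 * (d%:R - 1) / d%:R.
have kd : k * d%:R = 2 * (d%:R - 1) by rewrite /k divfK.
have k1 : 4 / 3 <= k by rewrite /k ler_pdivlMr; lra.
have k2 : k <= 2 by rewrite /k ler_pdivrMr; lra.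
set x := N%:R * p in Np H *; set y := M%:R * p in Mp H.
have x0 : 0 <= x by rewrite mulr_ge0.
have yE : y = k * x + 2 / d%:R * p.
  have e1 : d%:R * (k * x) = 2 * (d%:R - 1) * x by rewrite mulrA (mulrC _ k) kd.
  have e2 : d%:R * (2 / d%:R * p) = 2 * p by field.
  by apply: (mulfI d0); rewrite mulrDr e1 e2 /y mulrA dMR /x; ring.
have kx1 : k * x < 1 by have := ler_wpM2r x0 k2; lra.
have g := xlnx_gap (le_trans _ k1) x0 kx1.
have {}g : k * (k - 1) * x ^+ 2 / 2 <= xlnx (1 - k * x) - k * xlnx (1 - x) by apply: g; lra.
have t := @xlnx_tangent (1 - k * x) (1 - y); rewrite subr_gt0 kx1 subr_ge0 Mp in t.
have {}t := t isT isT.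
have l0 : ln (1 - k * x) <= 0 by rewrite ln_le0// gerBl mulr_ge0//; lra.
have dp0 : 0 <= 2 / d%:R * p by rewrite mulr_ge0// divr_ge0.
have s : xlnx (1 - k * x) - 2 / d%:R * p <= xlnx (1 - y).
  apply: le_trans t; rewrite lerD2l.
  have -> : 1 - y - (1 - k * x) = - (2 / d%:R * p) by rewrite yE; ring.
  rewrite mulNr lerN2 mulrDr mulr1 gerDl.
  by rewrite mulr_ge0_le0.
have {}s := lerD g s.
have {s} : d%:R * (k * (k - 1) * x ^+ 2 / 2) - 2 * p + 2 * (d%:R - 1) * xlnx (1 - x) <= d%:R * xlnx (1 - y).
  have := ler_wpM2l (ler0n R d) s; rewrite -kd.
  have -> : 2 * p = d%:R * (2 / d%:R * p) by rewrite mulrA mulrCA divff// mulr1.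
  by lra.
(* Here $kd = 2(d-1) \ge 4$ and $k-1 \ge 1/3$; halving at the end gives the constant 3 of the
   statement. *)
have c : 2 / 3 * x ^+ 2 <= d%:R * (k * (k - 1) * x ^+ 2 / 2).
  have -> : d%:R * (k * (k - 1) * x ^+ 2 / 2) = ((k * d%:R) * (k - 1) / 2) * x ^+ 2 by ring.
  rewrite ler_wpM2r ?sqr_ge0// kd.
  have : 4 * (1 / 3) <= (2 * (d%:R - 1)) * (k - 1) by apply: ler_pM; lra.
  by lra.
rewrite -exprMn -/x => e.
have mm : 2 * (d%:R - 1) * (N%:R * xlnx p) + 2 * xlnx p = d%:R * (M%:R * xlnx p).
  by rewrite [RHS]mulrA dMR; ring.
by lra.
Qed.

(** The hypothesis bounds $N^2p$ by $3(1-\ln p)$. Either [p] is already below $(d-1)^{-2k}$, or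
    $-\ln p$ is at most $2k\ln(d-1) \le 2kd$. *)
Lemma density_bound (d k N : nat) p : (3 <= d)%N -> 0 <= p <= 1 ->
  (d.-1 ^ k <= N)%N -> (N%:R ^+ 2 * p ^+ 2) / 3 <= p - xlnx p ->
  p <= (3 + 6 * (k * d)%:R) / (d.-1%:R ^+ (2 * k)).
Proof.
move=> d3 /andP[p0 p1] kN H.
have D0 : (0 : R) < d.-1%:R by rewrite ltr0n; case: d d3 {kN}=> [|[]].
set D : R := d.-1%:R in D0 *.
have Dk0 : 0 < D ^+ (2 * k) by rewrite exprn_gt0.
rewrite ler_pdivlMr//.
have [le|gt] := leP p (D ^- (2 * k)).
  have : p * D ^+ (2 * k) <= 1 by rewrite -ler_pdivlMr// div1r.
  by move=> h; apply: le_trans h _; rewrite -[1]addr0 lerD ?mulr_ge0//; lra.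
have {}p0 : 0 < p by apply: le_lt_trans gt; rewrite invr_ge0 ltW.
have lp : - ln p <= 2 * (k * d)%:R.
  have : ln (D ^- (2 * k)) <= ln p by rewrite ler_ln ?posrE ?invr_gt0// ltW.
  rewrite lnV ?posrE// lnXn// => h.
  have lD : ln D <= d%:R.
    apply: le_trans (ltW (ln_sublinear D0)) _; rewrite ler_nat; exact: leq_pred.
  have : ln D *+ (2 * k) <= d%:R *+ (2 * k) by rewrite lerMn2r lD orbT.
  rewrite -[_ *+ _ in X in _ <= X]mulr_natr -natrM (_ : 2 * (k * d)%:R = (d * (2 * k))%:R :> R).
    by lra.
  by rewrite -natrM; congr (_%:R); lia.
have kNR : D ^+ (2 * k) <= N%:R ^+ 2.
  by rewrite mulnC exprM lerXn2r ?nnegrE ?exprn_ge0 ?ler0n ?(ltW D0)// /D -natrX ler_nat.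
have : N%:R ^+ 2 * p <= 3 * (1 - ln p).
  rewrite -(ler_pM2l p0); move: H; rewrite /xlnx expr2 => H.
  by move: (ln p) H => l H; lra.
have := ler_wpM2r (ltW p0) kNR; rewrite [p * _]mulrC.
by lra.
Qed.

End density_bound.

(** * Symmetries of the tree *)

Section flip.
Variables (R : realType) (d : nat).
Implicit Types (i j : 'I_d) (w : seq 'I_d) (v : vertex d) (e : edge d).
Local Notation T := (regular_tree R d).
Local Notation vtx v := (inl v : T).

(* Right multiplication by the generator i. *)
Fixpoint flip_word i w : seq 'I_d :=
  if w is a :: u then
    if u is [::] then (if a == i then [::] else [:: a; i])
    else a :: flip_word i u
  else [:: i].

Lemma flip_word_cons i a b u :
  flip_word i [:: a, b & u] = a :: flip_word i (b :: u).
Proof. by []. Qed.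

Lemma flip_word_reduced i w : reduced w -> reduced (flip_word i w).
Proof.
elim: w => [//|a [|b u] IH] rw; first by rewrite /=; case: ifPn => // ai; rewrite /reduced /= ai.
rewrite flip_word_cons; have /= := rw; rewrite /reduced /= => /andP[ab pu].
have := IH (reduced_behead rw); case: (u) pu => [|c t] pu /=.
  by case: ifPn => // bi; rewrite /reduced /= ab => ->.
by rewrite /reduced /= ab.
Qed.

Lemma flip_wordK i w : reduced w -> flip_word i (flip_word i w) = w.
Proof.
elim: w => [|a [|b u] IH] rw; first by rewrite /= eqxx.
  by rewrite /=; case: eqVneq => [->//|ai] /=; rewrite eqxx.
rewrite flip_word_cons; have IH' := IH (reduced_behead rw).
case E: (flip_word i (b :: u)) => [|c t]; last by rewrite flip_word_cons -E IH'.
rewrite E /= in IH'; move: IH' => [ib u0]; move: rw; rewrite /= -ib -u0 /reduced /= andbT.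
by move=> /negbTE->.
Qed.

Lemma flip_word_behead i w : w != [::] -> w != [:: i] ->
  behead (flip_word i w) = flip_word i (behead w).
Proof.
case: w => [//|a [|b u]] _ //; case: (eqVneq a i) => [->|ai _] //=.
  by rewrite eqxx.
by rewrite (negbTE ai).
Qed.

Lemma flip_word_ohead i w : w != [::] -> w != [:: i] ->
  ohead (flip_word i w) = ohead w.
Proof.
case: w => [//|a [|b u]] _ //; case: (eqVneq a i) => [->|ai _] //=.
  by rewrite eqxx.
by rewrite (negbTE ai).
Qed.

Lemma flip_word_nil i w : w != [:: i] -> flip_word i w != [::].
Proof.
by case: w => [//|a [|b u]] //=; case: (eqVneq a i) => [->|//]; rewrite eqxx.
Qed.

Lemma size_flip_word i w : (size (flip_word i w) <= (size w).+1)%N.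
Proof. by elim: w => [//|a [|b u] IH]; [rewrite /=; case: ifP|rewrite flip_word_cons]. Qed.

Definition flip_vertex i v : vertex d :=
  exist _ (flip_word i (val v)) (flip_word_reduced i (valP v)).

Lemma flip_vertexK i : involutive (flip_vertex i).
Proof. by move=> v; apply/val_inj/flip_wordK/(valP v). Qed.

(* Meaningful only for the edges other than the one joining the root and [i]. *)
Definition flip_edge i e : edge d := insubd e (flip_vertex i (val e)).

Lemma val_flip_edge i e : val (val e) != [:: i] ->
  val (val (flip_edge i e)) = flip_word i (val (val e)).
Proof. by move=> h; rewrite /flip_edge insubdK//; exact: flip_word_nil. Qed.

Lemma edge_eqP e e' : val (val e) = val (val e') -> e = e'.
Proof. by move=> h; apply/val_inj/val_inj. Qed.

Lemma flip_edge_src i e : val (val e) != [:: i] ->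
  edge_src (flip_edge i e) = flip_vertex i (edge_src e).
Proof.
move=> h; apply/val_inj; rewrite /= val_flip_edge// flip_word_behead//.
exact: (valP e).
Qed.

Lemma flip_edge_tgt i e : val (val e) != [:: i] ->
  edge_tgt (flip_edge i e) = flip_vertex i (edge_tgt e).
Proof. by move=> h; apply/val_inj; rewrite /= val_flip_edge. Qed.

Lemma flip_edge_src0 i e : val (val e) = [:: i] ->
  edge_src e = tree_root d /\ flip_vertex i (edge_src e) = edge_tgt e.
Proof. by move=> h; split; apply/val_inj; rewrite /= h. Qed.

Lemma flip_edge_tgt0 i e : val (val e) = [:: i] ->
  flip_vertex i (edge_tgt e) = edge_src e.
Proof. by move=> h; apply/val_inj; rewrite /= /edge_tgt h /= eqxx. Qed.

Definition flip_point i (x : T) : T :=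
  match x with
  | inl v => inl (flip_vertex i v)
  | inr (e, s) => if val (val e) == [:: i] then edge_point e (1 - val s)
                  else edge_point (flip_edge i e) (val s)
  end.

Lemma edge_point_cases (s : R) : 0 <= s <= 1 ->
  [\/ s = 0, s = 1 | 0 < s < 1].
Proof.
move=> /andP[]; rewrite !le_eqVlt => /orP[/eqP<-|s0]; first by constructor.
by case/orP => [/eqP->|s1]; [constructor 2|constructor 3; rewrite s0].
Qed.

Lemma edge_point_inr e (s : R) (hs : 0 < s < 1) :
  edge_point e s = inr (e, exist _ s hs).
Proof. by rewrite -[s in LHS]/(val (exist (fun s : R => 0 < s < 1) s hs)) edge_point_inner. Qed.

Lemma onem01 (s : R) : 0 <= s <= 1 -> 0 <= 1 - s <= 1.
Proof. by move=> /andP[*]; apply/andP; split; lra. Qed.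

Lemma flip_edge_point i e (s : R) : 0 <= s <= 1 -> val (val e) != [:: i] ->
  flip_point i (edge_point e s) = edge_point (flip_edge i e) s.
Proof.
move=> s01 h; case: (edge_point_cases s01) => [->|->|s0].
- by rewrite !edge_point0 /= flip_edge_src.
- by rewrite !edge_point1 /= flip_edge_tgt.
- by rewrite (edge_point_inr e s0) /= (negbTE h).
Qed.

Lemma flip_edge_point0 i e (s : R) : 0 <= s <= 1 -> val (val e) = [:: i] ->
  flip_point i (edge_point e s) = edge_point e (1 - s).
Proof.
move=> s01 h; case: (edge_point_cases s01) => [->|->|s0].
- by rewrite edge_point0 subr0 edge_point1 /=; have [_ ->] := flip_edge_src0 h.
- by rewrite edge_point1 subrr edge_point0 /= flip_edge_tgt0.
- by rewrite (edge_point_inr e s0) /= h eqxx.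
Qed.

Lemma flip_point_ex i e : exists e', exists g : R -> R,
  forall s, 0 <= s <= 1 ->
    [/\ flip_point i (edge_point e s) = edge_point e' (g s), 0 <= g s <= 1 &
      forall t, `|g s - g t| = `|s - t|].
Proof.
case: (eqVneq (val (val e)) [:: i]) => h.
  exists e, (fun s => 1 - s) => s s01; split; first exact: flip_edge_point0.
    exact: onem01.
  by move=> t; rewrite opprB addrC addrA subrK distrC.
by exists (flip_edge i e), id => s s01; split=> //; exact: flip_edge_point.
Qed.

Lemma flip_path_length i (x y : T) l :
  path_length x y l -> path_length (flip_point i x) (flip_point i y) l.
Proof.
elim=> [{}x|e a b {}y {}l ha hb _ IH]; first exact: path_length_nil.
have [e' [g h]] := flip_point_ex i e.
have [ea ga hg] := h a ha; have [eb gb _] := h b hb.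
by rewrite ea -(hg b); apply: path_length_cons => //; rewrite -eb.
Qed.

Lemma flip_pointK i : involutive (flip_point i).
Proof.
case=> [v|[e s]] /=; first by rewrite flip_vertexK.
have s01 : 0 <= val s <= 1 by have /andP[? ?] := valP s; rewrite !ltW.
case: eqVneq => h.
  rewrite flip_edge_point0//; last exact: onem01.
  by rewrite opprB addrCA subrr addr0 edge_point_inner.
have hn : val (val (flip_edge i e)) != [:: i].
  rewrite val_flip_edge//; apply/eqP => h1.
  have := flip_wordK i (valP (val e)); rewrite h1 /= eqxx => e0.
  by have := valP e; rewrite /= -e0.
rewrite flip_edge_point// (_ : flip_edge i (flip_edge i e) = e) ?edge_point_inner//.
by apply: edge_eqP; rewrite (val_flip_edge hn) (val_flip_edge h) flip_wordK//; exact: (valP (val e)).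
Qed.

Lemma mdist_flip i (x y : T) :
  mdist (flip_point i x) (flip_point i y) = mdist x y.
Proof.
have le u t : mdist (flip_point i u) (flip_point i t) <= mdist u t :> R.
  by rewrite !mdist_treeE; apply: tree_dist_ge => l h; apply: tree_dist_le;
    exact: flip_path_length.
apply/eqP; rewrite eq_le le /= -[X in X <= _](_ : mdist (flip_point i (flip_point i x))
  (flip_point i (flip_point i y)) = _) ?le// !flip_pointK//.
Qed.

Definition half_edge_word v i := if ohead (val v) == Some i then val v else i :: val v.

Lemma half_edge_word_reduced v i : reduced (half_edge_word v i).
Proof.
rewrite /half_edge_word; case: ifPn => [_|]; first exact: (valP v).
case: v => -[|j w] //= rw h; rewrite /reduced /= in rw *.
by rewrite rw andbT; apply: contra h => /eqP ->.
Qed.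

Lemma half_edge_word_nil v i : half_edge_word v i != [::].
Proof. by rewrite /half_edge_word; case: ifPn => //; case: (val v). Qed.

(* The edge of color [i] at [v]. *)
Definition half_edge v i : edge d :=
  exist _ (exist _ (half_edge_word v i) (half_edge_word_reduced v i))
    (half_edge_word_nil v i).

Definition half_pos v i (a : R) : R := if ohead (val v) == Some i then 1 - a else a.

(* The point at distance [a] from [v] on the edge of color [i] at [v]. *)
Definition pt v i (a : R) : T := edge_point (half_edge v i) (half_pos v i a).

Lemma half_pos01 v i a : 0 <= a <= 1 -> 0 <= half_pos v i a <= 1.
Proof.
by rewrite /half_pos; case: ifP => // _ /andP[a0 a1]; apply/andP; split; lra.
Qed.

Lemma half_posB v i a b : `|half_pos v i a - half_pos v i b| = `|a - b|.
Proof.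
rewrite /half_pos; case: ifP => // _.
by rewrite opprB addrC addrA subrK distrC.
Qed.

(** Coordinates by vertex, color and distance ignore which end of the edge is the parent, so a flip
    acts on the vertex alone, even on the one edge that it reverses. *)
Lemma flip_pt j v i a : 0 <= a <= 1 ->
  flip_point j (pt v i a) = pt (flip_vertex j v) i a.
Proof.
move=> a01; have s01 := half_pos01 v i a01; rewrite /pt.
case: (eqVneq (val v) [::]) => [v0|v0].
  have vr : v = tree_root d by exact/val_inj.
  case: (eqVneq i j) => ij.
    rewrite flip_edge_point0//; last by rewrite /= /half_edge_word v0 /= ij.
    rewrite vr ij /half_pos /= eqxx; congr (edge_point _ _).
    by apply: edge_eqP; rewrite /= /half_edge_word /= eqxx.
  have w1 : val (val (half_edge v i)) = [:: i] by rewrite /= /half_edge_word v0.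
  have ne : val (val (half_edge v i)) != [:: j].
    by rewrite w1; apply: contra ij => /eqP[->].
  have jE : (Some j == Some i) = false.
    by apply/negbTE; apply: contra ij => /eqP[->].
  rewrite flip_edge_point//; rewrite vr /half_pos /= jE; congr (edge_point _ _).
  apply: edge_eqP; rewrite -vr val_flip_edge// w1 /= (negbTE ij) /half_edge_word /=.
  by rewrite vr /= jE.
case: (eqVneq (val v) [:: j]) => [vj|vj].
  have fv : val (flip_vertex j v) = [::] by rewrite /= vj /= eqxx.
  case: (eqVneq i j) => ij.
    have w1 : val (val (half_edge v i)) = [:: j] by rewrite /= /half_edge_word vj /= ij eqxx.
    rewrite flip_edge_point0// /half_pos fv vj /= ij eqxx opprB addrCA subrr addr0.
    congr (edge_point _ _); apply: edge_eqP; rewrite -{1}ij w1 -[RHS]/(half_edge_word _ _) /half_edge_word fv /= ?ij //.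
  have jE : (Some j == Some i) = false.
    by apply/negbTE; apply: contra ij => /eqP[->].
  have w1 : val (val (half_edge v i)) = [:: i; j] by rewrite /= /half_edge_word vj /= jE.
  rewrite flip_edge_point//; last by rewrite w1 eqseq_cons andbF.
  rewrite /half_pos fv vj /= jE; congr (edge_point _ _); apply: edge_eqP.
  by rewrite val_flip_edge ?w1 ?eqseq_cons ?andbF// -[RHS]/(half_edge_word _ _) /half_edge_word fv /= eqxx.
have oh : ohead (val (flip_vertex j v)) = ohead (val v) by exact: flip_word_ohead.
have ne : val (val (half_edge v i)) != [:: j].
  rewrite /= /half_edge_word; case: ifP => // _.
  by apply: contra v0 => /eqP[_ vn]; apply/eqP; exact: vn.
rewrite flip_edge_point//; rewrite /half_pos oh; congr (edge_point _ _).
apply: edge_eqP; rewrite val_flip_edge//= /half_edge_word oh; case: ifP => //.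
by case: v v0 {s01 vj oh ne} => -[].
Qed.

Lemma pt0 v i : pt v i 0 = inl v.
Proof.
rewrite /pt /half_pos; case: ifPn => h.
  rewrite subr0 edge_point1; congr inl; apply/val_inj.
  by rewrite /= /half_edge_word h.
rewrite edge_point0; congr inl; apply/val_inj.
by rewrite /= /half_edge_word (negbTE h).
Qed.

Lemma mdist_pt v i a b : 0 <= a <= 1 -> 0 <= b <= 1 ->
  mdist (pt v i a) (pt v i b) <= `|a - b|.
Proof.
move=> a01 b01; rewrite mdist_treeE -(half_posB v i); apply: tree_dist_le.
by apply: path_length1; exact: half_pos01.
Qed.

Lemma mdist_pt0 v i a : 0 <= a <= 1 -> mdist (vtx v) (pt v i a) <= a.
Proof.
move=> a01; rewrite -(pt0 v i); apply: le_trans (mdist_pt _ _ _ a01) _.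
  by rewrite lexx ler01.
by rewrite sub0r normrN ger0_norm//; case/andP: a01.
Qed.

Lemma ptE (x : T) : (0 < d)%N -> exists v, exists i, exists2 a : R,
  0 <= a <= 2^-1 & x = pt v i a.
Proof.
move=> d0; case: x => [v|[e s]].
  by exists v, (Ordinal d0), 0; rewrite ?pt0// lexx invr_ge0 ler0n.
have /andP[s0 s1] := valP s.
case E: (val (val e)) => [|i w]; first by have := valP e; rewrite /= E.
have hw : half_edge (edge_tgt e) i = e.
  by apply: edge_eqP; rewrite /= /half_edge_word /= /edge_tgt E /= eqxx.
have hh : (ohead (val (edge_src e)) == Some i) = false.
  rewrite /= E /=; have := valP (val e); rewrite E /reduced /=.
  by case: (w) => [|j u] //= /andP[ij _]; apply/negbTE; rewrite eq_sym; apply: contra ij => /eqP[->].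
have hw' : half_edge (edge_src e) i = e.
  by apply: edge_eqP; rewrite /= /half_edge_word hh /= E.
have [h|h] := leP (val s) 2^-1.
  exists (edge_src e), i, (val s); first by rewrite h ltW.
  by rewrite /pt hw' /half_pos hh edge_point_inner.
exists (edge_tgt e), i, (1 - val s); first by apply/andP; split; lra.
rewrite /pt hw /half_pos /edge_tgt E /= eqxx.
by rewrite opprB addrCA subrr addr0 edge_point_inner.
Qed.

Definition depth (x : T) : R :=
  match x with
  | inl v => (size (val v))%:R
  | inr (e, s) => (size (val (edge_src e)))%:R + val s
  end.

Lemma depthE e s : 0 <= s <= 1 ->
  depth (edge_point e s) = (size (val (edge_src e)))%:R + s.
Proof.
move=> s01; case: (edge_point_cases s01) => [->|->|s0].
- by rewrite edge_point0 addr0.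
- rewrite edge_point1 /= /edge_tgt.
  case: e => -[[|a w] rw] //= _; by rewrite natr1.
- by rewrite (edge_point_inr e s0).
Qed.

Lemma depth_le (x : T) : depth x <= mdist (vtx (tree_root d)) x.
Proof.
rewrite (metric_sym _ x) -[leLHS]subr0 -[X in _ - X](_ : depth (vtx (tree_root d)) = 0)//.
apply: tree_dist_lipschitz => e a b ha hb; rewrite !depthE//.
by rewrite opprD addrACA subrr add0r ler_norm.
Qed.

Lemma mdist_root_le v : mdist (vtx (tree_root d)) (vtx v) <= (size (val v))%:R :> R.
Proof.
case: v => w; elim: w => [|i w IH] rw.
  rewrite (_ : exist _ _ _ = tree_root d) ?mdistxx//; exact/val_inj.
pose e : edge d := exist _ (exist (@reduced d) (i :: w) rw) isT.
apply: le_trans (metric_triangle _ (vtx (edge_src e)) _) _.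
rewrite /= -natr1; apply: lerD.
  by have := IH (reduced_behead rw); congr (mdist _ (vtx _) <= _); exact: val_inj.
rewrite -(edge_point0 R e) (_ : inl _ = edge_point e 1) ?edge_point1 ?mdist_treeE//.
rewrite -edge_point1; apply: le_trans (tree_dist_le (path_length1 e _ _)) _;
  rewrite ?lexx ?ler01//.
by rewrite sub0r normrN normr1.
Qed.

Lemma mdist_rootE v : mdist (vtx (tree_root d)) (vtx v) = (size (val v))%:R :> R.
Proof. by apply/eqP; rewrite eq_le mdist_root_le (depth_le (vtx v)). Qed.

(** The candidate [m] is the shortest of the routes through the source, through the target and, if
    [z] lies on [e], along [e]. Extended by the true distance off [e], it becomes a 1-Lipschitz
    function that is at most 0 at [z], hence a lower bound for the distance. The four slopes $\pm 1$
    later bound the number of cells in a window of distances. *)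
Lemma mdist_edge (z : T) e : exists al be ga : R, forall s, 0 <= s <= 1 ->
  let r := mdist z (edge_point e s) in
  [\/ r = al + s, r = be - s, r = s - ga | r = ga - s].
Proof.
pose al := mdist z (vtx (edge_src e)); pose be := mdist z (vtx (edge_tgt e)).
pose k (s : R) := if z is inr (e', s0) then (if e' == e then `|s - val s0| else al + s) else al + s.
pose m (s : R) := Num.min (Num.min (al + s) (be + 1 - s)) (k s).
pose f (x : T) : R := match x with
  | inl _ => mdist z x
  | inr (e', s) => if e' == e then m (val s) else mdist z x end.
have ab : `|al - be| <= 1.
  have h : mdist (vtx (edge_src e)) (vtx (edge_tgt e)) <= 1 :> R.
    rewrite -(edge_point0 R) -edge_point1 mdist_treeE.
    apply: le_trans (tree_dist_le (path_length1 e _ _)) _; rewrite ?lexx ?ler01//.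
    by rewrite sub0r normrN normr1.
  have h1 := metric_triangle z (vtx (edge_src e)) (vtx (edge_tgt e)).
  have h2 := metric_triangle z (vtx (edge_tgt e)) (vtx (edge_src e)).
  rewrite (metric_sym (vtx (edge_tgt e))) in h2.
  by rewrite ler_norml /al /be; apply/andP; split; lra.
have up s : 0 <= s <= 1 -> mdist z (edge_point e s) <= m s.
  move=> s01; rewrite !le_min.
  have h0 : mdist (vtx (edge_src e)) (edge_point e s) <= s.
    rewrite -(edge_point0 R e) mdist_treeE.
    apply: le_trans (tree_dist_le (path_length1 e _ s01)) _; rewrite ?lexx ?ler01//.
    by rewrite sub0r normrN ger0_norm//; case/andP: s01.
  have h1 : mdist (vtx (edge_tgt e)) (edge_point e s) <= 1 - s.
    rewrite -(edge_point1 R e) mdist_treeE.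
    apply: le_trans (tree_dist_le (path_length1 e _ s01)) _; rewrite ?lexx ?ler01//.
    by rewrite ger0_norm// subr_ge0; case/andP: s01.
  have h2 : mdist z (edge_point e s) <= al + s.
    by apply: le_trans (metric_triangle _ (vtx (edge_src e)) _) _; rewrite lerD2l.
  rewrite h2 -addrA (le_trans (metric_triangle _ (vtx (edge_tgt e)) _)) ?lerD2l//=.
  rewrite /k; case E: z h2 => [//|[e' s0]] h2; case: eqVneq => // ee.
  rewrite -edge_point_inner ee mdist_treeE distrC; apply: tree_dist_le.
  apply: path_length1 => //; have /andP[? ?] := valP s0; by rewrite !ltW.
have fE s : 0 <= s <= 1 -> f (edge_point e s) = m s.
  move=> s01; case: (edge_point_cases s01) => [s0|s1|s0]; last first.
  - by rewrite (edge_point_inr e s0) /= eqxx.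
  - apply/eqP; rewrite s1 eq_le {2}edge_point1 {1}edge_point1 /=.
    have := up 1; rewrite edge_point1 => ->; rewrite ?lexx ?ler01//=.
    by rewrite /m !ge_min addrK lexx orbT.
  - apply/eqP; rewrite s0 eq_le {2}edge_point0 {1}edge_point0 /=.
    have := up 0; rewrite edge_point0 => ->; rewrite ?lexx ?ler01//=.
    by rewrite /m !ge_min addr0 lexx.
have fN e' s : 0 <= s <= 1 -> e' != e -> f (edge_point e' s) = mdist z (edge_point e' s).
  move=> s01 ee; case: (edge_point_cases s01) => [->|->|s0].
  - by rewrite edge_point0.
  - by rewrite edge_point1.
  - by rewrite (edge_point_inr e' s0) /= (negbTE ee).
have kl s t : k s - k t <= `|s - t|.
  have h : (al + s) - (al + t) <= `|s - t| by rewrite opprD addrACA subrr add0r ler_norm.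
  rewrite /k; case: (z) => [//|[e' s0]]; case: ifP => // _.
  rewrite lerBlDr; have := ler_distD t s (val s0); by [].
have ml s t : m s - m t <= `|s - t|.
  rewrite lerBlDr -lerBlDl !le_min !lerBlDl !ge_min.
  have := kl s t; have := ler_norm (s - t); have := ler_norm (t - s).
  rewrite (distrC t s) => h1 h2 h3; apply/andP; split; first (apply/andP; split).
  - by apply/orP; left; apply/orP; left; lra.
  - by apply/orP; left; apply/orP; right; lra.
  - by apply/orP; right; lra.
have fz : f z <= 0.
  suff H x : x = z -> f x <= 0 by exact: H.
  case: x => [v|[e' s0]] xz; rewrite /f; first by rewrite xz mdistxx.
  case: eqVneq => [ee|_]; last by rewrite xz mdistxx.
  by rewrite /m ge_min /k -xz ee eqxx subrr normr0 lexx orbT.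
have fl x y : f x - f y <= mdist x y.
  apply: tree_dist_lipschitz => e' a b ha hb.
  case: (eqVneq e' e) => [->|ee]; first by rewrite !fE.
  rewrite !fN// lerBlDr.
  have h := metric_triangle z (edge_point e' b) (edge_point e' a).
  apply: le_trans h _; rewrite addrC lerD2r metric_sym mdist_treeE.
  by apply: tree_dist_le; exact: path_length1.
have mE s : 0 <= s <= 1 -> mdist z (edge_point e s) = m s.
  move=> s01; apply/eqP; rewrite eq_le up//= -fE// metric_sym.
  by apply: le_trans (fl _ z); rewrite lerBrDr gerDl.
exists al, (be + 1); exists (if z is inr (e', s0) then val s0 else 0) => s s01 /=.
rewrite mE// /m; case: (leP _ (k s)) => _; last first.
  rewrite /k; case: (z) => [|[e' s0]]; first by constructor 1.
  case: ifP => _; last by constructor 1.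
  case: (leP (val s0) s) => h; [constructor 3|constructor 4].
    by rewrite ger0_norm// subr_ge0.
  by rewrite ltr0_norm ?opprB// subr_lt0.
by case: leP => _; [constructor 1|constructor 2].
Qed.

Lemma ball_edge_point e (s0 del : R) (y : T) :
  0 < s0 < 1 -> del <= s0 -> del <= 1 - s0 ->
  mdist (edge_point e s0) y < del ->
  exists2 s : {s : R | 0 < s < 1}, y = inr (e, s) & `|val s - s0| < del.
Proof.
move=> s01 d1 d2 yd; pose mu := Num.min s0 (1 - s0).
have dmu : del <= mu by rewrite le_min d1.
have lip x1 x2 : inner_bump e s0 x1 - inner_bump e s0 x2 <= mdist x1 x2.
  apply: tree_dist_lipschitz => e' a b ha hb.
  rewrite !inner_bumpE//; case: eqP => _; last by rewrite !mul0r subrr.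
  rewrite !mul1r -/mu lerBlDr ge_max; apply/andP; split.
    by rewrite addr_ge0// le_max lexx.
  rewrite -lerBlDl le_max; apply/orP; right.
  have := ler_distD a b s0; rewrite (distrC b a); lra.
have := lip (edge_point e s0) y.
rewrite inner_bumpE; last by case/andP: s01 => *; rewrite !ltW.
rewrite eqxx mul1r subrr normr0 subr0 -/mu.
have mu0 : 0 < mu by rewrite lt_min subr_gt0.
rewrite (max_idPr (ltW mu0)) => h.
have h1 : 0 < inner_bump e s0 y by lra.
case: y yd h h1 => [v|[e' s]] yd h; first by rewrite /= ltxx.
rewrite /=; case: eqVneq => [ee|_]; last by rewrite mul0r ltxx.
rewrite mul1r lt_max ltxx /= => h2; exists s; first by rewrite ee.
move: h yd; rewrite /= ee eqxx mul1r -/mu (max_idPr (ltW h2)).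
by rewrite opprB addrCA subrr addr0 => /le_lt_trans h /h.
Qed.

End flip.

(** * Isometries carrying the root to any vertex *)

Section translation.
Variables (R : realType) (d : nat).
Local Notation T := (regular_tree R d).
Implicit Types (i j : 'I_d) (w : seq 'I_d) (v : vertex d).

Lemma flip_word_rcons i w : flip_word i (rcons w i) = w.
Proof.
elim: w => [|a [|b u] IH] /=; rewrite ?eqxx//.
by move: IH; rewrite /= => ->.
Qed.

Lemma flip_word_rconsV i w : reduced (rcons w i) -> flip_word i w = rcons w i.
Proof. by move=> r; rewrite -{1}(flip_word_rcons i w) flip_wordK. Qed.

Definition ends_with i w := if w is a :: u then last a u == i else false.

Lemma ends_withP i w : reflect (exists u, w = rcons u i) (ends_with i w).
Proof.
apply: (iffP idP) => [|[u ->]]; last by case: u => [|a u] /=; rewrite ?last_rcons eqxx.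
case/lastP: w => [//|u a] h; exists u; congr rcons.
by move: h; case: u => [|b u] /=; rewrite ?last_rcons => /eqP.
Qed.

Lemma reduced_rcons i w : reduced (rcons w i) = reduced w && ~~ ends_with i w.
Proof.
case: w => [//|a u]; rewrite /reduced /= rcons_path; by [].
Qed.

Lemma flip_word_ends i w : ends_with i w -> size (flip_word i w) = (size w).-1.
Proof. by case/ends_withP => u ->; rewrite flip_word_rcons size_rcons. Qed.

Lemma flip_word_ends_with i w : reduced w ->
  ends_with i (flip_word i w) = ~~ ends_with i w.
Proof.
move=> rw; case: (boolP (ends_with i w)) => h /=.
  have [u wu] := ends_withP i w h; rewrite wu flip_word_rcons.
  by move: rw; rewrite wu reduced_rcons => /andP[_ /negbTE].
by rewrite flip_word_rconsV ?reduced_rcons ?rw//; apply/ends_withP; exists w.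
Qed.

Lemma flip_word_Nends i w : reduced w -> ~~ ends_with i w ->
  flip_word i w = rcons w i.
Proof. by move=> rw h; rewrite flip_word_rconsV// reduced_rcons rw. Qed.

Lemma foldl_flip (w : seq 'I_d) : reduced w ->
  val (foldl (fun v i => flip_vertex i v) (tree_root d) w) = w.
Proof.
elim/last_ind: w => [//|w i IH]; rewrite reduced_rcons => /andP[rw h].
by rewrite foldl_rcons /= IH// flip_word_Nends.
Qed.

(** An isometry together with its action on vertices. Preserving the color and the distance to the
    vertex is what makes it map cells to cells. *)
Record translation (F G : T -> T) (f g : vertex d -> vertex d) : Prop := {
  transK : cancel F G;
  transVK : cancel G F;
  trans_dist : forall x y, mdist (F x) (F y) = mdist x y;
  trans_pt : forall v i a, 0 <= a <= 1 -> F (pt v i a) = pt (f v) i a;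
  trans_vK : cancel f g;
  trans_vVK : cancel g f }.

Lemma ex_translation v : exists F G f g, translation F G f g /\ f (tree_root d) = v.
Proof.
suff [F [G [f [g [tr fr]]]]] : exists F G f g, translation F G f g /\
    f (tree_root d) = foldl (fun v i => flip_vertex i v) (tree_root d) (val v).
  exists F, G, f, g; split => //; rewrite fr; apply/val_inj/foldl_flip/(valP v).
elim/last_ind: (val v) => [|w i [F [G [f [g [[FG GF Fd Fp fg gf] fr]]]]]].
  by exists id, id, id, id.
exists (flip_point i \o F), (G \o flip_point i), (flip_vertex i \o f), (g \o flip_vertex i).
split; last by rewrite foldl_rcons /= fr.
split.
- by move=> x /=; rewrite flip_pointK FG.
- by move=> x /=; rewrite GF flip_pointK.
- by move=> x y /=; rewrite mdist_flip Fd.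
- by move=> u j a a01 /=; rewrite Fp// flip_pt.
- by move=> x /=; rewrite flip_vertexK fg.
- by move=> x /=; rewrite gf flip_vertexK.
Qed.

Lemma trans_inl F G f g (v : vertex d) : (0 < d)%N -> translation F G f g ->
  F (inl v) = inl (f v).
Proof.
move=> d0 tr; rewrite -(pt0 R v (Ordinal d0)) (trans_pt tr) ?pt0//.
by rewrite lexx ler01.
Qed.

End translation.

(** * Enumeration and size of vertex balls *)

Section ball_list.
Variable d : nat.
Implicit Types (i j : 'I_d) (w : seq 'I_d) (v : vertex d).

Definition extend w : seq (seq 'I_d) :=
  [seq a :: w | a <- enum 'I_d & Some a != ohead w].

Fixpoint ending_words i n : seq (seq 'I_d) :=
  if n is m.+1 then flatten [seq extend w | w <- ending_words i m]
  else [:: [:: i]].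

Lemma mem_extend w u : (u \in extend w) =
  if u is a :: t then (t == w) && (Some a != ohead w) else false.
Proof.
apply/mapP/idP => [[a]|].
  by rewrite mem_filter => /andP[h _] ->; rewrite eqxx.
case: u => [//|a t] /andP[/eqP-> h]; exists a => //.
by rewrite mem_filter h mem_enum.
Qed.

Lemma mem_ending_words i n w : (w \in ending_words i n) =
  [&& reduced w, size w == n.+1 & ends_with i w].
Proof.
elim: n w => [|n IH] w.
  rewrite inE; apply/eqP/idP => [->|]; first by rewrite /= eqxx.
  by case: w => [|a [|b w]] /=; rewrite ?andbF// => /eqP->.
apply/flattenP/idP => [[s /mapP[u hu ->]]|].
  rewrite mem_extend; case: w => [//|a t] /andP[/eqP-> h].
  move: hu; rewrite IH => /and3P[ru /eqP su eu]; rewrite /= su eqxx /=.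
  case: u ru su eu h => [//|b u] ru su eu h; rewrite /= in eu *.
  by rewrite eu andbT; move: ru; rewrite /reduced /= => ->; rewrite andbT; apply: contra h => /eqP->.
case: w => [//|a w]; rewrite [size _]/= eqSS => /and3P[rw sw ew].
exists (extend w); last first.
  rewrite mem_extend eqxx /=; case: w rw sw ew => [//|b w]; rewrite /reduced /=.
  by move=> /andP[ab _] _ _; apply: contra ab => /eqP[->].
apply/mapP; exists w => //; rewrite IH sw (reduced_behead rw) /=.
by case: (w) sw ew.
Qed.

Lemma uniq_extend w : uniq (extend w).
Proof. rewrite map_inj_uniq; [exact/filter_uniq/fintype.enum_uniq|by move=> a b []]. Qed.

Lemma uniq_ending_words i n : uniq (ending_words i n).
Proof.
elim: n => [//|n IH] /=; move: IH; elim: (ending_words i n) => [//|w s IHs] /= /andP[ws us].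
rewrite cat_uniq uniq_extend IHs// andbT -all_predC; apply/allP => u /= /flattenP[t /mapP[w' w's ->]].
rewrite !mem_extend; case: u => [//|a u] /andP[/eqP-> _]; rewrite negb_and.
by rewrite (_ : _ != _)//; apply: contraNneq ws => <-.
Qed.

Lemma size_extend w : w != [::] -> size (extend w) = d.-1.
Proof.
case: w => [//|b w] _; rewrite size_map size_filter /=.
have := count_predC (pred1 b) (enum 'I_d).
rewrite count_uniq_mem ?fintype.enum_uniq// mem_enum size_enum_ord add1n => /(congr1 predn) /= <-.
by apply: eq_count => a; rewrite /= eqE.
Qed.

Lemma size_ending_words i n : size (ending_words i n) = (d.-1 ^ n)%N.
Proof.
elim: n => [//|n IH]; rewrite expnS -IH /=.
have : all (fun w => w != [::]) (ending_words i n).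
  by apply/allP => w; rewrite mem_ending_words => /and3P[_ + _]; case: w.
elim: (ending_words i n) => [|w s IHs] /=; first by rewrite muln0.
by move=> /andP[w0 s0]; rewrite size_cat size_extend// IHs// mulnS.
Qed.

Definition sphere_words n : seq (seq 'I_d) :=
  flatten [seq ending_words i n | i <- enum 'I_d].

Lemma mem_sphere_words n w : (w \in sphere_words n) = reduced w && (size w == n.+1).
Proof.
apply/flattenP/andP => [[s /mapP[i _ ->]]|[rw sw]].
  by rewrite mem_ending_words => /and3P[-> ->].
case: w rw sw => [//|a w] rw sw.
exists (ending_words (last a w) n); first by apply/mapP; exists (last a w); rewrite ?mem_enum.
by rewrite mem_ending_words rw sw /= eqxx.
Qed.

Lemma uniq_sphere_words n : uniq (sphere_words n).
Proof.
rewrite /sphere_words; have := fintype.enum_uniq 'I_d; elim: (enum _) => [//|i s IH] /= /andP[is_ us].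
rewrite cat_uniq uniq_ending_words IH// andbT -all_predC; apply/allP => u /=.
move=> /flattenP[t /mapP[j js ->]]; rewrite !mem_ending_words => /and3P[-> -> /= uj].
apply: contra is_ => ui; suff -> : i = j by [].
by case: (u) ui uj => [//|a w] /= /eqP-> /eqP.
Qed.

Lemma size_sphere_words n : size (sphere_words n) = (d * d.-1 ^ n)%N.
Proof.
rewrite /sphere_words -[X in (X * _)%N](size_enum_ord d); elim: (enum _) => [//|i s IH] /=.
by rewrite size_cat IH size_ending_words mulSn.
Qed.

Fixpoint vball_words n : seq (seq 'I_d) :=
  if n is m.+1 then vball_words m ++ sphere_words m else [:: [::]].

Lemma mem_ball_words n w : (w \in vball_words n) = reduced w && (size w <= n)%N.
Proof.
elim: n => [|n IH] /=.
  by rewrite inE leqn0 size_eq0; case: w => [|? ?]; rewrite ?andbF.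
rewrite mem_cat IH mem_sphere_words -andb_orr; congr (_ && _).
by rewrite [RHS]leq_eqVlt ltnS orbC.
Qed.

Lemma uniq_ball_words n : uniq (vball_words n).
Proof.
elim: n => [//|n IH] /=; rewrite cat_uniq IH uniq_sphere_words andbT -all_predC.
apply/allP => w; rewrite mem_sphere_words /= mem_ball_words => /andP[-> /eqP->].
by rewrite ltnn.
Qed.

Lemma size_vball_words n : (3 <= d)%N ->
  ((d - 2) * size (vball_words n) + 2 = d * d.-1 ^ n)%N.
Proof.
move=> d3; elim: n => [|n IH] /=; first by rewrite expn0; lia.
rewrite size_cat size_sphere_words mulnDr addnAC IH expnS.
by move: (d.-1 ^ n)%N => x; nia.
Qed.

Definition vball n : seq (vertex d) := pmap insub (vball_words n).

(** The vertices to be added to the ball of radius [n] so as to contain its image under the flip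
    [i]: the last letter of a word is the first step from the root. *)
Definition ending i n : seq (vertex d) := pmap insub (ending_words i n).

Lemma mem_vball n v : (v \in vball n) = (size (val v) <= n)%N.
Proof. by rewrite mem_pmap_sub mem_ball_words (valP v). Qed.

Lemma uniq_vball n : uniq (vball n).
Proof. exact/pmap_sub_uniq/uniq_ball_words. Qed.

Lemma size_vball n : size (vball n) = size (vball_words n).
Proof.
rewrite size_pmap_sub; apply/eqP; rewrite -all_count; apply/allP => w.
by rewrite mem_ball_words => /andP[].
Qed.

Lemma mem_ending i n v :
  (v \in ending i n) = (size (val v) == n.+1) && ends_with i (val v).
Proof. by rewrite mem_pmap_sub mem_ending_words (valP v). Qed.

Lemma uniq_ending i n : uniq (ending i n).
Proof. exact/pmap_sub_uniq/uniq_ending_words. Qed.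

Lemma size_ending i n : size (ending i n) = (d.-1 ^ n)%N.
Proof.
rewrite size_pmap_sub -(size_ending_words i); apply/eqP; rewrite -all_count.
by apply/allP => w; rewrite mem_ending_words => /and3P[].
Qed.

Lemma leq_size_vball n : (3 <= d)%N -> (d.-1 ^ n <= size (vball n))%N.
Proof.
move=> d3; have := size_vball_words n d3; rewrite -size_vball.
by move: (d.-1 ^ n)%N (size _) => x y; nia.
Qed.

Lemma size_vball_leq n : (3 <= d)%N -> (size (vball n) <= 3 * d.-1 ^ n)%N.
Proof.
move=> d3; have := size_vball_words n d3; rewrite -size_vball.
have : (0 < d.-1 ^ n)%N by rewrite expn_gt0; lia.
move: (d.-1 ^ n)%N (size _) => x y; nia.
Qed.

(** This exact identity, and not an estimate, is what makes the logarithmic terms cancel in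
    [density_ineq]. *)
Lemma size_edge_vball i n : (3 <= d)%N ->
  (d * size (vball n ++ ending i n) = 2 * d.-1 * size (vball n) + 2)%N.
Proof.
move=> d3; have := size_vball_words n d3; rewrite -size_vball size_cat size_ending.
by move: (d.-1 ^ n)%N (size _) => x y; nia.
Qed.

Lemma uniq_edge_vball i n : uniq (vball n ++ ending i n).
Proof.
rewrite cat_uniq uniq_vball uniq_ending andbT -all_predC; apply/allP => w.
by rewrite mem_ending /= mem_vball => /andP[/eqP-> _]; rewrite ltnn.
Qed.

Lemma flip_vball i n v : v \in vball n -> flip_vertex i v \in vball n ++ ending i n.
Proof.
rewrite mem_cat !mem_vball mem_ending /= => vn.
case: (boolP (ends_with i (val v))) => h.
  by rewrite flip_word_ends// (leq_trans (leq_pred _)).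
rewrite (flip_word_ends_with i (valP v)) h andbT flip_word_Nends ?(valP v)//.
by rewrite size_rcons eqSS orbC -leq_eqVlt.
Qed.

Lemma perm_cat_filter (A : eqType) (s t : seq A) : uniq s -> uniq t ->
  {subset s <= t} -> perm_eq t (s ++ [seq x <- t | x \notin s]).
Proof.
move=> us ut st; apply: uniq_perm => //.
  rewrite cat_uniq us filter_uniq// andbT -all_predC; apply/allP => x.
  by rewrite mem_filter => /andP[].
move=> x; rewrite mem_cat mem_filter; case: (boolP (x \in s)) => //= xs.
exact: st.
Qed.

Lemma perm_flip_vball i n : exists D',
  perm_eq (vball n ++ ending i n) (map (flip_vertex i) (vball n) ++ D').
Proof.
eexists; apply: perm_cat_filter.
- by rewrite map_inj_uniq ?uniq_vball//; exact/inv_inj/flip_vertexK.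
- exact: uniq_edge_vball.
- by move=> v /mapP[u ub ->]; exact: flip_vball.
Qed.

Lemma card_ends_with v : (d.-1 <= #|[pred i | ~~ ends_with i (val v)]|)%N.
Proof.
have := cardC [pred i | ends_with i (val v)]; rewrite card_ord => dE.
have e1 : (#|[pred i | ends_with i (val v)]| <= 1)%N.
  case: (val v) => [|a w]; first by rewrite eq_card0.
  by rewrite -(card1 (last a w)); apply: subset_leq_card; apply/fintype.subsetP => j;
    rewrite !inE /= eq_sym.
rewrite -[X in (X.-1 <= _)%N]dE -subn1 leq_subLR leq_add//.
Qed.

End ball_list.

(** * Cells *)

Section metric_borel.
Variables (R : realType) (T : metricType R).

Lemma open_mdist_ball (x : T) (e : R) : open [set y | mdist x y < e].
Proof.
rewrite openE => y /= xy; apply/nbhs_ballP; exists (e - mdist x y) => /=.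
  by rewrite subr_gt0.
move=> z; rewrite ballEmdist /= => yz.
by apply: le_lt_trans (metric_triangle x y z) _; rewrite -ltrBrDl.
Qed.

Lemma borel_open (A : set T) : open A -> borel A.
Proof. by move=> oA; exact: sub_sigma_algebra. Qed.

Lemma borel_set1 (x : T) : borel [set x].
Proof.
have oC : open (~` [set x]).
  rewrite openE => y /= /eqP; rewrite eq_sym -mdist_gt0 => xy.
  apply/nbhs_ballP; exists (mdist x y) => //= z; rewrite ballEmdist /= => yz zx.
  by move: yz; rewrite zx metric_sym ltxx.
by have := sigma_algebraCD (borel_open oC); rewrite setTD setCK.
Qed.

End metric_borel.

Section cells.
Variables (R : realType) (d K : nat).
Hypothesis K0 : (0 < K)%N.
Local Notation T := (regular_tree R d).
Local Notation vtx v := (inl v : T).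

(* Each half edge is cut into K cells. *)
Definition mesh : R := (2 * K)%:R^-1.
Local Notation h := mesh.

Definition cell : Type := (vertex d * 'I_d * 'I_K)%type.

Implicit Types (c : cell) (v : vertex d) (i : 'I_d).

Definition cell_pos c : R := (c.2%:R + 2^-1) * h.

Definition cell_center c : T := pt c.1.1 c.1.2 (cell_pos c).

(** An open ball, so that isometries visibly carry cells to cells and cells are Borel. The division
    points are left out; they almost surely carry no point of the process. *)
Definition cellset c : set T := [set x | mdist (cell_center c) x < h / 2].

Lemma mesh_gt0 : 0 < h.
Proof. by rewrite invr_gt0 ltr0n; lia. Qed.

Lemma mesh_half : K%:R * h = 2^-1.
Proof.
have K0R : (K%:R : R) != 0 by rewrite pnatr_eq0 -lt0n.
by rewrite /mesh natrM invfM mulrCA divff// mulr1.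
Qed.

Lemma cell_posP c : h / 2 <= cell_pos c /\ cell_pos c + h / 2 <= 2^-1.
Proof.
have h0 := mesh_gt0; have := ltn_ord c.2; rewrite -(ler_nat R) -natr1 => le.
split; first by rewrite /cell_pos mulrDl mulrC lerDr mulr_ge0// ltW.
have mh := mesh_half; have := ler_wpM2r (ltW h0) le.
by rewrite /cell_pos; lra.
Qed.

Lemma cell_pos01 c : 0 <= cell_pos c <= 1.
Proof. by have h0 := mesh_gt0; have [h1 h2] := cell_posP c; apply/andP; split; lra. Qed.

Let cpos c : R := half_pos c.1.1 c.1.2 (cell_pos c).

Let cposP c : [/\ 0 < cpos c < 1, h / 2 <= cpos c & h / 2 <= 1 - cpos c].
Proof.
have h0 := mesh_gt0; have [h1 h2] := cell_posP c; rewrite /cpos /half_pos.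
by case: ifP => _; split; try (apply/andP; split); lra.
Qed.

Lemma cellsetP c x : cellset c x -> exists2 s : {s : R | 0 < s < 1},
  x = inr (half_edge c.1.1 c.1.2, s) & `|val s - half_pos c.1.1 c.1.2 (cell_pos c)| < h / 2.
Proof.
by have [c01 c1 c2] := cposP c; apply: ball_edge_point.
Qed.

Lemma cellset_center c : cellset c (cell_center c).
Proof. by rewrite /cellset /= mdistxx divr_gt0 ?mesh_gt0. Qed.

Lemma half_edge_inj v i v' i' : half_edge_word v i = half_edge_word v' i' -> v <> v' ->
  i = i' /\ (ohead (val v) == Some i) = ~~ (ohead (val v') == Some i').
Proof.
rewrite /half_edge_word => e vv.
have neq : val v <> val v' by move=> /val_inj.
case: ifP e => [/eqP h1|/negbT h1]; case: ifP => [/eqP h2|/negbT h2] e.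
- by [].
- by split => //; move: h1; rewrite e /= => -[].
- by split => //; move: h2; rewrite -e /= => -[->].
- by move: e => [_ e]; case: neq.
Qed.

Lemma cellset_disjoint c c' x : cellset c x -> cellset c' x -> c = c'.
Proof.
have h0 := mesh_gt0.
move=> /cellsetP[s -> sc] /cellsetP[s' [ee ss]]; rewrite -{s'}ss => sc'.
have [h1 h2] := cell_posP c; have [h1' h2'] := cell_posP c'.
case: (pselect (c.1.1 = c'.1.1)) => [vv|vv]; last first.
  have [ii hh] := half_edge_inj ee vv.
  exfalso; move: sc sc'; rewrite /half_pos hh; case: (ohead _ == Some c'.1.2) => /=;
    rewrite !ltr_norml => /andP[? ?] /andP[? ?]; lra.
have ii : c.1.2 = c'.1.2.
  move: ee; rewrite /half_edge_word vv.
  case: ifP => [/eqP a|/negbT a]; case: ifP => [/eqP b|/negbT b].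
  - by move: b; rewrite a => -[].
  - by move=> /(congr1 size) /= /n_Sn.
  - by move=> /(congr1 size) /= /esym/n_Sn.
  - by case.
have : `|cell_pos c - cell_pos c'| < h.
  rewrite -(half_posB c.1.1 c.1.2) [X in _ - X](_ : _ = half_pos c'.1.1 c'.1.2 (cell_pos c')); last by rewrite vv ii.
  move: sc sc'; rewrite !ltr_norml => /andP[? ?] /andP[? ?]; apply/andP; split; lra.
rewrite /cell_pos -mulrBl opprD addrACA subrr addr0 normrM (gtr0_norm h0).
rewrite -[ltRHS]mul1r ltr_pM2r// => hh.
case: c c' vv ii hh {sc sc' ee h1 h2 h1' h2'} => [[v i] k] [[v' i'] k'] /= -> -> hh.
congr (_, _); apply/val_inj => /=; case: (ltngtP k k') hh => // kk.
- rewrite distrC ger0_norm ?subr_ge0 ?ler_nat 1?ltnW//.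
  by rewrite -natrB ?(ltnW kk)// (ltr_nat R _ 1) ltnS leqn0 subn_eq0 leqNgt kk.
- rewrite ger0_norm ?subr_ge0 ?ler_nat 1?ltnW//.
  by rewrite -natrB ?(ltnW kk)// (ltr_nat R _ 1) ltnS leqn0 subn_eq0 leqNgt kk.
Qed.

Lemma borel_cellset c : borel (cellset c).
Proof. exact: borel_open (open_mdist_ball (cell_center c) (mesh / 2)). Qed.

Lemma length_measure_cellset c : length_measure (cellset c) = h%:E.
Proof.
have h0 := mesh_gt0; rewrite /length_measure.
have [/andP[c0 c1] c2 c3] := cposP c.
pose e0 := half_edge c.1.1 c.1.2.
rewrite (_ : (fun e => _) = (fun e => if e \in [set e0] then h%:E else 0%E)); last first.
  apply/funext => e; rewrite in_set1; case: eqVneq => [->|ne]; last first.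
    rewrite [X in lebesgue_measure X](_ : _ = set0) ?measure0//.
    apply/seteqP; split => // s [s01 cs]; have [s' es _] := cellsetP cs.
    case: (edge_point_cases s01) es => [->|->|s0].
    - by rewrite edge_point0.
    - by rewrite edge_point1.
    - by rewrite (edge_point_inr e s0) => -[ee _]; rewrite ee eqxx in ne.
  rewrite [X in lebesgue_measure X](_ : _ = [set` `]cpos c - h / 2, cpos c + h / 2[%R]).
    rewrite lebesgue_measure_itv /= lte_fin ifT -?EFinB; last by lra.
    by congr (_%:E); lra.
  apply/seteqP; split => s /=; rewrite in_itv /=.
    move=> [s01 cs]; have [s' es] := cellsetP cs.
    case: (edge_point_cases s01) es => [->|->|s0].
    - by rewrite edge_point0.
    - by rewrite edge_point1.
    - rewrite (edge_point_inr e0 s0) => -[<-] /=; rewrite -/(cpos c) ltr_norml.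
      by move=> /andP[? ?]; apply/andP; split; lra.
  move=> /andP[s1 s2]; have s01 : 0 <= s <= 1 by apply/andP; split; lra.
  split => //; rewrite /cellset /= /cell_center /pt -/(cpos c) -/e0 mdist_treeE.
  have cp : 0 <= cpos c <= 1 by rewrite !ltW.
  apply: le_lt_trans (tree_dist_le (path_length1 e0 cp s01)) _.
  by rewrite ltr_norml; apply/andP; split; lra.
by rewrite -esum_mkcond esum_set1// lee_fin ltW.
Qed.

Lemma length_measure_set1 (x : T) : length_measure [set x] = 0%E.
Proof.
rewrite /length_measure esum1// => e _.
have inj (s s' : R) : 0 <= s <= 1 -> 0 <= s' <= 1 ->
    edge_point e s = edge_point e s' -> s = s'.
  move=> s01 s01' /(congr1 (vertex_bump (edge_tgt e))).
  by rewrite !vertex_bumpE// (negbTE (edge_src_neq_tgt e)) eqxx !mul0r !mul1r !add0r.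
set A := (X in lebesgue_measure X).
have [->|/set0P[s [s01 es]]] := eqVneq A set0; first by rewrite measure0.
rewrite (_ : A = [set s]) ?lebesgue_measure_set1//.
apply/seteqP; split => [s' [s01' es']|s' ->]; last by [].
by apply: inj => //; rewrite es'.
Qed.

Lemma cell_cover v i (a : R) : 0 <= a <= 2^-1 ->
  (forall k : nat, (k <= K)%N -> a <> k%:R * h) ->
  exists2 c : cell, c.1.1 = v & cellset c (pt v i a).
Proof.
move=> /andP[a0 a1] ng; have h0 := mesh_gt0.
have [k /andP[k1 k2]] : exists k : nat, k%:R <= a / h < k.+1%:R.
  by exists (Num.truncn (a / h)); rewrite truncn_itv// divr_ge0// ltW.
rewrite ler_pdivlMr// in k1; rewrite ltr_pdivrMr// in k2.
have kK : (k <= K)%N.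
  by rewrite -(ler_nat R) -(ler_pM2r h0); have := mesh_half; lra.
have k1' : k%:R * h < a by rewrite lt_neqAle k1 andbT; apply/eqP => e; exact: (ng k kK).
have {}kK : (k < K)%N.
  by rewrite -(ltr_nat R) -(ltr_pM2r h0); have := mesh_half; lra.
pose c : cell := (v, i, Ordinal kK); exists c => //.
rewrite /cellset /= /cell_center; apply: le_lt_trans (mdist_pt v i (cell_pos01 c) _) _.
  by apply/andP; split; lra.
rewrite /cell_pos /= ltr_norml; rewrite -natr1 in k2.
by apply/andP; split; lra.
Qed.

Lemma mdist_center_vertex c : mdist (vtx c.1.1) (cell_center c) <= 2^-1.
Proof.
apply: le_trans (mdist_pt0 _ _ (cell_pos01 c)) _; have h0 := mesh_gt0.
by have [_ ?] := cell_posP c; lra.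
Qed.

Section transport.
Variables (F G : T -> T) (f g : vertex d -> vertex d).
Hypothesis tr : translation F G f g.

Definition map_cell (f : vertex d -> vertex d) c : cell := (f c.1.1, c.1.2, c.2).

Lemma trans_cell_center c : F (cell_center c) = cell_center (map_cell f c).
Proof. by rewrite /cell_center (trans_pt tr)//; exact: cell_pos01. Qed.

Lemma trans_cellset c x : cellset (map_cell f c) (F x) = cellset c x.
Proof. by rewrite /cellset /= -trans_cell_center (trans_dist tr). Qed.

End transport.

Lemma mdist_center_depth c : (size (val c.1.1))%:R <= mdist (vtx (tree_root d)) (cell_center c) + 2^-1.
Proof.
rewrite -mdist_rootE.
apply: le_trans (metric_triangle _ (cell_center c) _) _; rewrite lerD2l metric_sym.
exact: mdist_center_vertex.
Qed.

End cells.

(** * Thinning *)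

Section thinning.
Variables (R : realType) (d K : nat).
Hypothesis K0 : (0 < K)%N.
Local Notation T := (regular_tree R d).
Local Notation h := (mesh R K).
Implicit Types (O : set (cell d K)) (c : cell d K).

Definition cell_dist c c' : R := mdist (cell_center R c) (cell_center R c').

Lemma cell_dist_sym c c' : cell_dist c c' = cell_dist c' c.
Proof. exact: metric_sym. Qed.

Lemma cell_dist_ge0 c c' : 0 <= cell_dist c c'.
Proof. exact: mdist_ge0. Qed.

(* Up to errors of order the mesh, balls of radius k * mesh centered in two cells
   intersect iff the centers of the cells are at distance at most 2k * mesh. *)
Definition level (k : nat) : R := (2 * k)%:R * h - h.

(* A discrete process dominating the balloon process: at each step, all cells
   with another one within reach are removed at once. *)
Fixpoint thin O (k : nat) : set (cell d K) :=
  if k is j.+1 then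
    [set c | thin O j c /\
       forall c', thin O j c' -> c' <> c -> level j.+1 < cell_dist c c']
  else O.

Lemma thin_subS O k : thin O k.+1 `<=` thin O k.
Proof. by move=> c []. Qed.

Lemma thin_sub O k l : (k <= l)%N -> thin O l `<=` thin O k.
Proof.
move=> /subnK <-; elim: (l - k)%N => [//|j IH]; rewrite addSn.
by apply: subset_trans IH; exact: thin_subS.
Qed.

Lemma level_lt j k : (j < k)%N -> level j + 2 * h <= level k.
Proof.
move=> jk; rewrite /level addrAC lerD2r -mulrDl ler_wpM2r ?(ltW (mesh_gt0 R K0))//.
by rewrite -natrD ler_nat; lia.
Qed.

Lemma thin_sep O k c c' : thin O k c -> thin O k c' -> c' <> c ->
  level k < cell_dist c c'.
Proof.
case: k => [|k] /=.
  move=> _ _ _; apply: lt_le_trans (cell_dist_ge0 _ _).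
  by rewrite /level muln0 mul0r add0r oppr_lt0 mesh_gt0.
by move=> [_ h1] [h2 _]; exact: h1.
Qed.

Lemma thin_exit O m c : O c -> ~ thin O m c ->
  exists2 l, (l < m)%N & thin O l c /\ ~ thin O l.+1 c.
Proof.
move=> Oc; elim: m => [//|m IH] nm.
have [tm|/IH[l lm h]] := pselect (thin O m c); first by exists m.
by exists l => //; exact: ltnW.
Qed.

Lemma thin_removed O l c : thin O l c -> ~ thin O l.+1 c ->
  exists c', [/\ thin O l c', c' <> c & cell_dist c c' <= level l.+1].
Proof.
move=> tc ntc; apply: contrapT => hn; apply: ntc; split => // c' tc' cc'.
by rewrite ltNge; apply/negP => le; apply: hn; exists c'.
Qed.

(** Each step consults cells within [L] of a cell, so the outcome of [k] steps is determined within
    distance [k%:R * L]. *)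
Lemma thin_local (L : R) O O' k c : 0 <= L -> level k <= L ->
  (forall c', cell_dist c c' <= k%:R * L -> O c' <-> O' c') ->
  thin O k c <-> thin O' k c.
Proof.
move=> L0; elim: k c => [|k IH] c lk OO' /=.
  apply: OO'; rewrite mul0r /cell_dist mdistxx//.
have h0 := mesh_gt0 R K0.
have lk' : level k <= L by have := @level_lt k k.+1 (leqnn _); lra.
have loc c' : cell_dist c c' <= L -> thin O k c' <-> thin O' k c'.
  move=> cc'; apply: IH => // c'' cc''; apply: OO'.
  apply: le_trans (metric_triangle _ (cell_center R c') _) _.
  by rewrite -natr1 mulrDl mul1r addrC lerD.
have locc : thin O k c <-> thin O' k c by apply: loc; rewrite /cell_dist mdistxx.
by split => -[/locc tc sep]; split => // c' tc' cc'; rewrite ltNge; apply/negP => le;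
  have := sep c'; rewrite ltNge le => /(_ _ cc')/negP; apply => //;
  apply/loc => //; exact: le_trans lk.
Qed.

Lemma thin_map (F G : T -> T) (f g : vertex d -> vertex d) O k c :
  translation F G f g ->
  thin [set c | O (map_cell f c)] k c <-> thin O k (map_cell f c).
Proof.
move=> tr; have dE c1 c2 : cell_dist (map_cell f c1) (map_cell f c2) = cell_dist c1 c2.
  by rewrite /cell_dist -!(trans_cell_center K0 tr) (trans_dist tr).
have gK : cancel (map_cell g) (map_cell f : cell d K -> _).
  by case=> -[v i] s; rewrite /map_cell /= (trans_vVK tr).
have fK : cancel (map_cell f : cell d K -> _) (map_cell g).
  by case=> -[v i] s; rewrite /map_cell /= (trans_vK tr).
elim: k c => [//|k IH] c /=; split => -[tc sep]; split; try exact/IH.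
  move=> c'; rewrite -(gK c') => tc' ne; rewrite dE; apply: sep.
    exact/IH.
  by move=> e; apply: ne; rewrite e.
move=> c' tc' ne; rewrite -dE; apply: sep; first exact/IH.
by move=> /(can_inj fK).
Qed.

End thinning.

(** * Chains with decreasing steps *)

Section decreasing_chain.
Variables (R : realType) (T : metricType R) (X : set T).
Implicit Types (x y z : T) (s : seq T) (b L : R).

(** Each step length becomes the upper bound for the next one. Such chains record who can influence
    whom: a balloon is affected through a neighbor that popped earlier, with a closer partner. *)
Fixpoint dchain L b x s : Prop :=
  if s is y :: s' then
    [/\ X y, mdist x y < b, L < mdist x y & dchain L (mdist x y) y s']
  else True.

Definition reach b x L y := exists s,
  [/\ uniq (x :: s), dchain L b x s & last x s = y].

Lemma dchain_weak L L' b x s : L' <= L -> dchain L b x s -> dchain L' b x s.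
Proof.
move=> LL'; elim: s b x => [//|y s IH] b x /= [? ? lt ?]; split => //.
  exact: le_lt_trans lt.
exact: IH.
Qed.

Lemma dchain_rcons L L' b x s z : L < b -> dchain L b x s -> X z ->
  mdist (last x s) z <= L -> L' < mdist (last x s) z ->
  dchain L' b x (rcons s z).
Proof.
elim: s b x => [|y s IH] b x Lb /=.
  by move=> _ Xz le lt; split => //; exact: le_lt_trans Lb.
move=> [Xy xyb Lxy ch] Xz le lt; split => //; last exact: IH.
by apply: lt_trans Lxy; exact: lt_le_trans le.
Qed.

Lemma dchain_cat L b x s1 s2 : dchain L b x (s1 ++ s2) -> dchain L b x s1.
Proof. by elim: s1 b x => [//|y s IH] b x /= [? ? ? /IH]. Qed.

Lemma dchain_X L b x s y : dchain L b x s -> y \in s -> X y.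
Proof.
elim: s b x => [//|z s IH] b x /= [Xz _ _ ch]; rewrite inE.
by case/orP => [/eqP->//|]; exact: IH ch.
Qed.

Lemma reach_refl b x L : reach b x L x.
Proof. by exists [::]. Qed.

(** If [z] is already on the chain, the chain is cut at [z]. Chains thus never repeat a point, as
    required for estimating the probability that all their cells are occupied. *)
Lemma reach_step b x L L' y z : L < b -> reach b x L y -> X z ->
  mdist y z <= L -> L' < mdist y z -> reach b x L' z.
Proof.
move=> Lb [s [us ch ly]] Xz le lt.
have LL' : L' <= L by apply: ltW; exact: lt_le_trans le.
case: (boolP (z \in x :: s)) => [|zs].
  rewrite inE => /orP[/eqP->|zs]; first exact: reach_refl.
  case/splitPr: zs us ch ly => s1 s2 us ch _; exists (rcons s1 z); split.
  - by move: us; rewrite -cat_cons -cat_rcons cat_uniq => /and3P[].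
  - by apply: dchain_weak LL' _; apply: (@dchain_cat L b x _ s2); rewrite cat_rcons.
  - by rewrite last_rcons.
exists (rcons s z); split; last by rewrite last_rcons.
- by rewrite -rcons_cons rcons_uniq zs.
- by apply: (dchain_rcons Lb ch); rewrite ?ly.
Qed.

Lemma dchain_dist L b x s : dchain L b x s ->
  mdist x (last x s) <= (size s)%:R * b.
Proof.
elim: s b x => [|y s IH] b x /=; first by rewrite mdistxx mul0r.
move=> [_ xyb _ ch]; apply: le_trans (metric_triangle _ y _) _.
rewrite -natr1 mulrDl mul1r addrC lerD//; last exact: ltW.
by apply: le_trans (IH _ _ ch) _; rewrite ler_wpM2l// ltW.
Qed.

Lemma reach_dist b x L y n : 0 <= b ->
  (forall s, size s = n -> uniq (x :: s) -> ~ dchain L b x s) ->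
  reach b x L y -> mdist x y <= n%:R * b.
Proof.
move=> b0 hn [s [us ch <-]]; apply: le_trans (dchain_dist ch) _.
rewrite ler_wpM2r// ler_nat leqNgt; apply/negP => ns.
(* A longer chain has a prefix of exactly [n] steps, still without repetition. *)
apply: (hn (take n s)); first by rewrite size_takel// ltnW.
  by move: us; rewrite -{1}(cat_take_drop n s) -cat_cons cat_uniq => /and3P[].
by apply: (@dchain_cat _ _ _ _ (drop n s)); rewrite cat_take_drop.
Qed.

End decreasing_chain.

(** * Active balloons lie in surviving cells *)

Section comparison.
Variables (R : realType) (d K : nat).
Hypothesis K0 : (0 < K)%N.
Local Notation T := (regular_tree R d).
Local Notation h := (mesh R K).
Local Notation root := (inl (tree_root d) : T).
Variables (X : set T) (tau : T -> \bar R).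
Hypothesis Xtau : popping_times X tau.

Definition occupied : set (cell d K) := [set c | exists2 x, X x & cellset c x].

Lemma cell_dist_approx (c c' : cell d K) (x y : T) : cellset c x -> cellset c' y ->
  `|mdist x y - cell_dist R c c'| <= h.
Proof.
rewrite /cellset /= => xc yc.
have t1 := metric_triangle x (cell_center R c) y.
have t2 := metric_triangle (cell_center R c) (cell_center R c') y.
have t3 := metric_triangle (cell_center R c) x (cell_center R c').
have t4 := metric_triangle x y (cell_center R c').
rewrite (metric_sym x (cell_center R c)) in t1; rewrite (metric_sym y (cell_center R c')) in t4.
by rewrite /cell_dist ler_norml; apply/andP; split; lra.
Qed.

Variables (m : nat) (r0 : R) (x0 : T).
Local Notation t := (m%:R * h).
Local Notation b := (2 * t + 1).
Local Notation near x := (mdist root x <= r0 + b).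
Hypothesis generic : forall x, X x -> near x -> exists c, @cellset R d K c x.
Hypothesis simple : forall x y c, X x -> X y -> near x -> near y ->
  @cellset R d K c x -> cellset c y -> x = y.
Hypothesis notie : forall x y z, X x -> X y -> X z ->
  near x -> near y -> near z -> x <> y -> y <> z -> x <> z ->
  4 * h < `|mdist x y - mdist y z|.
Hypothesis reach_near : forall L x, 0 <= L -> reach X b x0 L x -> mdist root x <= r0.

Let h0 : 0 < h := mesh_gt0 R K0.

Let ex_slot (u : R) : 0 < u -> exists j : nat, j%:R * h < u <= j.+1%:R * h.
Proof.
move=> u0; have exn : exists n, u <= n%:R * h.
  exists (Num.truncn (u / h)).+1; rewrite -ler_pdivrMr//; apply: ltW.
  exact: truncnS_gt.
case: (ex_minnP exn) => -[|j]; first by rewrite mul0r leNgt u0.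
move=> uj hj; exists j; rewrite uj andbT ltNge; apply/negP => /hj.
by rewrite ltnn.
Qed.

Let mhE (k : nat) : (k.+1%:R * h : R) = k%:R * h + h.
Proof. by rewrite -natr1 mulrDl mul1r. Qed.

Let levE (k : nat) : level R K k = 2 * (k%:R * h) - h.
Proof. by rewrite /level natrM mulrA. Qed.

(** Suppose the cell of [x] falls to a cell [c'] with point [y]. As [x] is still active, [y] has
    popped, with a partner [z] that is markedly closer since there are no near ties. By induction
    the cell of [z] survives almost until that time; as [c'] outlives it, it must fall to a third
    cell [cw], and the points of [c'] and [cw] are then almost equidistant from [z], a forbidden
    tie. The steps to [x], [y], [z] decrease, so all these points stay in the region where the
    hypotheses hold. *)
Lemma active_not_removed (l : nat) (L : R) (x : T) (c : cell d K) :
  (l < m)%N -> 2 * (l.+1%:R * h) <= L -> L < b -> reach X b x0 L x -> X x ->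
  ((l.+1%:R * h)%:E < tau x)%E -> cellset c x ->
  thin R occupied l c -> thin R occupied l.+1 c.
Proof.
elim/ltn_ind: l L x c => l IH L x c lm Ll Lb rx Xx tx cx thc.
apply: contrapT => nthc.
have [c' [thc' cc' Dcc']] := thin_removed thc nthc.
have Dlow := thin_sep K0 thc thc' cc'.
have [y Xy cy] : occupied c' by exact: thin_sub (leq0n l) _ thc'.
have /ler_normlP[a1 a2] := cell_dist_approx cx cy.
rewrite !levE in Dcc' Dlow.
have lh : 0 <= l%:R * h by rewrite mulr_ge0// ltW.
have lmh : l.+1%:R * h <= m%:R * h by rewrite ler_wpM2r ?(ltW h0)// ler_nat.
have lS := mhE l.
have xy_up : mdist x y <= 2 * (l.+1%:R * h) by lra.
have xy_low : 2 * (l%:R * h) - 2 * h < mdist x y by lra.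
have yx : y <> x.
  by move=> e; apply: cc'; rewrite e in cy; exact: cellset_disjoint cy cx.
have [pos sep part] := Xtau.
have ty : (tau y <= (l.+1%:R * h)%:E)%E.
  rewrite leNgt; apply/negP => ty.
  have := sep (l.+1%:R * h) x y; rewrite lS addr_ge0 ?(ltW h0)// -lS.
  by move=> /(_ isT (conj Xx tx) (conj Xy ty) (nesym yx)); lra.
have tyoo : (tau y < +oo)%E by apply: le_lt_trans ty _; rewrite ltry.
have [z [Xz zy tz yz]] := part y Xy tyoo.
have [u tu] : exists u, tau y = u%:E.
  by exists (fine (tau y)); rewrite fineK// ge0_fin_numE// ltW// pos.
rewrite tu lee_fin in ty; rewrite tu in tz.
have u0 : 0 < u by have := pos y Xy; rewrite tu lte_fin.
rewrite tu -EFinM in yz; have {}yz : mdist y z = 2 * u by case: yz.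
have L0 : 0 <= L by lra.
have x_near : mdist root x <= r0 by exact: reach_near rx.
have nr (p q : T) : mdist root p <= r0 -> mdist p q < b -> near q.
  by move=> ? ?; apply: le_trans (metric_triangle _ p _) _; apply: lerD => //; exact: ltW.
have y_near : near y by apply: nr x_near _; lra.
have zx : z <> x.
  by move=> e; move: tx; rewrite -e tz lte_fin ltNge ty.
have xy0 : 0 < mdist x y by rewrite mdist_gt0; apply/eqP/nesym.
have ry0 : reach X b x0 0 y.
  by apply: (reach_step Lb rx Xy) => //; lra.
have y_near0 : mdist root y <= r0 by exact: reach_near ry0.
have z_near : near z by apply: nr y_near0 _; rewrite yz; lra.
have tie := notie Xx Xy Xz (le_trans x_near _) y_near z_near (nesym yx) (nesym zy) (nesym zx).
have {}tie : 4 * h < `|mdist x y - mdist y z| by apply: tie; lra.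
(* With the other sign [y] would be farther than [2 * (l.+1%:R * h)] from its partner, hence would
   pop too late. *)
have yz_lt : 2 * u < mdist x y - 4 * h.
  by move: tie; rewrite yz lter_normr => /orP[|]; lra.
have ry : reach X b x0 (2 * u) y.
  by apply: (reach_step Lb rx Xy); lra.
have [j /andP[ju uj]] := ex_slot u0.
(* The margin [4 * h] puts the popping of [z] two slots earlier, so that [c'] is known to survive
   step [j.+2]. *)
have jl : (j + 2 <= l)%N.
  have : j%:R * h + 1 * h < l%:R * h by lra.
  by rewrite -mulrDl ltr_pM2r// natr1 ltr_nat addn2.
have jl1 : (j < l)%N by apply: leq_trans jl; rewrite addn2 ltnS leqnSn.
have jS := mhE j.
have jh : 0 <= j%:R * h by rewrite mulr_ge0// ltW.
have rz : reach X b x0 (2 * (j%:R * h)) z.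
  apply: (@reach_step _ _ _ _ _ (2 * u)) ry Xz _ _; rewrite ?yz; lra.
have z_near0 : mdist root z <= r0 by apply: reach_near rz; lra.
have [cz zcz] := generic Xz z_near.
have Oz : occupied cz by exists z.
(* The induction hypothesis excludes an earlier removal of [cz], because [z] is active up to [u],
   which exceeds [j%:R * h]. *)
have [thz|nthz] := pselect (thin R occupied j cz); last first.
  have [l' l'j [thz' nthz']] := thin_exit Oz nthz.
  apply: nthz'.
  have l'jh : l'.+1%:R * h <= j%:R * h by rewrite ler_wpM2r ?(ltW h0)// ler_nat.
  apply: (IH l' _ (2 * (j%:R * h)) z) => //.
  - exact: ltn_trans jl1.
  - exact: ltn_trans (ltn_trans jl1 lm).
  - lra.
  - lra.
  - by rewrite tz lte_fin; lra.
have /ler_normlP[e1 e2] := cell_dist_approx cy zcz.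
have czc' : cz <> c'.
  move=> e; rewrite e in zcz; apply: zy; exact: simple zcz cy.
(* The bound $2u \le 2(j+1)h$ and the discretization error $h$ add up exactly to this level. *)
have Dup : cell_dist R c' cz <= level R K j.+2.
  by rewrite levE mhE jS; lra.
have thc'2 : thin R occupied j.+2 c' by apply: thin_sub thc'; rewrite -addn2.
have nthz1 : ~ thin R occupied j.+1 cz.
  by move=> thz1; have [_ /(_ cz thz1 czc')] := thc'2; rewrite ltNge Dup.
have [cw [thw wz Dw]] := thin_removed thz nthz1.
have Dwlow := thin_sep K0 thz thw wz.
have [w Xw cww] : occupied cw by exact: thin_sub (leq0n j) _ thw.
have thc'1 : thin R occupied j.+1 c' by apply: thin_sub thc'2.
have wc' : cw <> c'.
  move=> e; rewrite e in Dw; have [_ /(_ cz thz czc')] := thc'1.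
  by rewrite ltNge cell_dist_sym Dw.
have /ler_normlP[f1 f2] := cell_dist_approx zcz cww.
rewrite !levE jS in Dw Dwlow.
have jm : j.+2%:R * h <= m%:R * h.
  by rewrite ler_wpM2r ?(ltW h0)// ler_nat -addn2 (leq_trans jl)// ltnW.
have jSS := mhE j.+1.
have w_near : near w by apply: nr z_near0 _; lra.
have wz' : w <> z by move=> e; rewrite e in cww; apply: wz; exact: cellset_disjoint cww zcz.
have wy' : w <> y by move=> e; rewrite e in cww; apply: wc'; exact: cellset_disjoint cww cy.
(* The distances from [z] to [y] and to [w] both lie between $2jh-2h$ and $2jh+2h$; this is the
   origin of the threshold [4 * h] for ties. *)
have := notie Xy Xz Xw y_near z_near w_near (nesym zy) (nesym wz') (nesym wy').
by rewrite yz lter_normr => /orP[|]; lra.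
Qed.

Lemma active_thin (c : cell d K) : X x0 -> (t%:E < tau x0)%E -> cellset c x0 ->
  thin R occupied m c.
Proof.
move=> Xx0 tx0 cx0; apply: contrapT => nth.
have Oc : occupied c by exists x0.
have [l lm [thl nthl]] := thin_exit Oc nth; apply: nthl.
have lmh : l.+1%:R * h <= m%:R * h by rewrite ler_wpM2r ?(ltW h0)// ler_nat.
apply: (@active_not_removed l (2 * t) x0) => //.
- lra.
- lra.
- exact: reach_refl.
- by apply: le_lt_trans tx0; rewrite lee_fin.
Qed.

End comparison.

(** * Rare patterns *)

Section window_count.
Variables (R : realType) (d K : nat).
Hypothesis K0 : (0 < K)%N.
Local Notation T := (regular_tree R d).
Local Notation h := (mesh R K).

Let h0 : 0 < h := mesh_gt0 R K0.

Lemma card_itv_mesh (A : pred 'I_K) (lo w : R) : 0 <= w ->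
  (forall s, A s -> lo <= s%:R * h <= lo + w) -> #|A|%:R <= w / h + 1.
Proof.
move=> w0 Alo; have wh0 : 0 <= w / h by rewrite divr_ge0// ltW.
have [|A0] := posnP #|A|.
  by move=> ->; rewrite addr_ge0// divr_ge0// ltW.
have [s0 s0A] : exists s0, s0 \in A by apply/card_gt0P.
have [s1 s1A min1] := arg_minnP (fun s : 'I_K => val s) s0A.
pose n := Num.truncn (w / h).
have sub : {subset map val (enum A) <= iota s1 n.+1}.
  move=> _ /mapP[s + ->]; rewrite mem_enum => sA; rewrite mem_iota min1//=.
  have /andP[_ u] := Alo s sA; have /andP[l _] := Alo s1 s1A.
  have : (s - s1)%:R <= w / h.
    by rewrite natrB ?min1// ler_pdivlMr// mulrBl; lra.
  rewrite -truncn_ge_nat// -/n; have := min1 s sA => /=; lia.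
have := uniq_leq_size _ sub.
rewrite map_inj_uniq ?fintype.enum_uniq; last exact: val_inj.
rewrite size_map -cardE size_iota => /(_ isT) le.
apply: (@le_trans _ _ n.+1%:R); first by rewrite ler_nat.
by rewrite -natr1 lerD2r /n truncn_le.
Qed.

(** On each of the four affine branches of the distance the admissible positions form an interval of
    length [w]. *)
Lemma card_window_half_edge (z : T) v i (a w : R) : 0 <= w ->
  #|[pred s : 'I_K | a <= mdist z (cell_center R (v, i, s)) <= a + w]|%:R <=
  4 * (w / h + 1).
Proof.
move=> w0; have [al [be [ga hd]]] := mdist_edge z (half_edge v i).
pose p (s : 'I_K) : R := s%:R * h.
have [sg [u [sg1 posE]]] : exists sg u : R, (sg = 1 \/ sg = -1) /\ forall s,
    half_pos v i (cell_pos R ((v, i, s) : cell d K)) = sg * p s + u.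
  have hp (x : R) : half_pos v i x = if ohead (val v) == Some i then 1 - x else x by [].
  case: (ohead (val v) == Some i) hp => hp.
    exists (-1), (1 - 2^-1 * h); split; first by right.
    by move=> s; rewrite hp /cell_pos /p /=; ring.
  exists 1, (2^-1 * h); split; first by left.
  by move=> s; rewrite hp /cell_pos /p /=; ring.
have [A [Ac AP]] : exists A : 'I_4 -> pred 'I_K, (forall k, #|A k|%:R <= w / h + 1 :> R) /\
    forall s, a <= mdist z (cell_center R (v, i, s)) <= a + w -> exists k, A k s.
  pose Q (e x : R) : pred 'I_K := fun s => a <= e * p s + x <= a + w.
  have gen (e x : R) : (e = 1 \/ e = -1) -> #|Q e x|%:R <= w / h + 1.
    by case=> ->; [apply: (@card_itv_mesh _ (a - x))|apply: (@card_itv_mesh _ (x - a - w))] => // s;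
      rewrite /Q /p => /andP[? ?]; apply/andP; split; lra.
  have sgN : - sg = 1 \/ - sg = -1 by case: sg1 => ->; [right|left]; rewrite ?opprK.
  exists (fun k : 'I_4 => nth (fun=> false)
    [:: Q sg (al + u); Q (- sg) (be - u); Q sg (u - ga); Q (- sg) (ga - u)] k); split.
    by case=> -[|[|[|[|//]]]] /= _; apply: gen.
  move=> s; rewrite /cell_center /pt /=.
  have := hd (half_pos v i (cell_pos R ((v, i, s) : cell d K))).
  rewrite half_pos01 ?cell_pos01// => /(_ isT) /=; rewrite posE.
  case=> ->; rewrite -/(p s) => sa.
  - by exists (@Ordinal 4 0 isT); rewrite /= /Q; move: sa => /andP[? ?]; apply/andP; split; lra.
  - by exists (@Ordinal 4 1 isT); rewrite /= /Q; move: sa => /andP[? ?]; apply/andP; split; lra.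
  - by exists (@Ordinal 4 2 isT); rewrite /= /Q; move: sa => /andP[? ?]; apply/andP; split; lra.
  - by exists (@Ordinal 4 3 isT); rewrite /= /Q; move: sa => /andP[? ?]; apply/andP; split; lra.
apply: (@le_trans _ _ (\sum_(k < 4) #|A k|%:R)).
  rewrite -natr_sum ler_nat -sum1_card.
  under [leqRHS]eq_bigr do rewrite -sum1_card.
  rewrite (exchange_big_dep xpredT)//= big_mkcond; apply: leq_sum => s _.
  case: ifP => // /AP[k Ak]; rewrite sum1_card.
  by apply/card_gt0P; exists k.
by apply: le_trans (ler_sum _ (fun k _ => Ac k)) _; rewrite sumr_const card_ord mulr_natl.
Qed.

End window_count.

(** * Expected numbers of chains and near ties *)

Section patterns.
Variables (R : realType) (d K R0 : nat) (q : R).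
Hypothesis K0 : (0 < K)%N.
Hypothesis q01 : 0 <= q <= 1.
Local Notation h := (mesh R K).

Let h0 : 0 < h := mesh_gt0 R K0.

Definition fin_vertex : finType := seq_sub (vball d R0).
Definition fin_cell : finType := (fin_vertex * 'I_d * 'I_K)%type.

Definition to_cell (c : fin_cell) : cell d K := (val c.1.1, c.1.2, c.2).

Lemma to_cell_inj : injective to_cell.
Proof. by move=> [[v i] s] [[v' i'] s'] [/val_inj -> -> ->]. Qed.

Lemma ex_fin_cell (c : cell d K) : (size (val c.1.1) <= R0)%N -> exists c', to_cell c' = c.
Proof.
rewrite -mem_vball => h; exists (SeqSub h, c.1.2, c.2).
by rewrite /to_cell /=; case: c h => -[].
Qed.

Definition fdist (c c' : fin_cell) : R := cell_dist R (to_cell c) (to_cell c').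

Definition window (a w : R) (c : fin_cell) : pred fin_cell :=
  [pred c' | a <= fdist c c' <= a + w].

(** A translation to the root makes the bound depend on [n] and not on [R0]; this matters because
    [R0] grows with [K]. *)
Lemma card_window (a w : R) (c : fin_cell) (n : nat) : 0 <= w -> a + w + 1 <= n%:R ->
  #|window a w c|%:R <= (size (vball d n) * d)%:R * (4 * (w / h + 1)).
Proof.
move=> w0 an; have [F [G [f [g [tr fr]]]]] := ex_translation R (val c.1.1).
have near (v : fin_vertex) i s : window a w c (v, i, s) -> val v \in map f (vball d n).
  move=> /andP[_ le]; rewrite -[val v](trans_vVK tr) map_f// mem_vball -(ler_nat R).
  rewrite -mdist_rootE -(trans_dist tr).
  have d0 : (0 < d)%N := leq_ltn_trans (leq0n i) (ltn_ord i).
  rewrite !(trans_inl _ d0 tr) fr (trans_vVK tr).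
  apply: le_trans an; apply: le_trans (metric_triangle _ (cell_center R (to_cell c)) _) _.
  have h2 := mdist_center_vertex R K0 (to_cell c).
  have h1 := mdist_center_vertex R K0 (to_cell (v, i, s)).
  rewrite metric_sym in h1.
  have := metric_triangle (cell_center R (to_cell c)) (cell_center R (to_cell (v, i, s))) (inl (val v)).
  move: le h1 h2; rewrite /fdist /cell_dist /=; lra.
have -> : #|window a w c|%:R = \sum_(v : fin_vertex) \sum_(i < d)
    #|[pred s : 'I_K | window a w c (v, i, s)]|%:R :> R.
  rewrite -sum1_card natr_sum big_mkcond /=.
  rewrite pair_bigA /= -(eq_bigr _ (fun _ _ => erefl)) /=.
  under [RHS]eq_bigr do rewrite -sum1_card natr_sum big_mkcond /=.
  rewrite [RHS]pair_bigA /=; apply: eq_bigr => -[[v i] s] _ //=.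
apply: (@le_trans _ _ (\sum_(v : fin_vertex | val v \in map f (vball d n))
    \sum_(i < d) (4 * (w / h + 1)))).
  rewrite [leRHS]big_mkcond; apply: ler_sum => v _; case: ifPn => [_|vn].
    by apply: ler_sum => i _; exact: card_window_half_edge.
  rewrite big1// => i _; rewrite eq_card0// => s; rewrite inE.
  by apply/negbTE; apply: contra vn; exact: near.
rewrite sumr_const [X in X <= _](_ : _ = (#|[pred v : fin_vertex | val v \in map f (vball d n)]|)%:R *
   (d%:R * (4 * (w / h + 1)))); last first.
  by rewrite sumr_const card_ord -[LHS]mulr_natl -[_ *+ d]mulr_natl.
rewrite natrM -mulrA ler_wpM2r//.
  by rewrite !mulr_ge0// addr_ge0// divr_ge0// ltW.
rewrite ler_nat -(size_map f) cardE -(size_map val).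
apply: uniq_leq_size; first by rewrite map_inj_uniq ?fintype.enum_uniq//; exact: val_inj.
by move=> u /mapP[v]; rewrite mem_enum => ? ->.
Qed.

Lemma Ex_subset (C : finType) (A : {set C}) :
  Ex q (fun w : {set C} => (A \subset w)%:R) = q ^+ #|A|.
Proof.
move: {2}#|A| (leqnn #|A|) => n; elim: n A => [|n IH] A.
  rewrite leqn0 cards_eq0 => /eqP->; rewrite cards0 -[RHS](Ex_cst C q).
  by apply: eq_bigr => w _; rewrite finset.sub0set.
have [->|/set0Pn[j jA]] := eqVneq A finset.set0.
  by move=> _; apply: IH; rewrite cards0.
rewrite (cardsD1 j) jA add1n ltnS => An; rewrite exprS -IH// (two_point q _ j).
rewrite [in RHS]/Ex mulr_sumr; apply: eq_bigr => w _; rewrite mulrCA; congr (_ * _).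
rewrite (_ : (A \subset w :\ j) = false) ?mulr0 ?add0r; last first.
  by apply/negbTE/fintype.subsetPn; exists j => //; rewrite !inE eqxx.
congr (_ * _%:R); congr nat_of_bool; by rewrite finset.subDset.
Qed.

Lemma Ex_all (C : finType) (s : seq C) :
  Ex q (fun w : {set C} => (uniq s && all (mem w) s)%:R) <= q ^+ size s.
Proof.
have q0 : 0 <= q by case/andP: q01.
case: (boolP (uniq s)) => us /=; last first.
  by rewrite /Ex big1 ?exprn_ge0// => w _; rewrite mulr0.
rewrite -(card_uniqP us) -cardsE -Ex_subset; apply: ler_Ex => // w.
rewrite ler_nat; case: (boolP (all _ _)) => // /allP h.
by rewrite lt0b; apply/fintype.subsetP => x; rewrite inE => /h.
Qed.

Lemma Ex_has (C : finType) (A : Type) (s : seq A) (F : A -> {set C} -> bool) (e : R) :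
  (forall a, Ex q (fun w => (F a w)%:R) <= e) ->
  Ex q (fun w => (has (F^~ w) s)%:R) <= (size s)%:R * e.
Proof.
move=> he; elim: s => [|a s IH] /=.
  by rewrite mul0r /Ex big1// => w _; rewrite mulr0.
rewrite -natr1 mulrDl mul1r addrC; apply: le_trans (lerD (he a) IH).
rewrite -ExD; apply: ler_Ex => // w.
by rewrite -natrD ler_nat; case: (F a w); case: (has _ _).
Qed.

Lemma size_flatten_map (A B : Type) (F : A -> seq B) (s : seq A) :
  size (flatten [seq F x | x <- s]) = \sum_(x <- s) size (F x).
Proof.
elim: s => [|a s IH] /=; first by rewrite big_nil.
by rewrite size_cat IH big_cons.
Qed.

(* Candidate cell chains starting at [c] whose n steps have lengths in slices of
   width w (up to the mesh), with nonincreasing slice indices at most k. *)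
Fixpoint chains (w : R) (n k : nat) (c : fin_cell) : seq (seq fin_cell) :=
  if n is n'.+1 then
    flatten [seq flatten [seq map (cons c') (chains w n' j c') |
                            c' <- enum (window (j%:R * w - h) (w + 2 * h) c)]
            | j <- iota 0 k.+1]
  else [:: [::]].

Lemma chainsS w n k c : chains w n.+1 k c =
  flatten [seq flatten [seq map (cons c') (chains w n j c') |
                          c' <- enum (window (j%:R * w - h) (w + 2 * h) c)]
          | j <- iota 0 k.+1].
Proof. by []. Qed.

(** Since the slice index never increases, the geometric sum of $2^j$ over $j \le k$ costs only one
    more factor 2 per step. *)
Lemma size_chains (w be : R) (n k kmax : nat) (c : fin_cell) : (k <= kmax)%N ->
  (forall j c', (j <= kmax)%N ->
     #|window (j%:R * w - h) (w + 2 * h) c'|%:R <= be) ->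
  (size (chains w n k c))%:R <= (2 * be) ^+ n * 2 ^+ k.
Proof.
move=> kk hbe; have be0 : 0 <= be by apply: le_trans (hbe 0%N c (leq0n _)).
elim: n k c kk => [|n IH] k c kk; first by rewrite expr0 mul1r exprn_ege1// ler1n.
rewrite chainsS size_flatten_map natr_sum.
apply: (@le_trans _ _ (\sum_(j <- iota 0 k.+1) be * ((2 * be) ^+ n * 2 ^+ j))).
  rewrite big_seq [leRHS]big_seq; apply: ler_sum => j; rewrite mem_iota add0n ltnS => /= jk.
  have jkm : (j <= kmax)%N by exact: leq_trans kk.
  rewrite size_flatten_map natr_sum.
  apply: (@le_trans _ _ (\sum_(c' <- enum (window (j%:R * w - h) (w + 2 * h) c))
      (2 * be) ^+ n * 2 ^+ j)).
    by apply: ler_sum => c' _; rewrite size_map; exact: IH.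
  rewrite big_const_seq count_predT -cardE iter_addr_0 -[leLHS]mulr_natl ler_wpM2r ?hbe//.
  by rewrite mulr_ge0 ?exprn_ge0 ?mulr_ge0.
have -> : \sum_(j <- iota 0 k.+1) be * ((2 * be) ^+ n * 2 ^+ j) =
    be * (2 * be) ^+ n * (2 ^+ k.+1 - 1).
  rewrite -[k.+1]subn0 -/(index_iota 0 k.+1) subn0; elim: (k.+1) => [|l IHl].
    by rewrite big_geq// expr0 subrr mulr0.
  by rewrite big_nat_recr//= IHl [2 ^+ l.+1]exprS; ring.
have X0 : 0 <= be * (2 * be) ^+ n by rewrite mulr_ge0 ?exprn_ge0 ?mulr_ge0.
rewrite !exprS; set X := (2 * be) ^+ n in X0 *; set Y := 2 ^+ k.
by clearbody X Y; lra.
Qed.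

Lemma size_mem_chains w n k c s : s \in chains w n k c -> size s = n.
Proof.
elim: n k c s => [|n IH] k c s; first by rewrite inE => /eqP->.
move=> /flattenP[s1 /mapP[j _ ->]] /flattenP[s2 /mapP[c' _ ->]] /mapP[s3 h ->].
by rewrite /= (IH _ _ _ h).
Qed.

Definition ex_chain w n k c (o : {set fin_cell}) :=
  has (fun s => uniq (c :: s) && all (mem o) (c :: s)) (chains w n k c).

Lemma Ex_chain (w be : R) (n k : nat) (c : fin_cell) :
  (forall j c', (j <= k)%N ->
     #|window (j%:R * w - h) (w + 2 * h) c'|%:R <= be) ->
  Ex q (fun o => (ex_chain w n k c o)%:R) <= (2 * be) ^+ n * 2 ^+ k * q ^+ n.+1.
Proof.
move=> hbe; have q0 : 0 <= q by case/andP: q01.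
pose F s (o : {set fin_cell}) := [&& size s == n, uniq (c :: s) & all (mem o) (c :: s)].
have -> : Ex q (fun o => (ex_chain w n k c o)%:R) =
    Ex q (fun o => (has (F^~ o) (chains w n k c))%:R).
  apply: eq_bigr => o _; congr (_ * _%:R); congr nat_of_bool.
  by apply: eq_in_has => s hs; rewrite /F (size_mem_chains hs) eqxx.
apply: (@le_trans _ _ ((size (chains w n k c))%:R * q ^+ n.+1)).
  apply: Ex_has => s; case: (eqVneq (size s) n) => sn.
    rewrite -sn; apply: le_trans (Ex_all (c :: s)); apply: ler_Ex => // o.
    by rewrite /F sn eqxx.
  rewrite /Ex big1 ?exprn_ge0// => o _; by rewrite /F (negbTE sn) mulr0.
by rewrite ler_wpM2r ?exprn_ge0//; apply: (@size_chains w be n k k).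
Qed.

(** A tie of points up to [4 * h] becomes a tie of cell centers up to [6 * h], each of the two
    distances moving by at most [h]. *)
Definition tie_triple (L : R) (c0 : fin_cell) (t : fin_cell * fin_cell * fin_cell) : bool :=
  [&& window 0 L c0 t.1.1, window 0 L t.1.1 t.1.2 &
      window (fdist t.1.1 t.1.2 - 6 * h) (12 * h) t.1.2 t.2].

Definition tie (L : R) (c0 : fin_cell) (o : {set fin_cell}) : bool :=
  has (fun t => tie_triple L c0 t &&
       let s := [:: t.1.1; t.1.2; t.2] in uniq s && all (mem o) s)
    (enum [pred t | tie_triple L c0 t]).

(** Two cells range over order [L / h] positions, while the third is confined to a window of width
    [12 * h], whence the constant 13. Against three occupied cells, one factor [h] is gained. *)
Lemma card_tie (L : R) (c0 : fin_cell) (n : nat) : 0 <= L -> L + 6 * h + 1 <= n%:R ->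
  #|[pred t | tie_triple L c0 t]|%:R <=
  ((size (vball d n) * d)%:R * 4) ^+ 3 * (L / h + 1) ^+ 2 * 13.
Proof.
move=> L0 Ln; have hp : 0 < h := h0; set N := (size (vball d n) * d)%:R * 4.
have N0 : 0 <= N by rewrite mulr_ge0.
have l0 : 0 <= L / h + 1 by rewrite addr_ge0// divr_ge0// ltW.
have bL c : #|window 0 L c|%:R <= N * (L / h + 1).
  rewrite /N -mulrA; apply: card_window => //; lra.
have b3 c1 c2 : window 0 L c1 c2 ->
    #|window (fdist c1 c2 - 6 * h) (12 * h) c2|%:R <= N * 13.
  rewrite /window /= => /andP[_ le].
  have := @card_window (fdist c1 c2 - 6 * h) (12 * h) c2 n.
  rewrite mulr_ge0 ?(ltW h0)// mulfK ?gt_eqF// => /(_ isT).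
  rewrite /N -mulrA (_ : (4 * (12 + 1) : R) = 4 * 13); last by ring.
  apply; lra.
have -> : #|[pred t | tie_triple L c0 t]|%:R = \sum_(c1 | window 0 L c0 c1)
    \sum_(c2 | window 0 L c1 c2) #|window (fdist c1 c2 - 6 * h) (12 * h) c2|%:R :> R.
  rewrite -sum1_card natr_sum big_mkcond /=.
  under [RHS]eq_bigr do under eq_bigr do rewrite -sum1_card natr_sum.
  rewrite (@pair_big_dep _ _ _ _ _ (window 0 L c0) (fun c1 c2 => window 0 L c1 c2)) /=.
  rewrite (@pair_big_dep _ _ _ _ _ (fun p => window 0 L c0 p.1 && window 0 L p.1 p.2)
    (fun p c3 => window (fdist p.1 p.2 - 6 * h) (12 * h) p.2 c3)) /= [RHS]big_mkcond.
  by apply: eq_bigr => -[[c1 c2] c3] _; rewrite inE /tie_triple /= andbA.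
apply: (@le_trans _ _ (\sum_(c1 | window 0 L c0 c1) \sum_(c2 | window 0 L c1 c2) (N * 13))).
  by apply: ler_sum => c1 _; apply: ler_sum => c2; exact: b3.
apply: (@le_trans _ _ (\sum_(c1 | window 0 L c0 c1) (N * (L / h + 1) * (N * 13)))).
  apply: ler_sum => c1 _; rewrite sumr_const -[leLHS]mulr_natl.
  by rewrite ler_wpM2r ?mulr_ge0//; exact: bL.
rewrite sumr_const -[leLHS]mulr_natl.
rewrite (_ : N ^+ 3 * _ * _ = N * (L / h + 1) * (N * (L / h + 1) * (N * 13))); last by ring.
by rewrite ler_wpM2r ?mulr_ge0//; exact: bL.
Qed.

Lemma Ex_tie (L : R) (c0 : fin_cell) (n : nat) : 0 <= L -> L + 6 * h + 1 <= n%:R ->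
  Ex q (fun o => (tie L c0 o)%:R) <=
  ((size (vball d n) * d)%:R * 4) ^+ 3 * (L / h + 1) ^+ 2 * 13 * q ^+ 3.
Proof.
move=> L0 Ln; have q0 : 0 <= q by case/andP: q01.
apply: le_trans (ler_wpM2r _ (card_tie c0 L0 Ln)); last by rewrite exprn_ge0.
rewrite cardE; apply: Ex_has => t.
apply: le_trans (Ex_all [:: t.1.1; t.1.2; t.2]); apply: ler_Ex => // o.
rewrite ler_nat; case: (tie_triple L c0 t); [rewrite andTb; exact: leqnn|exact: leq0n].
Qed.

End patterns.

(** * Density of survivors *)

Lemma translation_flip (R : realType) (d : nat) (i : 'I_d) :
  translation (@flip_point R d i) (flip_point i) (flip_vertex i) (flip_vertex i).
Proof.
split; try exact: flip_pointK; try exact: flip_vertexK.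
- exact: mdist_flip.
- by move=> v j a a01; exact: flip_pt.
Qed.

Lemma sum_exclusive_le1 (R : realType) (A : eqType) (s : seq A) (F : A -> R) :
  uniq s -> (forall a, (F a == 0) || (F a == 1)) ->
  (forall a b, a \in s -> b \in s -> F a = 1 -> F b = 1 -> a = b) ->
  \sum_(a <- s) F a <= 1.
Proof.
move=> us F01; elim: s us => [|a s IH] /=; first by rewrite big_nil.
move=> /andP[as_ us] ex; rewrite big_cons.
have exs b c : b \in s -> c \in s -> F b = 1 -> F c = 1 -> b = c.
  by move=> bs cs; apply: ex; rewrite inE ?bs ?cs orbT.
case/orP: (F01 a) => /eqP Fa; first by rewrite Fa add0r; exact: IH.
rewrite Fa big_seq big1 ?addr0// => b bs; case/orP: (F01 b) => /eqP// Fb.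
by move: as_; rewrite (ex a b) ?bs// inE ?eqxx ?bs ?orbT.
Qed.

Lemma half_half_lt3 (R : realFieldType) (x y : R) : y + 2^-1 + x + 2^-1 < x + y + 3.
Proof. lra. Qed.

Section root_density.
Variables (R : realType) (d K t R0 : nat).
Hypothesis d3 : (3 <= d)%N.
Hypothesis K0 : (0 < K)%N.
Hypothesis t4 : (4 <= t)%N.
Hypothesis R0_large : (2 * K * t * (2 * t) + t + 3 <= R0)%N.
Local Notation h := (mesh R K).
Local Notation C := (fin_cell d K R0).
Local Notation m := (2 * K * t)%N.
Local Notation vtx v := (inl v : regular_tree R d).
Implicit Types (o : {set C}) (v : vertex d) (i : 'I_d).

Definition cells_of o : set (cell d K) := [set c | exists2 c', c' \in o & to_cell c' = c].

Definition survives v o : bool :=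
  `[< exists i s, thin R (cells_of o) m (v, i, s) >].

Let h0 : 0 < h := mesh_gt0 R K0.

Let mh : m%:R * h = t%:R :> R.
Proof.
rewrite /mesh [(2 * K * t)%N]mulnC natrM -mulrA divff ?mulr1//.
by rewrite pnatr_eq0; lia.
Qed.

Let levm : level R K m = 2 * t%:R - h.
Proof. by rewrite /level natrM -mulrA mh. Qed.

Let h_half : h <= 2^-1.
Proof. by rewrite /mesh lef_pV2 ?posrE ?ltr0n ?ler_nat; lia. Qed.

(** Surviving cells are more than $2t-h$ apart, whereas cells at vertices of depth at most $t-2$
    have centers within $2(t-2)+1$ of each other. *)
Lemma survives_unique (v v' : vertex d) o : (size (val v) <= t - 2)%N ->
  (size (val v') <= t - 2)%N -> survives v o -> survives v' o -> v = v'.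
Proof.
move=> vt v't /asboolP[i [s th]] /asboolP[i' [s' th']].
apply: contrapT => vv; have ne : ((v', i', s') : cell d K) <> (v, i, s).
  by move=> [e _ _]; apply: vv.
have := thin_sep K0 th th' ne; rewrite levm.
have d1 := mdist_center_vertex R K0 ((v, i, s) : cell d K).
have d2 := mdist_center_vertex R K0 ((v', i', s') : cell d K).
have r1 := @mdist_rootE R d v; have r2 := @mdist_rootE R d v'.
have t1 := metric_triangle (cell_center R ((v, i, s) : cell d K)) (vtx v) (cell_center R ((v', i', s') : cell d K)).
have t2 := metric_triangle (vtx v) (vtx (tree_root d)) (cell_center R ((v', i', s') : cell d K)).
have t3 := metric_triangle (vtx (tree_root d)) (vtx v') (cell_center R ((v', i', s') : cell d K)).
rewrite metric_sym in d1; rewrite metric_sym in r1.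
have vtR : (size (val v))%:R <= t%:R - 2 :> R by rewrite lerBrDr -natrD ler_nat; lia.
have v'tR : (size (val v'))%:R <= t%:R - 2 :> R by rewrite lerBrDr -natrD ler_nat; lia.
by rewrite /cell_dist => hh; move: d1 d2 r1 r2 t1 t2 t3 hh vtR v'tR h_half => /=; lra.
Qed.

(** The thinning makes [m] steps of range at most [2 * t] from a vertex of depth at most [t]: this
    is the origin of [R0_large]. *)
Let near_size v i s (c' : cell d K) : (size (val v) <= t)%N ->
  cell_dist R (v, i, s) c' <= m%:R * (2 * t)%:R -> (size (val c'.1.1) < R0)%N.
Proof.
move=> vt le; have := mdist_center_depth R K0 c'.
have d1 := mdist_center_vertex R K0 ((v, i, s) : cell d K).
have r1 := @mdist_root_le R d v.
have t1 := metric_triangle (vtx (tree_root d)) (vtx v) (cell_center R ((v, i, s) : cell d K)).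
have t2 := metric_triangle (vtx (tree_root d)) (cell_center R ((v, i, s) : cell d K)) (cell_center R c').
have vtR : (size (val v))%:R <= t%:R :> R by rewrite ler_nat.
have R0R : (m * (2 * t) + t + 3)%:R <= R0%:R :> R by rewrite ler_nat.
rewrite !natrD natrM in R0R; rewrite -(ltr_nat R).
move: le d1 r1 t1 t2 vtR R0R; rewrite /cell_dist /= => le d1 r1 t1 t2 vtR R0R dd.
apply: le_lt_trans dd _; apply: (le_lt_trans (lerD t2 (lexx _))).
apply: (le_lt_trans (lerD (lerD t1 le) (lexx _))).
apply: (le_lt_trans (lerD (lerD (lerD (le_trans r1 vtR) d1) (lexx _)) (lexx _))).
apply: lt_le_trans R0R.
exact: half_half_lt3.
Qed.

Lemma thin_near v i s O O' : (size (val v) <= t)%N ->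
  (forall c' : cell d K, (size (val c'.1.1) < R0)%N -> O c' <-> O' c') ->
  thin R O m (v, i, s) <-> thin R O' m (v, i, s).
Proof.
move=> vt OO'; apply: (@thin_local _ _ _ K0 (2 * t)%:R) => //.
  by rewrite levm natrM gerBl ltW.
by move=> c' /(near_size vt); exact: OO'.
Qed.

Lemma val_insubd_vertex (v : fin_vertex d R0) (x : vertex d) :
  val (insubd v x) = if (size (val x) <= R0)%N then x else val v.
Proof. by rewrite -mem_vball val_insubd. Qed.

(** The default value of [insubd] matters: a cell that the flip would carry out of the finite ball
    stays in place, so the map remains an involution. *)
Definition flip_fin i (c : C) : C :=
  (insubd c.1.1 (flip_vertex i (val c.1.1)), c.1.2, c.2).

Lemma flip_finK i : involutive (flip_fin i).
Proof.
move=> [[v j] s]; rewrite /flip_fin /=; congr (_, _, _); apply/val_inj.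
have vR := valP v; rewrite mem_vball in vR.
rewrite !val_insubd_vertex; case: (boolP (size (val (flip_vertex i (val v))) <= R0)%N) => h.
  by rewrite flip_vertexK vR.
by rewrite (negbTE h).
Qed.

Lemma flip_fin_to_cell i (c : C) : (size (val (flip_vertex i (val c.1.1))) <= R0)%N ->
  to_cell (flip_fin i c) = map_cell (flip_vertex i) (to_cell c).
Proof. by rewrite -mem_vball /to_cell /flip_fin /map_cell /= val_insubd_vertex mem_vball => ->. Qed.

Lemma survives_flip i v o : (size (val v) <= t)%N ->
  survives (flip_vertex i v) o = survives v (flip_fin i @: o).
Proof.
move=> vt; apply: asbool_equiv_eq.
suff H j s : thin R (cells_of o) m (flip_vertex i v, j, s) <->
    thin R (cells_of (flip_fin i @: o)) m (v, j, s).
  by split => -[j [s /H th]]; exists j, s.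
rewrite -[X in thin _ _ _ X]/(map_cell (flip_vertex i) ((v, j, s) : cell d K)).
rewrite -(thin_map K0 _ _ _ (translation_flip R i)).
apply: thin_near => // c' c'R.
have fR : (size (val (flip_vertex i c'.1.1)) <= R0)%N.
  by apply: leq_trans (size_flip_word _ _) _.
have ffK (c : cell d K) : map_cell (flip_vertex i) (map_cell (flip_vertex i) c) = c.
  by case: c => -[? ?] ?; rewrite /map_cell /= flip_vertexK.
split => [[c co e]|[c /imsetP[c0 c0o e] c'E]].
  exists (flip_fin i c); first exact: imset_f.
  rewrite flip_fin_to_cell ?e ?ffK//.
  have -> : val c.1.1 = flip_vertex i c'.1.1 by move: e => /(congr1 (fun c => c.1.1)).
  by rewrite flip_vertexK ltnW.
exists c0 => //; rewrite -[c0](flip_finK i) -e flip_fin_to_cell ?c'E//.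
by have -> : val c.1.1 = c'.1.1 by rewrite -c'E.
Qed.

(** Cells at the extreme depth [R0] lie beyond the range of the thinning; they are the only ones
    that [flip_fin] can fail to move. *)
Lemma survives_indep v (j : C) : (size (val v) <= t)%N -> size (val (val j.1.1)) = R0 ->
  indep j (fun o => (survives v o)%:R : R).
Proof.
move=> vt jR o; congr (_%:R); congr nat_of_bool; apply: asbool_equiv_eq.
suff H i s : thin R (cells_of (o :\ j)) m (v, i, s) <->
    thin R (cells_of (j |: o)%SET) m (v, i, s).
  by split => -[i [s /H th]]; exists i, s.
apply: thin_near => // c' c'R; split => -[c co e]; exists c => //.
  by rewrite !inE; move: co; rewrite !inE => /andP[_ ->]; rewrite orbT.
move: co; rewrite !inE; case: eqVneq => //= cj _.
by move: c'R; rewrite -e cj /= jR ltnn.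
Qed.

Variable q : R.
Hypothesis q01 : 0 <= q <= 1.

Local Notation Y := (fun v o => (survives v o)%:R : R).
Local Notation p := (Ex q (Y (tree_root d))).

Lemma survives01 v o : (Y v o == 0) || (Y v o == 1).
Proof. by move=> /=; case: (survives v o); rewrite /= ?eqxx ?orbT. Qed.

Lemma Ex_survives v : (size (val v) <= t)%N -> Ex q (Y v) = p.
Proof.
have [w vw] : exists w, val v = w by exists (val v).
elim/last_ind: w v vw => [|w i IH] v vw vt.
  by have -> : v = tree_root d by exact/val_inj.
have ri : reduced (rcons w i) by rewrite -vw; exact: valP v.
have rw : reduced w by move: ri; rewrite reduced_rcons => /andP[].
pose u : vertex d := exist _ w rw.
have ut : (size (val u) <= t)%N by move: vt; rewrite vw size_rcons => /ltnW.
rewrite -(IH u erefl ut) (_ : v = flip_vertex i u); last first.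
  by apply/val_inj; rewrite vw /= flip_word_rconsV.
rewrite -(cE_0 q _ finset.set0) -(cE_0 q _ (flip_fin i @: finset.set0)).
rewrite (cE_inv _ _ _ (flip_finK i) (f := Y u)) ?imset0//.
by move=> o /=; rewrite survives_flip.
Qed.

Lemma survives_sum_le1 (B : seq (vertex d)) o : uniq B ->
  (forall v, v \in B -> (size (val v) <= t - 2)%N) -> \sum_(v <- B) Y v o <= 1.
Proof.
move=> uB Bt; apply: sum_exclusive_le1 => //.
  by move=> v; exact: survives01.
move=> v v' vB v'B; case E: (survives v o); case E': (survives v' o) => //=.
- by move=> _ _; apply: (survives_unique (Bt v vB) (Bt v' v'B) E E').
- by move=> _ /eqP; rewrite eq_sym oner_eq0.
- by move=> /eqP; rewrite eq_sym oner_eq0.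
- by move=> /eqP; rewrite eq_sym oner_eq0.
Qed.

Let sum_p (B : seq (vertex d)) : (forall v, v \in B -> (size (val v) <= t)%N) ->
  \sum_(v <- B) Ex q (Y v) = (size B)%:R * p.
Proof.
move=> Bt; rewrite big_seq (eq_bigr (fun=> p)) => [|v vB]; last exact/Ex_survives/Bt.
by rewrite -big_seq big_const_seq count_predT iter_addr_0 mulr_natl.
Qed.

Let size_p_le1 (B : seq (vertex d)) : uniq B ->
  (forall v, v \in B -> (size (val v) <= t - 2)%N) -> (size B)%:R * p <= 1.
Proof.
move=> uB Bt; rewrite -sum_p; last by move=> v /Bt; lia.
rewrite -Ex_sum -[leRHS](Ex_cst C q); apply: ler_Ex => // o.
exact: survives_sum_le1.
Qed.

Let info_p (B : seq (vertex d)) : (forall v, v \in B -> (size (val v) <= t)%N) ->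
  info q (fun v o => Y v o) B finset.set0 = (size B)%:R * xlnx p + xlnx (1 - (size B)%:R * p).
Proof.
move=> Bt; rewrite info_set0 sum_p//; congr (_ + _).
rewrite big_seq (eq_bigr (fun=> xlnx p)) => [|v vB]; last by rewrite Ex_survives// Bt.
by rewrite -big_seq big_const_seq count_predT iter_addr_0 mulr_natl.
Qed.

(** The radius $t-4$ leaves room for the edge ball, of radius $t-3$, and for the ball of radius
    $t-2$ that gives the factor 4 below; at all these depths survivors exclude each other. *)
Lemma root_density :
  p <= (3 + 6 * ((t - 4) * d)%:R) / d.-1%:R ^+ (2 * (t - 4)).
Proof.
pose k := (t - 4)%N; pose N := size (vball d k); rewrite -/k.
have p0 : 0 <= p by apply: Ex_ge0 => // o; rewrite ler0n.
have p1 : p <= 1.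
  rewrite -[leRHS](Ex_cst C q); apply: ler_Ex => // o.
  by case: (survives _ o).
have d0 : (0 < d)%N by lia.
pose i0 : 'I_d := Ordinal d0.
pose M := size (vball d k ++ ending i0 k).
have ballt j v : v \in vball d j -> (j <= t - 2)%N -> (size (val v) <= t - 2)%N.
  by rewrite mem_vball => ? ?; apply: leq_trans; eassumption.
have edget i v : v \in vball d k ++ ending i k -> (size (val v) <= t - 2)%N.
  rewrite mem_cat => /orP[/ballt -> //|]; first by rewrite /k; lia.
  by rewrite mem_ending => /andP[/eqP-> _]; rewrite /k; lia.
have le2 (s : nat) : (s <= t - 2 -> s <= t)%N by lia.
(* Two more units of radius multiply the ball by at least 4, and even the larger ball contains at
   most one survivor. *)
have Np : N%:R * p <= 4^-1.
  have le : (size (vball d (k + 2)))%:R * p <= 1.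
    by apply: size_p_le1 (uniq_vball _ _) _ => v /ballt; apply; rewrite /k; lia.
  have : (4 * N <= size (vball d (k + 2)))%N.
    have e1 := size_vball_words k d3; have e2 := size_vball_words k.+2 d3.
    rewrite addn2; rewrite !expnS -!size_vball -/N in e1 e2.
    move: (d.-1 ^ k)%N (size (vball d k.+2)) e1 e2 => x y.
    have : (2 <= d.-1)%N by lia.
    move: (d.-1) => e e2 h1 h2.
    have : (4 * (d * x) <= d * (e * (e * x)))%N.
      have : (4 * x <= e * (e * x))%N by rewrite mulnA leq_mul2r -[4%N]/(2 * 2)%N leq_mul ?orbT.
      by move: (e * (e * x))%N => z; nia.
    by nia.
  rewrite -(ler_nat R) natrM => hN; have := ler_wpM2r p0 hN; lra.
have Mp : M%:R * p <= 1 by apply: size_p_le1 (uniq_edge_vball _ _) _; exact: edget.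
apply: (@density_bound _ _ _ N) => //; first by rewrite p0.
  exact: leq_size_vball.
have sM i : size (vball d k ++ ending i k) = M by rewrite /M !size_cat !size_ending.
apply: (density_ineq d3 (size_edge_vball i0 k d3) p0 Np Mp).
have [D' pD'] := boolp.choice (fun i : 'I_d => perm_flip_vball i k).
(* [S i] consists of the cells on the root side of the edge of color [i] at the root: those whose
   word does not end in [i]. *)
have ev := @edge_vertex R C q (vertex d) (fun v o => Y v o) 'I_d flip_fin (@flip_vertex d)
  (fun i => [set c : C | ~~ ends_with i (val (val c.1.1))]%SET) (vball d k)
  (fun i => vball d k ++ ending i k) (fun i => ending i k) D' q01.
have {ev} := ev (fun v o => survives01 v o) flip_finK.
rewrite card_ord => ev.
have {ev} := ev _ _ pD' _ _ _ _ _; rewrite info_p; last by move=> v /ballt h; apply: le2; apply: h; rewrite /k; lia.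
under eq_bigr do rewrite (info_p (fun v hv => le2 _ (edget _ v hv))) sM.
rewrite sumr_const card_ord -[_ *+ d]mulr_natl; apply => //.
- move=> i v o; rewrite mem_vball => vk; congr (_%:R); congr nat_of_bool.
  by apply: survives_flip; apply: leq_trans vk _; rewrite /k; lia.
- by move=> i o; apply: survives_sum_le1; [exact: uniq_edge_vball|exact: edget].
- move=> i c; rewrite !inE negbK => ec.
  rewrite /flip_fin /= val_insubd_vertex /= ifT.
    by rewrite flip_word_ends_with ?ec//; exact: (valP (val c.1.1)).
  rewrite flip_word_ends//; have := valP c.1.1; rewrite mem_vball.
  by apply: leq_trans; exact: leq_pred.
- move=> i c v; rewrite !inE /flip_fin /= val_insubd_vertex /= => ec.
  case: ifPn => [_|]; first by rewrite flip_word_ends_with ?ec//; exact: (valP (val c.1.1)).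
  rewrite flip_word_Nends//; last exact: (valP (val c.1.1)).
  rewrite size_rcons -ltnNge ltnS => Rc _ vk; apply: survives_indep.
    by move: vk; rewrite mem_vball => vk; apply: leq_trans vk _; rewrite /k; lia.
  by apply/eqP; rewrite eqn_leq Rc andbT; have := valP c.1.1; rewrite mem_vball.
- move=> c; apply: leq_trans (card_ends_with (val c.1.1)) _.
  by apply: subset_leq_card; apply/fintype.subsetP => i; rewrite !inE.
Qed.

End root_density.

(** * Balloons and thinning *)

Lemma uniq3 (A : eqType) (a b c : A) : a != b -> a != c -> b != c -> uniq [:: a; b; c].
Proof. by move=> ab ac bc; rewrite /= !inE negb_or ab ac bc. Qed.

Lemma all3 (A : Type) (P : pred A) (a b c : A) : P a -> P b -> P c -> all P [:: a; b; c].
Proof. by move=> /= -> -> ->. Qed.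

Section soundness.
Variables (R : realType) (d K t R0 n : nat).
Hypothesis d3 : (3 <= d)%N.
Hypothesis K0 : (0 < K)%N.
Hypothesis t4 : (4 <= t)%N.
Hypothesis n0 : (0 < n)%N.
Hypothesis R0_large : (2 * K * t * (2 * t) + t + 3 <= R0)%N.
Local Notation T := (regular_tree R d).
Local Notation h := (mesh R K).
Local Notation C := (fin_cell d K R0).
Local Notation m := (2 * K * t)%N.
Local Notation root := (inl (tree_root d) : T).
Implicit Types (o : {set C}) (c : C).

Definition max_step : R := 2 * t%:R + 1.
(** A point of the star of the root, at most [n] steps of length [max_step], and one further step to
    a neighbor that may enter a tie. *)
Definition region_radius : R := n%:R * max_step + 1 + max_step.
Definition slice_width : R := max_step / n%:R.
Definition tie_span : R := 2 * region_radius + 2.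

Hypothesis R0_radius : region_radius + 2 <= R0%:R.

Let h0 : 0 < h := mesh_gt0 R K0.

Let mh : m%:R * h = t%:R :> R.
Proof.
rewrite /mesh [(2 * K * t)%N]mulnC natrM -mulrA divff ?mulr1//.
by rewrite pnatr_eq0; lia.
Qed.

Let h_half : h <= 2^-1.
Proof. by rewrite /mesh lef_pV2 ?posrE ?ltr0n ?ler_nat; lia. Qed.

Let step0 : 0 < max_step.
Proof. by rewrite /max_step ltr_wpDl// mulr_ge0. Qed.

Let slice0 : 0 < slice_width.
Proof. by rewrite divr_gt0// ltr0n. Qed.

Definition spread (X : set T) : Prop :=
  (forall x, X x -> mdist root x <= region_radius -> exists c : cell d K, cellset c x) /\
  (forall x y (c : cell d K), X x -> X y -> mdist root x <= region_radius -> mdist root y <= region_radius ->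
     cellset c x -> cellset c y -> x = y).

Definition occupancy (X : set T) : {set C} :=
  [set c : C | `[< exists2 x, X x & cellset (to_cell c) x >]]%SET.

(** An event that depends on the occupied cells only, so that its probability is a Bernoulli
    expectation, and that occurs whenever a balloon centered in a cell of the star of the root is
    alive at time [t]. The cell [c0] only anchors the search for ties. *)
Definition suspicious (c0 : C) o : bool :=
  [|| survives R t (tree_root d) o,
      [exists c : C, (val c.1.1 == tree_root d) && ex_chain slice_width n n c o] |
      tie tie_span c0 o].

Lemma mem_occupancy (X : set T) c : (c \in occupancy X) <-> exists2 x, X x & cellset (to_cell c) x.
Proof. by rewrite inE; split => /asboolP. Qed.

Section points.
Variables (X : set T) (tau : T -> \bar R).
Hypothesis Xtau : popping_times X tau.
Hypothesis Xspread : spread X.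
Local Notation near x := (mdist root x <= region_radius).

Let ex_cell x : X x -> near x -> exists c : C, cellset (to_cell c) x.
Proof.
move=> Xx nx; have [c cx] := Xspread.1 x Xx nx.
have [|c' c'c] := @ex_fin_cell d K R0 c; last by exists c'; rewrite c'c.
rewrite -(ler_nat R); apply: le_trans (mdist_center_depth R K0 c) _.
have := metric_triangle root x (cell_center R c).
move: cx; rewrite /cellset /= => cx tr; rewrite metric_sym in cx.
by have hp : 0 < h := h0; have hh := h_half; have R0r := R0_radius; lra.
Qed.

Let dist_approx (c c' : C) x y : cellset (to_cell c) x -> cellset (to_cell c') y ->
  `|mdist x y - fdist R c c'| <= h.
Proof. exact: cell_dist_approx. Qed.

Lemma dchain_ex_chain (x : T) (s : seq T) (c : C) (L b : R) (k : nat) : 0 <= L ->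
  b <= k.+1%:R * slice_width -> X x ->
  (forall y, y \in x :: s -> near y) -> dchain X L b x s -> cellset (to_cell c) x ->
  exists s' : seq C, [/\ s' \in chains slice_width (size s) k c,
    (forall c', c' \in s' -> exists2 y, y \in s & cellset (to_cell c') y),
    (uniq s -> uniq s') & size s' = size s].
Proof.
move=> L0; elim: s x c b k => [|y s IH] x c b k bk Xx nr.
  by move=> _ _; exists [::]; split=> //; rewrite inE.
move=> [Xy xyb Lxy ch] cx.
have ny : near y by apply: nr; rewrite !inE eqxx orbT.
have [c' c'y] := ex_cell Xy ny.
(* The slice of the first step. Being below [b], the step lies in slice [k] or lower, and its own
   length bounds the next slice. *)
pose j := Num.truncn (mdist x y / slice_width).
have xy0 : 0 <= mdist x y / slice_width by rewrite divr_ge0 ?mdist_ge0 ?ltW.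
have /andP[j1 j2] := truncn_itv xy0.
rewrite -/j ler_pdivlMr// in j1; rewrite -/j ltr_pdivrMr// in j2.
have jk : (j <= k)%N.
  rewrite -ltnS -(ltr_nat R) -(ltr_pM2r slice0).
  by apply: le_lt_trans j1 _; exact: lt_le_trans bk.
have nr' z : z \in y :: s -> near z by move=> zs; apply: nr; rewrite inE zs orbT.
have [s' [s'c s'y us' ss']] := IH y c' (mdist x y) j (ltW j2) Xy nr' ch c'y.
exists (c' :: s'); split.
- apply/flattenP; eexists; first by apply/mapP; exists j; [rewrite mem_iota add0n ltnS; exact: jk|reflexivity].
  apply/flattenP; eexists; last by apply: map_f; exact: s'c.
  apply/mapP; exists c'; last by reflexivity.
  rewrite mem_enum inE.
  have /ler_normlP[e1 e2] := dist_approx cx c'y.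
  by rewrite -natr1 in j2; apply/andP; split; lra.
- move=> c1; rewrite inE => /orP[/eqP->|/s'y[z zs cz]]; first by exists y; rewrite ?inE ?eqxx.
  by exists z => //; rewrite inE zs orbT.
- rewrite [uniq (y :: s)]/= => /andP[ys us]; rewrite /= us' // andbT.
  apply/negP => /s'y[z zs cz].
  have zy : z = y.
    have Xz : X z := dchain_X ch zs.
    apply: (Xspread.2 z y (to_cell c')) => //.
    by apply: nr; rewrite !inE zs !orbT.
  by move: ys; rewrite -zy zs.
- by rewrite /= ss'.
Qed.

Lemma dchain_near (L b : R) (x y : T) (s : seq T) : 0 <= b -> dchain X L b x s ->
  y \in s -> mdist x y <= (size s)%:R * b.
Proof.
move=> b0 ch ys; case/splitPr: ys ch => s1 s2 ch.
have ch1 : dchain X L b x (rcons s1 y) by apply: (@dchain_cat _ _ _ _ _ _ _ s2); rewrite cat_rcons.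
have := dchain_dist ch1; rewrite last_rcons => /le_trans; apply.
by rewrite ler_wpM2r// ler_nat size_rcons size_cat /= addnS ltnS leq_addr.
Qed.

Lemma no_tie (c0 : C) (x y z : T) : val c0.1.1 = tree_root d ->
  ~~ tie tie_span c0 (occupancy X) -> X x -> X y -> X z -> near x -> near y -> near z ->
  x <> y -> y <> z -> x <> z -> 4 * h < `|mdist x y - mdist y z|.
Proof.
move=> c00 nt Xx Xy Xz nx ny nz xy yz xz; have hp : 0 < h := h0; have hh := h_half.
have sim := Xspread.2; have rad0 : 0 <= region_radius := le_trans (mdist_ge0 _ _) nx.
have center_root (c1 : C) u : cellset (to_cell c1) u -> near u ->
    mdist root (cell_center R (to_cell c1)) <= region_radius + h / 2.
  rewrite /cellset /= => cu nu.
  have := metric_triangle root u (cell_center R (to_cell c1)).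
  by rewrite metric_sym in cu; lra.
rewrite ltNge; apply/negP => le.
have [cx cxx] := ex_cell Xx nx; have [cy cyy] := ex_cell Xy ny; have [cz czz] := ex_cell Xz nz.
have ne (c1 c2 : C) x1 x2 : X x1 -> X x2 -> near x1 -> near x2 -> x1 <> x2 ->
    cellset (to_cell c1) x1 -> cellset (to_cell c2) x2 -> c1 != c2.
  move=> X1 X2 n1 n2 x12 cx1 cx2; apply/eqP => c12; apply: x12.
  by rewrite c12 in cx1; exact: sim cx1 cx2.
have tt : tie_triple tie_span c0 (cx, cy, cz).
  have a1 := center_root cx x cxx nx; have a2 := center_root cy y cyy ny.
  have a3 := center_root cz z czz nz.
  have a0 := mdist_center_vertex R K0 (to_cell c0); rewrite /= c00 in a0.
  have b1 := metric_triangle (cell_center R (to_cell c0)) root (cell_center R (to_cell cx)).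
  have b2 := metric_triangle (cell_center R (to_cell cx)) root (cell_center R (to_cell cy)).
  have /ler_normlP[e1 e2] := dist_approx cxx cyy.
  have /ler_normlP[e3 e4] := dist_approx cyy czz.
  have /ler_normlP[e5 e6] := le.
  rewrite metric_sym in a0; rewrite (metric_sym _ root) in b2.
  rewrite /tie_triple /window /= !mdist_ge0 !add0r /=.
  apply/and3P; split.
  - by rewrite /fdist /cell_dist /tie_span; lra.
  - by rewrite /fdist /cell_dist /tie_span; lra.
  - by apply/andP; split; lra.
move/negP: nt; apply; apply/hasP; exists (cx, cy, cz); last first.
  apply/andP; split; first exact: tt.
  apply/andP; split.
    by apply: uniq3; [exact: (ne _ _ x y)|exact: (ne _ _ x z)|exact: (ne _ _ y z)].
  by apply: all3; apply/mem_occupancy; [exists x | exists y | exists z].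
by rewrite mem_enum inE.
Qed.

Lemma active_suspicious (c0 : C) (x0 : T) i s : val c0.1.1 = tree_root d ->
  X x0 -> (t%:R%:E < tau x0)%E -> cellset ((tree_root d, i, s) : cell d K) x0 ->
  suspicious c0 (occupancy X).
Proof.
move=> c00 Xx0 tx0 cx0; apply: contraT => /norP[ns /norP[nc nt]].
have hp : 0 < h := h0; have hh := h_half; have sp := step0.
have nstep : 0 <= n%:R * max_step by rewrite mulr_ge0// ltW.
have x01 : mdist root x0 <= 1.
  have := mdist_center_vertex R K0 ((tree_root d, i, s) : cell d K).
  have := metric_triangle root (cell_center R ((tree_root d, i, s) : cell d K)) x0.
  by move: cx0; rewrite /cellset /= => ? ? ?; lra.
have near0 : near x0 by rewrite /region_radius; lra.
have [c cc] : exists c : C, to_cell c = (tree_root d, i, s) by exact: ex_fin_cell.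
have sim := Xspread.2.
have nchain (L : R) (s1 : seq T) : 0 <= L -> size s1 = n -> uniq (x0 :: s1) ->
    ~ dchain X L max_step x0 s1.
  move=> L0 sn us ch; have nr y : y \in x0 :: s1 -> near y.
    rewrite inE => /orP[/eqP->//|ys].
    have := metric_triangle root x0 y; have := dchain_near (ltW sp) ch ys.
    by rewrite sn /region_radius; lra.
  have bk : max_step <= n.+1%:R * slice_width.
    have nR : (n%:R : R) != 0 by rewrite pnatr_eq0 -lt0n.
    rewrite /slice_width mulrCA ler_peMr ?(ltW sp)// -natr1 mulrDl divff// lerDl.
    by rewrite mul1r invr_ge0.
  have cx : cellset (to_cell c) x0 by rewrite cc.
  have [s' [s'c s'y us' ss']] := dchain_ex_chain L0 bk Xx0 nr ch cx.
  move/negP: nc; apply; apply/existsP; exists c.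
  rewrite (_ : val c.1.1 = tree_root d) ?eqxx /=; last by move: cc => -[].
  apply/hasP; exists s'; first by move: s'c; rewrite sn.
  rewrite /= us' ?andbT; last by case/andP: us.
  apply/andP; split.
    apply/negP => /s'y[z zs cz]; have zx : z = x0.
      apply: (sim z x0 (to_cell c)) => //; last by apply: nr; rewrite inE zs orbT.
      exact: dchain_X ch zs.
    by move: us; rewrite /= -zx zs.
  apply/andP; split; first by apply/mem_occupancy; exists x0.
  apply/allP => c1 /s'y[z zs cz]; apply/mem_occupancy; exists z => //.
  exact: dchain_X ch zs.
have radE : region_radius = (n%:R * max_step + 1) + (2 * (m%:R * h) + 1) by rewrite mh.
have rn (L : R) x : 0 <= L -> reach X (2 * (m%:R * h) + 1) x0 L x -> mdist root x <= n%:R * max_step + 1.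
  rewrite mh -/max_step => L0 rx.
  have := reach_dist (ltW sp) (fun s1 sn us => nchain L s1 L0 sn us) rx.
  by have := metric_triangle root x0 x; lra.
have notie (x y z : T) : X x -> X y -> X z -> near x -> near y -> near z ->
    x <> y -> y <> z -> x <> z -> 4 * h < `|mdist x y - mdist y z|.
  exact: (no_tie c00 nt).
have gen := Xspread.1; rewrite radE in gen sim notie.
have th := active_thin K0 Xtau gen sim notie rn Xx0 _ cx0.
rewrite mh in th.
case/negP: ns; apply/asboolP; exists i, s.
have occ (c' : cell d K) : (size (val c'.1.1) < R0)%N ->
    occupied X c' <-> cells_of (occupancy X) c'.
  move=> c'R; split => [[x Xx cx]|[c1 /mem_occupancy[x Xx cx] <-]]; last by exists x.
  have [c1 c1E] := ex_fin_cell (ltnW c'R).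
  by exists c1 => //; apply/mem_occupancy; exists x => //; rewrite c1E.
have [H _] := @thin_near R d K t R0 d3 K0 t4 R0_large (tree_root d) i s (occupied X)
  (cells_of (occupancy X)) (leq0n _) occ.
exact/H/th.
Qed.

End points.
End soundness.

(** * Choice of the number of slices and of the mesh *)

Section suspicious_bound.
Variable R : realType.

Lemma Ex_orb (C : finType) (q : R) (F G : {set C} -> bool) : 0 <= q <= 1 ->
  Ex q (fun o => (F o || G o)%:R) <= Ex q (fun o => (F o)%:R) + Ex q (fun o => (G o)%:R).
Proof.
move=> q01; rewrite -ExD; apply: ler_Ex => // o; rewrite -natrD ler_nat.
by case: (F o); case: (G o).
Qed.

Lemma Ex_exists (C A : finType) (q : R) (P : pred A) (F : A -> {set C} -> bool) (e : R) :
  0 <= q <= 1 -> (forall a, P a -> Ex q (fun o => (F a o)%:R) <= e) ->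
  Ex q (fun o => ([exists a, P a && F a o])%:R) <= #|P|%:R * e.
Proof.
move=> q01 he; have h (o : {set C}) : ([exists a, P a && F a o])%:R <= \sum_(a | P a) (F a o)%:R :> R.
  case: existsP => [[a /andP[Pa Fa]]|_]; last by apply: sumr_ge0 => *; rewrite ler0n.
  by rewrite (bigD1 a)//= Fa lerDl sumr_ge0// => *; rewrite ler0n.
apply: le_trans (ler_Ex q01 h) _.
rewrite (_ : Ex q _ = \sum_(a | P a) Ex q (fun o => (F a o)%:R)); last first.
  by rewrite /Ex exchange_big; apply: eq_bigr => o _; rewrite mulr_sumr.
by apply: le_trans (ler_sum _ he) _; rewrite sumr_const mulr_natl.
Qed.

Lemma ex_nat_ge (x : R) : exists n : nat, x <= n%:R.
Proof. by exists (Num.truncn x).+1; apply: ltW; exact: truncnS_gt. Qed.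

Lemma mesh_small (del : R) : 0 < del ->
  exists K1, forall K, (K1 <= K)%N -> (0 < K)%N -> mesh R K <= del.
Proof.
move=> d0; have [n hn] := ex_nat_ge del^-1; exists n => K nK K0.
rewrite /mesh -[leRHS]invrK lef_pV2 ?posrE ?invr_gt0 ?ltr0n ?muln_gt0//.
by apply: le_trans hn _; rewrite ler_nat (leq_trans nK)// leq_pmull.
Qed.

Lemma natr_le_exp2 (n : nat) : n%:R <= 2 ^+ n :> R.
Proof. by rewrite -natrX ler_nat ltnW// ltn_expl. Qed.

Lemma card_root_cells (d K R0 : nat) :
  (#|[pred c : fin_cell d K R0 | val c.1.1 == tree_root d]| <= d * K)%N.
Proof.
rewrite -[d in (d * _)%N]card_ord -[K in (_ * K)%N]card_ord -card_prod cardE.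
pose f (c : fin_cell d K R0) : 'I_d * 'I_K := (c.1.2, c.2).
rewrite -(size_map f) cardE; apply: uniq_leq_size; last by move=> *; rewrite mem_enum.
rewrite map_inj_in_uniq ?fintype.enum_uniq// => -[[v i] s] [[v' i'] s'].
rewrite !mem_enum !inE /= => /eqP vr /eqP vr' [-> ->].
by congr (_, _, _); apply/val_inj; exact: etrans vr (esym vr').
Qed.

(** [n] and the threshold for [K] are independent of [R0], which can therefore be chosen after [K].
    The three alternatives in [suspicious] contribute the density bound and twice [eps / 2]. *)
Lemma suspicious_small (d t : nat) (eps : R) : (3 <= d)%N -> (4 <= t)%N -> 0 < eps ->
  exists n K1, (0 < n)%N /\ forall K R0 (c0 : fin_cell d K R0) (q : R),
    (K1 <= K)%N -> (0 < K)%N -> (2 * K * t * (2 * t) + t + 3 <= R0)%N ->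
    0 <= q <= mesh R K ->
    Ex q (fun o => (suspicious R t n c0 o)%:R) <=
      (3 + 6 * ((t - 4) * d)%:R) / d.-1%:R ^+ (2 * (t - 4)) + eps.
Proof.
move=> d3 t4 e0.
pose N1 := (4 * t + 4)%N; pose A : R := (size (vball d N1) * d)%:R * 4.
have A0 : 0 <= A by rewrite mulr_ge0.
pose st : R := max_step R t.
have st0 : 0 < st by rewrite /st /max_step ltr_wpDl// mulr_ge0.
(* [na] makes the expected number of continuations per step at most one half, slices included; [nb]
   makes $d\,2^{-n}$ at most [eps]. *)
have [na hna] := ex_nat_ge (16 * A * st); have [nb hnb] := ex_nat_ge (d%:R / eps).
pose n := (na + nb).+1; pose sl : R := slice_width R t n.
have nR : 0 < n%:R :> R by rewrite ltr0n.
have sl0 : 0 < sl by rewrite divr_gt0.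
have sln : sl * n%:R = st by rewrite /sl /slice_width divfK ?gt_eqF.
pose sp : R := tie_span R t n.
have sp0 : 0 <= sp.
  have r0 : 0 <= region_radius R t n.
    by have := mulr_ge0 (ltW nR) (ltW st0); rewrite /region_radius -/st; lra.
  by rewrite /sp /tie_span; lra.
have [N2 hN2] := ex_nat_ge (sp + 4).
pose B : R := ((size (vball d N2) * d)%:R * 4) ^+ 3 * 13 * (sp + 1) ^+ 2.
have B0 : 0 <= B by rewrite !mulr_ge0 ?exprn_ge0 ?mulr_ge0// addr_ge0.
(* The first bound absorbs the mesh errors in the slice width, and the last makes the tie
   probability, at most [B * h], smaller than [eps / 2]. *)
pose del : R := Num.min (sl / 3) (Num.min 2^-1 (eps / 2 / (B + 1))).
have del0 : 0 < del.
  by rewrite /del !lt_min !divr_gt0 ?invr_gt0//; lra.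
have [K1 hK1] := mesh_small del0; exists n, K1; split => // K R0 c0 q K1K K0 R0l /andP[q0 qh].
have := hK1 K K1K K0; rewrite /del !le_min => /and3P[h1 h2 h3].
have h0 := mesh_gt0 R K0; set h := mesh R K in qh h1 h2 h3 h0 *.
have q01 : 0 <= q <= 1 by rewrite q0 /=; lra.
rewrite /suspicious; apply: le_trans (Ex_orb _ _ q01) _.
have s1 := root_density d3 K0 t4 R0l q01.
apply: lerD s1 _; apply: le_trans (Ex_orb _ _ q01) _.
rewrite (splitr eps); apply: lerD.
  pose be : R := A * (sl / h + 3).
  have be0 : 0 <= be by rewrite mulr_ge0// addr_ge0// divr_ge0// ltW.
  have hbe j (c' : fin_cell d K R0) : (j <= n)%N ->
      #|window (j%:R * sl - h) (sl + 2 * h) c'|%:R <= be.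
    move=> jn; have jsl : j%:R * sl <= st.
      by rewrite -sln mulrC ler_wpM2l ?(ltW sl0)// ler_nat.
    have sl1 : sl <= st by rewrite -sln ler_peMr ?(ltW sl0)// (ler_nat R 1).
    have := @card_window R d K R0 K0 (j%:R * sl - h) (sl + 2 * h) c' N1.
    have -> : be = (size (vball d N1) * d)%:R * (4 * ((sl + 2 * h) / h + 1)).
      by rewrite /be /A; field; rewrite gt_eqF.
    apply; first by lra.
    rewrite /N1 natrD natrM; move: jsl sl1; rewrite /st /max_step; lra.
  have hc (c : fin_cell d K R0) : val c.1.1 == tree_root d ->
      Ex q (fun o => (ex_chain sl n n c o)%:R) <= h * 2^-1 ^+ n.
    move=> _; apply: le_trans (Ex_chain q01 n c hbe) _.
    have qbe : 4 * be * q <= 2^-1.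
      have : be * q <= be * h by rewrite ler_wpM2l.
      have -> : be * h = A * (sl + 3 * h) by rewrite /be; field; rewrite gt_eqF.
      have : A * (sl + 3 * h) <= A * (2 * sl) by rewrite ler_wpM2l//; lra.
      have : 16 * A * st <= n%:R.
        by apply: le_trans hna _; rewrite ler_nat leqW// leq_addr.
      rewrite -sln => a1 a2 a3.
      have : 16 * A * sl <= 1 by rewrite -(ler_pM2r nR); lra.
      by lra.
    (* One factor [q] is for the starting cell; summed over the [d * K] cells at the root it gives
       [d / 2]. *)
    rewrite (_ : _ * _ = q * (4 * be * q) ^+ n); last first.
      have e4 : 4 = 2 * 2 :> R by ring.
      by rewrite exprS e4 !exprMn; ring.
    have qb0 : 0 <= 4 * be * q by rewrite mulr_ge0// mulr_ge0.
    apply: ler_pM => //; first exact: exprn_ge0.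
    by rewrite lerXn2r// nnegrE.
  apply: le_trans (Ex_exists (P := fun c => val c.1.1 == tree_root d) q01 hc) _.
  have : (#|[pred c : fin_cell d K R0 | val c.1.1 == tree_root d]|%:R : R) <= (d * K)%:R.
    by rewrite ler_nat card_root_cells.
  have t0 : 0 <= h * 2^-1 ^+ n by rewrite mulr_ge0 ?exprn_ge0 ?(ltW h0).
  move=> /(ler_wpM2r t0) le; apply: le_trans le _.
  rewrite natrM -mulrA (mulrA K%:R) mesh_half//.
  have d0 : d%:R / eps <= 2 ^+ n.
    apply: le_trans (natr_le_exp2 n); apply: le_trans hnb _.
    by rewrite ler_nat leqW// leq_addl.
  rewrite exprVn mulrCA mulrC ler_wpM2r ?invr_ge0//.
  by rewrite ler_pdivrMr ?exprn_gt0// mulrC -ler_pdivrMr.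
have Nh : sp + 6 * h + 1 <= N2%:R by lra.
apply: le_trans (Ex_tie K0 q01 c0 sp0 Nh) _; rewrite -/h.
have q3 : q ^+ 3 <= h ^+ 3 by rewrite lerXn2r ?nnegrE// ltW.
set a := ((size (vball d N2) * d)%:R * 4) ^+ 3.
have a0 : 0 <= a by rewrite exprn_ge0 ?mulr_ge0.
have c0' : 0 <= a * (sp / h + 1) ^+ 2 * 13.
  by rewrite !mulr_ge0 ?exprn_ge0// addr_ge0// divr_ge0// ltW.
apply: le_trans (ler_wpM2l c0' q3) _.
have -> : a * (sp / h + 1) ^+ 2 * 13 * h ^+ 3 = a * 13 * (sp + h) ^+ 2 * h.
  by field; rewrite gt_eqF.
have : a * 13 * (sp + h) ^+ 2 * h <= B * h.
  rewrite ler_wpM2r ?(ltW h0)// /B -/a ler_wpM2l ?mulr_ge0// lerXn2r ?nnegrE; lra.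
have : B * h <= (B + 1) * (eps / 2 / (B + 1)) by apply: ler_pM; lra.
have -> : (B + 1) * (eps / 2 / (B + 1)) = eps / 2 by field; lra.
by lra.
Qed.

End suspicious_bound.

(** * Poisson occupancy of the cells *)

Section outer_probability.
Variables (R : realType) (dW : measure_display) (W : measurableType dW).
Variable P : probability W R.
Implicit Types (S : set W) (a b : R).

(* The popping times are not assumed measurable, whence outer probabilities. *)
Definition outer_le S a : Prop :=
  exists M, [/\ measurable M, S `<=` M & (P M <= a%:E)%E].

Lemma outer_le_sub S S' a : S `<=` S' -> outer_le S' a -> outer_le S a.
Proof. by move=> SS' [M [mM SM Ma]]; exists M; split => //; exact: subset_trans SM. Qed.

Lemma outer_le_trans S a b : a <= b -> outer_le S a -> outer_le S b.
Proof.
by move=> ab [M [mM SM Ma]]; exists M; split => //; apply: le_trans Ma _; rewrite lee_fin.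
Qed.

Lemma outer_leU S S' a b : outer_le S a -> outer_le S' b -> outer_le (S `|` S') (a + b).
Proof.
move=> [M [mM SM Ma]] [M' [mM' SM' Mb]]; exists (M `|` M'); split.
- exact: measurableU.
- exact: setUSS.
- by apply: le_trans (measureU2 _ _ _) _ => //; rewrite EFinD leeD.
Qed.

Lemma outer_le_sum (A : eqType) (s : seq A) (F : A -> set W) (a : A -> R) :
  (forall x, x \in s -> outer_le (F x) (a x)) ->
  outer_le [set w | exists2 x, x \in s & F x w] (\sum_(x <- s) a x).
Proof.
elim: s => [_|x s IH h].
  rewrite big_nil; exists set0; split; [exact: measurable0| |by rewrite measure0].
  by move=> w [x]; rewrite in_nil.
rewrite big_cons; apply: outer_le_sub (outer_leU (h x (mem_head _ _)) (IH _)).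
  move=> w [y]; rewrite inE => /orP[/eqP->|ys Fy]; [by left|by right; exists y].
by move=> y ys; apply: h; rewrite inE ys orbT.
Qed.

Lemma outer_le_seq (A : eqType) (s : seq A) (F : A -> set W) a :
  (forall x, x \in s -> outer_le (F x) a) ->
  outer_le [set w | exists2 x, x \in s & F x w] ((size s)%:R * a).
Proof.
by move=> h; have := outer_le_sum h; rewrite big_const_seq count_predT iter_addr_0 mulr_natl.
Qed.

Lemma outer_le_negligible S : P.-negligible S -> outer_le S 0.
Proof. by move=> [M [mM M0 SM]]; exists M; split => //; rewrite M0. Qed.

Lemma negligible_outer_le S : (forall e, 0 < e -> outer_le S e) -> P.-negligible S.
Proof.
move=> h; have /boolp.choice[M MP] (n : nat) : exists M, [/\ measurable M, S `<=` M &
    (P M <= (n.+1%:R^-1)%:E)%E] by apply: h; rewrite invr_gt0.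
have mM : measurable (\bigcap_n M n) by apply: bigcapT_measurable => n; have [] := MP n.
exists (\bigcap_n M n); split => //; last by move=> w Sw n _; have [_ + _] := MP n; apply.
have le n : (P (\bigcap_n M n) <= (n.+1%:R^-1)%:E)%E.
  have [mMn _ Mn] := MP n; apply: le_trans Mn; apply: le_measure; rewrite ?inE//.
  exact: bigcap_inf.
have fin : P (\bigcap_n M n) \is a fin_num by exact: fin_num_measure.
apply/eqP; rewrite eq_le measure_ge0 andbT -(fineK fin) lee_fin leNgt; apply/negP => p0.
have [n hn] := ex_nat_ge (fine (P (\bigcap_n M n)))^-1.
have := le n; rewrite -(fineK fin) lee_fin leNgt => /negP; apply.
rewrite -[ltRHS]invrK ltf_pV2 ?posrE ?invr_gt0 ?ltr0n//.
by apply: le_lt_trans hn _; rewrite ltr_nat.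
Qed.

End outer_probability.

Section poisson_cells.
Variables (R : realType) (d : nat) (dW : measure_display) (W : measurableType dW).
Variables (P : probability W R) (Pi : W -> set (regular_tree R d)).
Hypothesis hPP : poisson_point_process P (@length_measure R d) Pi.
Variable K : nat.
Hypothesis K0 : (0 < K)%N.
Local Notation T := (regular_tree R d).
Local Notation h := (mesh R K).

Let h0 : 0 < h := mesh_gt0 R K0.

Definition cell_prob : R := 1 - expR (- h).

Lemma cell_prob_itv : 0 <= cell_prob <= h.
Proof.
rewrite /cell_prob subr_ge0 -(expR0 R) ler_expR oppr_le0 ltW//= expR0.
by have := expR_ge1Dx (- h); lra.
Qed.

Let cell_event (c : cell d K) (k : nat) : set W := count_event Pi (cellset c) k.

Let measurable_cell c k : measurable (cell_event c k).
Proof.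
have [+ _] := hPP => /(_ (cellset c) (borel_cellset _)).
by rewrite length_measure_cellset// ltry => /(_ isT k)[].
Qed.

Let prob_cell c k : P (cell_event c k) = (h ^+ k / k`!%:R * expR (- h))%:E.
Proof.
have [+ _] := hPP => /(_ (cellset c) (borel_cellset _)).
rewrite length_measure_cellset// ltry => /(_ isT k)[_ ->] /=.
by rewrite /poisson_prob h0 esum_set1 ?lee_fin ?poisson_pmf_ge0// /poisson_pmf h0.
Qed.

Let empty_event (c : cell d K) : set W := [set w | Pi w `&` cellset c = set0].

Let empty_eventE c : empty_event c = cell_event c 0.
Proof.
apply/seteqP; rewrite /cell_event /count_event /empty_event II0; split => w /=.
  by move=> ->; exact: card_eq00.
by rewrite card_eq0 => /eqP.
Qed.

Lemma double_outer_le (c : cell d K) : outer_le P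
  [set w | exists x y, [/\ Pi w x, Pi w y, x <> y & cellset c x /\ cellset c y]] (h ^+ 2).
Proof.
have mU : measurable (cell_event c 0 `|` cell_event c 1) by exact: measurableU.
exists (~` (cell_event c 0 `|` cell_event c 1)); split.
- exact: measurableC.
- move=> w [x [y [Px Py xy [cx cy]]]] [].
    by rewrite -empty_eventE => e; have : (Pi w `&` cellset c) x by []; rewrite e.
  move=> /card_set_bijP[f [ff fi _]]; apply: xy; apply: fi; rewrite ?inE//.
  have := ff x (conj Px cx); have := ff y (conj Py cy).
  by rewrite II1 /= => -> ->.
- have PU : P (cell_event c 0 `|` cell_event c 1) = (P (cell_event c 0) + P (cell_event c 1))%E.
    apply: measureU => //; apply/seteqP; split => // w [/= e0 e1].
    have : (`I_0 #= `I_1)%card.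
      by apply: card_eq_trans e1; rewrite card_eq_sym.
    by move=> /card_eq_II.
  rewrite probability_setC// PU !prob_cell lee_fin expr0 expr1 fact0 !divr1 mul1r.
  have e := expR_ge1Dx (- h); have hp := h0.
  (* The probability of at least two points is $1-(1+h)e^{-h}$, at most $1-(1+h)(1-h) = h^2$. *)
  have : (1 - h) * (1 + h) <= expR (- h) * (1 + h) by rewrite ler_wpM2r//; lra.
  by rewrite expr2; lra.
Qed.

Lemma negligible_poisson_point (x : T) : P.-negligible [set w | Pi w x].
Proof.
have [+ _] := hPP => /(_ [set x] (borel_set1 _)).
rewrite length_measure_set1 ltry => /(_ isT 0%N)[mE PE].
exists (~` count_event Pi [set x] 0); split.
- exact: measurableC.
- rewrite probability_setC// PE /poisson_prob /= ltxx.
  by rewrite diracE mem_set// subee.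
- move=> w Px; rewrite /count_event /= II0 card_eq0 => /eqP e.
  by have : (Pi w `&` [set x]) x by []; rewrite e.
Qed.

Section law.
Variables (I : finType) (F : I -> cell d K).
Hypothesis F_inj : injective F.
Implicit Types (A B : {set I}).

Let mixed A B : set W :=
  [set w | (forall c, c \in A -> empty_event (F c) w) /\
           (forall c, c \in B -> ~ empty_event (F c) w)].

Let measurable_mixed A B : measurable (mixed A B).
Proof.
rewrite (_ : mixed A B = \bigcap_(c in [set` A]) empty_event (F c) `&`
    \bigcap_(c in [set` B]) ~` empty_event (F c)); last first.
  by apply/seteqP; split => w [h1 h2]; split => c; [exact: h1|exact: h2|exact: h1|exact: h2].
apply: measurableI; apply: fin_bigcap_measurable => // c _.
  by rewrite empty_eventE.
by apply: measurableC; rewrite empty_eventE.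
Qed.

(** Independence is available for counts, hence for empty cells, while an occupied cell is a
    complement. The induction on [B] writes occupied at [j] as unconstrained at [j] minus empty at
    [j]. *)
Let prob_mixed A B : (forall c, c \in A -> c \notin B) ->
  P (mixed A B) = ((1 - cell_prob) ^+ #|A| * cell_prob ^+ #|B|)%:E.
Proof.
have [n] := ubnP #|B|; elim: n A B => // n IH A B Bn AB.
have [B0|/set0Pn[j jB]] := eqVneq B finset.set0.
  rewrite B0 cards0 expr0 mulr1.
  have [_ indep] := hPP.
  pose cs (i : 'I_#|A|) := cellset (F (enum_val i)) : set T.
  have cs_borel i : borel (cs i) /\ (length_measure (cs i) < +oo)%E.
    by split; [exact: borel_cellset | rewrite length_measure_cellset// ltry].
  have tr : trivIset setT cs.
    move=> i j _ _ [x [ci cj]]; apply: enum_val_inj; apply: F_inj.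
    exact: cellset_disjoint ci cj.
  rewrite (_ : mixed _ _ = \bigcap_(i in [set: 'I_#|A|]) count_event Pi (cs i) 0).
    rewrite (indep _ _ cs_borel tr (fun=> 0%N)).
    rewrite (eq_bigr (fun=> (1 - cell_prob)%:E)); last first.
      move=> i _; rewrite -/(cell_event _ _) prob_cell expr0 fact0 divr1 mul1r.
      by rewrite /cell_prob opprB addrC subrK.
    by rewrite prodEFin prodr_const card_ord.
  apply/seteqP; split => w.
    move=> [h1 _] i _; rewrite -/(cell_event _ _) -empty_eventE; apply: h1.
    exact: enum_valP.
  move=> hw; split => [c cA|c]; last by rewrite inE.
  have := hw (enum_rank_in cA c) Logic.I; rewrite -/(cell_event _ _) -empty_eventE enum_rankK_in//.
have jA : j \notin A by apply: contraL jB => /AB.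
have BE : B = j |: B :\ j by rewrite finset.setD1K.
have cB : #|B| = #|B :\ j|.+1 by rewrite [in LHS]BE cardsU1 setD11.
have Bn' : (#|B :\ j| < n)%N by rewrite -ltnS -cB.
have dis1 c : c \in A -> c \notin B :\ j by move=> /AB cB'; rewrite !inE negb_and cB' orbT.
have dis2 c : c \in j |: A -> c \notin B :\ j.
  by rewrite !inE => /orP[->//|/dis1]; rewrite !inE.
rewrite (_ : mixed A B = mixed A (B :\ j) `\` mixed (j |: A) (B :\ j)); last first.
  apply/seteqP; split => w.
    move=> [h1 h2]; split.
      by split => // c; rewrite !inE => /andP[_ /h2].
    by move=> [h3 _]; apply: (h2 j jB); apply: h3; rewrite !inE eqxx.
  move=> [[h1 h2] h3]; split => // c cB'; case: (eqVneq c j) => [->|cj].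
    move=> ej; apply: h3; split => // c'; rewrite !inE => /orP[/eqP->//|]; exact: h1.
  by apply: h2; rewrite !inE cj.
have PD : P (mixed A (B :\ j) `\` mixed (j |: A) (B :\ j)) =
    (P (mixed A (B :\ j)) - P (mixed A (B :\ j) `&` mixed (j |: A) (B :\ j)))%E.
  by apply: measureD => //; rewrite ltey_eq fin_num_measure.
rewrite PD.
rewrite (_ : _ `&` _ = mixed (j |: A) (B :\ j)); last first.
  apply/seteqP; split => w; [by case|move=> hw; split => //].
  by case: hw => h1 h2; split => // c cA; apply: h1; rewrite !inE cA orbT.
rewrite !IH// -EFinB cardsU1 jA cB !exprS; congr (_%:E); ring.
Qed.

Definition poisson_occupancy w : {set I} :=
  [set c : I | `[< exists2 x, Pi w x & cellset (F c) x >]]%SET.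

Lemma poisson_occupancy_outer_le (E : {set I} -> bool) :
  outer_le P [set w | E (poisson_occupancy w)] (Ex cell_prob (fun o => (E o)%:R)).
Proof.
rewrite /Ex; apply: outer_le_sub (outer_le_sum (F := fun o => [set w | E o /\ poisson_occupancy w = o]) _).
  by move=> w /= Ew; exists (poisson_occupancy w); rewrite ?mem_index_enum.
move=> o _; case: (boolP (E o)) => Eo; last first.
  by rewrite mulr0; exists set0; rewrite measure0; split => // w [] //.
rewrite mulr1; exists (mixed (~: o) o); split => //.
  move=> w /= [_ <-]; split => c; rewrite !inE.
    move=> /asboolPn nx; apply/seteqP; split => // x [Px cx]; apply: nx.
    by exists x.
  by move=> [x Px cx] e; suff [] : set0 x by []; rewrite -e.
rewrite prob_mixed; last by move=> c; rewrite inE.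
by rewrite /wt mulrC.
Qed.

End law.

Section pullback.
Variables (F G : T -> T) (f g : vertex d -> vertex d).
Hypothesis tr : translation F G f g.
Local Notation X w := [set x | Pi w (F x)].

(** A translation only relabels the cells, injectively, and the Bernoulli law is the same for every
    injective labelling; this replaces the invariance of the Poisson process. *)
Lemma occupancy_outer_le (R0 : nat) (E : {set fin_cell d K R0} -> bool) :
  outer_le P [set w | E (occupancy K R0 (X w))] (Ex cell_prob (fun o => (E o)%:R)).
Proof.
have inj : injective (fun c : fin_cell d K R0 => map_cell f (to_cell c)).
  move=> [[v i] s] [[v' i'] s'] [/(can_inj (trans_vK tr))/val_inj -> -> ->] //.
apply: outer_le_sub (poisson_occupancy_outer_le inj E) => w /=.
suff -> : occupancy K R0 (X w) = poisson_occupancy (fun c => map_cell f (to_cell c)) w by [].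
apply/setP => c; rewrite !inE; apply/asboolP/asboolP => -[x Xx cx].
  by exists (F x) => //; rewrite (trans_cellset K0 tr).
have e := transVK tr x; exists (G x); first by rewrite /= e.
by rewrite -(trans_cellset K0 tr) e.
Qed.

(** Points at division points have probability zero. Each cell holds two points with probability at
    most $h^2$, and the number of cells is proportional to $K = 1/(2h)$. *)
Lemma spread_outer_le (t n N : nat) : (0 < d)%N -> region_radius R t n + 1 <= N%:R ->
  outer_le P [set w | ~ spread K t n (X w)] ((size (vball d N) * d)%:R * h / 2).
Proof.
move=> d0 rN.
pose grid := [set w | exists2 p : 'I_K.+1 * 'I_d * seq_sub (vball d N),
  p \in enum [set: 'I_K.+1 * 'I_d * seq_sub (vball d N)]%SET & X w (pt (val p.2) p.1.2 (p.1.1%:R * h))].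
pose double := [set w | exists2 c : fin_cell d K N, c \in enum [set: fin_cell d K N]%SET &
  exists x y, [/\ Pi w x, Pi w y, x <> y & cellset (map_cell f (to_cell c)) x /\ cellset (map_cell f (to_cell c)) y]].
have og : outer_le P grid 0.
  rewrite -(mulr0 (size (enum [set: 'I_K.+1 * 'I_d * seq_sub (vball d N)]%SET))%:R).
  by apply: outer_le_seq => p _; apply: outer_le_negligible; exact: negligible_poisson_point.
have od : outer_le P double ((size (vball d N) * d)%:R * h / 2).
  have := @outer_le_seq _ _ _ P _ (enum [set: fin_cell d K N]%SET) _ (h ^+ 2)
    (fun c _ => double_outer_le (map_cell f (to_cell c))).
  rewrite -cardE cardsT !card_prod !card_ord card_seq_sub ?uniq_vball//.
  rewrite natrM expr2 -mulrA (mulrA K%:R) mesh_half//.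
  by rewrite (mulrC 2^-1) mulrA.
apply: outer_le_sub (outer_le_trans _ (outer_leU og od)); last by rewrite add0r.
move=> w nsp; apply: contrapT => /not_orP[ng nd]; apply: nsp.
have near v i (a : R) : 0 <= a <= 2^-1 -> mdist (inl (tree_root d) : T) (pt v i a) <= region_radius R t n ->
    v \in vball d N.
  move=> a01 le; rewrite mem_vball -(ler_nat R) -mdist_rootE.
  have := metric_triangle (inl (tree_root d) : T) (pt v i a) (inl v : T).
  have a1 : 0 <= a <= 1 by move: a01 => /andP[? ?]; apply/andP; split; lra.
  have p0 := mdist_pt0 v i a1; rewrite metric_sym in p0; move: a01 => /andP[? ?]; lra.
split.
  move=> x Xx nx; have [v [i [a a01 xE]]] := ptE x d0.
  rewrite xE in nx Xx *.
  have vN := near v i a a01 nx.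
  have [|c _ cx] := @cell_cover R d K K0 v i a a01; last by exists c.
  move=> k kK ak; apply: ng; exists (inord k, i, SeqSub vN); first by rewrite mem_enum inE.
  by rewrite /= inordK ?ltnS// -ak.
move=> x y c Xx Xy nx ny cx cy; apply: contrapT => xy; apply: nd.
have [|c' c'E] := @ex_fin_cell d K N c.
  rewrite -(ler_nat R); apply: le_trans (mdist_center_depth R K0 c) _.
  have := metric_triangle (inl (tree_root d) : T) x (cell_center R c).
  have hp := h0; have hh : h <= 2^-1 by rewrite /mesh lef_pV2 ?posrE ?ltr0n ?ler_nat; lia.
  have cx' := cx; rewrite /cellset /= metric_sym in cx'; lra.
exists c'; first by rewrite mem_enum inE.
exists (F x), (F y); split => //; first by move=> /(can_inj (transK tr)).
by rewrite c'E !(trans_cellset K0 tr).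
Qed.

End pullback.
End poisson_cells.

(** * Density of active centers of the Poisson process *)

Section star_density.
Variables (R : realType) (d : nat).
Hypothesis d3 : (3 <= d)%N.
Local Notation T := (regular_tree R d).

Lemma popping_times_pullback (F G : T -> T) (f g : vertex d -> vertex d) (X : set T)
    (tau : T -> \bar R) : translation F G f g -> popping_times X tau ->
  popping_times [set x | X (F x)] (tau \o F).
Proof.
move=> tr [h1 h2 h3]; split => /=.
- by move=> x; exact: h1.
- move=> t x y t0 [Xx tx] [Xy ty] xy; rewrite -(trans_dist tr); apply: h2 => //.
  by move=> /(can_inj (transK tr)).
- move=> x Xx tx; have [y [Xy yx ty dy]] := h3 (F x) Xx tx.
  exists (G y); rewrite (transVK tr); split => //.
    by move=> e; apply: yx; rewrite -e (transVK tr).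
  by rewrite -(trans_dist tr) (transVK tr).
Qed.

Definition star_bound (t : nat) : R := (3 + 6 * ((t - 4) * d)%:R) / d.-1%:R ^+ (2 * (t - 4)).

Lemma ex_root_cell (K R0 : nat) : (0 < K)%N ->
  exists c : fin_cell d K R0, val c.1.1 = tree_root d.
Proof.
move=> K0; have d0 : (0 < d)%N by lia.
have [c cE] := @ex_fin_cell d K R0 (tree_root d, Ordinal d0, Ordinal K0) isT.
by exists c; case: cE.
Qed.

Variables (dW : measure_display) (W : measurableType dW) (P : probability W R).
Variables (Pi : W -> set T) (tau : W -> T -> \bar R).
Hypothesis hPP : poisson_point_process P (@length_measure R d) Pi.

(** After moving [v] to the root, an active center in its star forces a suspicious occupancy, unless
    the mesh fails to separate points. The order of choice is [n], then the radius [N] of the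
    region, then [K], which must beat the volume of that region, and finally [R0]. *)
Lemma star_outer_le (t : nat) (eps : R) (v : vertex d) : (4 <= t)%N -> 0 < eps ->
  outer_le P [set w | popping_times (Pi w) (tau w) /\ exists i, exists2 a : R,
    0 <= a <= 2^-1 & active (Pi w) (tau w) t%:R (pt v i a)] (star_bound t + eps).
Proof.
move=> t4 e0; have d0 : (0 < d)%N by lia.
have [F [G [f [g [tr fr]]]]] := ex_translation R v.
have e2 : 0 < eps / 2 by rewrite divr_gt0.
have [n [K1 [n0 small]]] := suspicious_small d3 t4 e2.
have [N hN] := ex_nat_ge (region_radius R t n + 2).
pose V : R := (size (vball d N) * d)%:R.
have V0 : 0 <= V by rewrite ler0n.
have V1 : 0 < V + 1 by rewrite ltr_wpDl.
have [K2 hK2] := @mesh_small R (eps / (V + 1)) (divr_gt0 e0 V1).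
pose K := (K1 + K2).+1; have K0 : (0 < K)%N by [].
pose R0 := (2 * K * t * (2 * t) + t + 3 + N)%N.
have R0l : (2 * K * t * (2 * t) + t + 3 <= R0)%N by rewrite leq_addr.
have NR0 : (N <= R0)%N by rewrite leq_addl.
have R0r : region_radius R t n + 2 <= R0%:R by apply: le_trans hN _; rewrite ler_nat.
have [c0 c00] := @ex_root_cell K R0 K0.
have hq := cell_prob_itv R K0.
have K1K : (K1 <= K)%N by rewrite leqW// leq_addr.
have K2K : (K2 <= K)%N by rewrite leqW// leq_addl.
have sus := small K R0 c0 _ K1K K0 R0l hq.
have hh := hK2 K K2K K0.
have o1 := occupancy_outer_le hPP K0 tr (suspicious R t n c0).
have N1 : region_radius R t n + 1 <= N%:R by have := hN; lra.
have o2 : outer_le P [set w | ~ spread K t n [set x | Pi w (F x)]] (eps / 2).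
  apply: outer_le_trans (spread_outer_le hPP K0 tr d0 N1).
  rewrite -/V ler_pM2r ?invr_gt0//; have h0 := mesh_gt0 R K0.
  have : mesh R K * (V + 1) <= eps by rewrite -ler_pdivlMr.
  by lra.
pose grid := [set w | exists2 p : 'I_K.+1 * 'I_d, p \in enum [set: 'I_K.+1 * 'I_d]%SET &
  Pi w (pt v p.2 (p.1%:R * mesh R K))].
have o3 : outer_le P grid 0.
  rewrite -(mulr0 (size (enum [set: 'I_K.+1 * 'I_d]%SET))%:R).
  apply: outer_le_seq => p _; apply: outer_le_negligible.
  exact: negligible_poisson_point hPP _.
apply: outer_le_sub (outer_le_trans _ (outer_leU (outer_leU o1 o2) o3)); last first.
  by have := sus; rewrite /star_bound; lra.
move=> w [pop [i [a a01 [Px tx]]]].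
have [|ng] := pselect (grid w); [by right|left].
have [sp|] := pselect (spread K t n [set x | Pi w (F x)]); [left|by right].
have a1 : 0 <= a <= 1 by move: a01 => /andP[? ?]; apply/andP; split; lra.
have FE : F (pt (tree_root d) i a) = pt v i a by rewrite (trans_pt tr)// fr.
have [|[[v' i'] s'] /= v'E cx] := @cell_cover R d K K0 (tree_root d) i a a01.
  move=> k kK ak; apply: ng; exists (inord k, i); first by rewrite mem_enum inE.
  by rewrite /= inordK ?ltnS// -ak.
rewrite v'E in cx.
apply: (active_suspicious d3 K0 t4 n0 R0l R0r (popping_times_pullback tr pop) sp c00 _ _ cx).
  by rewrite /= FE.
by rewrite /= FE.
Qed.

End star_density.

(** * Surgery *)

Section surgery_weight.
Variables (R : realType) (C : finType) (q : R).
Hypothesis q01 : 0 <= q < 1.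
Local Notation odds := (q / (1 - q)).

Let p0 : 0 < 1 - q. Proof. by rewrite subr_gt0; case/andP: q01. Qed.
Let odds0 : 0 <= odds. Proof. by apply: divr_ge0; [case/andP: q01 | exact: ltW]. Qed.

Lemma wt_odds (w : {set C}) : wt q w = odds ^+ #|w| * (1 - q) ^+ #|C|.
Proof.
have e : (1 - q) ^+ #|C| = (1 - q) ^+ #|w| * (1 - q) ^+ #|~: w| by rewrite -exprD cardsC.
rewrite e /wt mulrA -exprMn divfK// gt_eqF//.
Qed.

Lemma sum_inj_le (A B : finType) (Q : pred A) (f : A -> B) (g : B -> R) :
  {in Q &, injective f} -> (forall b, 0 <= g b) -> \sum_(a | Q a) g (f a) <= \sum_b g b.
Proof.
move=> finj g0; rewrite -(big_imset g finj) big_mkcond /=.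
by apply: ler_sum => b _; case: ifP.
Qed.

(** The binomial expansion of $(1+\mathrm{odds})^{|F|}$: the price of not knowing which part of [F]
    was erased. *)
Lemma sum_odds_subset (F : {set C}) :
  \sum_(a : {set C} | a \subset F) odds ^+ #|a| <= (1 - q)^-1 ^+ #|F|.
Proof.
have e : (1 - q)^-1 = odds + 1 by have := p0 => p1; field; rewrite gt_eqF.
have -> : (1 - q)^-1 ^+ #|F| = \prod_(c : C) ((if c \in F then odds else 0) + 1).
  rewrite (bigID (fun c => c \in F)) /= [X in _ * X]big1 ?mulr1; last first.
    by move=> c /negbTE ->; rewrite add0r.
  by rewrite (eq_bigr (fun=> (1 - q)^-1)) ?prodr_const// => c ->.
rewrite bigA_distr big_mkcond /=; apply: ler_sum => a _; case: ifP => [aF|_].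
  rewrite (bigID (fun c => c \in a)) /= [X in _ <= _ * X]big1 ?mulr1; last first.
    by move=> c /negbTE ->.
  rewrite (eq_bigr (fun=> odds)) ?prodr_const// => c ca.
  by rewrite ca (fintype.subsetP aF).
by apply: prodr_ge0 => c _; case: ifP => // _; case: ifP.
Qed.

Variables (I : finType) (c : I -> C).
Hypothesis c_inj : injective c.
Variables (F : {set C}) (D E : {set C} -> bool).
Hypothesis DE : forall w, D w -> exists a : {set C}, [/\ a \subset F, a \subset w &
  forall i, E (c i |: (w :\: a)) && (c i \notin w :\: a)].

(* Given [a], the map (i, w) |-> c i |: (w :\: a) is injective on the relevant
   pairs, and multiplies weights by odds ^ (1 - #|a|). *)
Lemma surgery_Ex : #|I|%:R * odds * Ex q (fun w => (D w)%:R) <=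
  (1 - q)^-1 ^+ #|F| * Ex q (fun w => (E w)%:R).
Proof.
have q01' : 0 <= q <= 1 by case/andP: q01 => -> /ltW.
pose Q (a : {set C}) (p : I * {set C}) :=
  [&& a \subset p.2, [forall j, c j \notin p.2 :\: a] & E (c p.1 |: (p.2 :\: a))].
have EE0 : 0 <= Ex q (fun w => (E w)%:R) by apply: Ex_ge0 => // w; rewrite ler0n.
apply: le_trans (ler_wpM2r EE0 (sum_odds_subset F)).
rewrite mulr_suml.
apply: (@le_trans _ _ (\sum_(a : {set C} | a \subset F) \sum_(p | Q a p) odds * wt q p.2)).
  rewrite (exchange_big_dep xpredT)//=.
  have -> : #|I|%:R * odds * Ex q (fun w => (D w)%:R) =
      \sum_(p : I * {set C}) odds * wt q p.2 * (D p.2)%:R.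
    rewrite /Ex -(pair_bigA _ (fun i w => odds * wt q w * (D w)%:R)) /=.
    rewrite sumr_const -[RHS]mulr_natl -mulrA; congr (_ * _).
    by rewrite mulr_sumr; apply: eq_bigr => w _; rewrite mulrA.
  apply: ler_sum => -[i w] _ /=.
  have t0 : 0 <= odds * wt q w by rewrite mulr_ge0// wt_ge0.
  case: (boolP (D w)) => [/DE[a [aF aw h]]|_]; last first.
    by rewrite mulr0; apply: sumr_ge0.
  rewrite mulr1 (bigD1 a)/=; first by rewrite lerDl sumr_ge0.
  rewrite aF /Q aw /=; apply/andP; split; last by case/andP: (h i).
  by apply/forallP => j; case/andP: (h j).
apply: ler_sum => a aF.
rewrite (eq_bigr (fun p => odds ^+ #|a| * (wt q (c p.1 |: (p.2 :\: a)) * (E (c p.1 |: (p.2 :\: a)))%:R))).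
  rewrite -mulr_sumr ler_wpM2l ?exprn_ge0//.
  apply: (@sum_inj_le _ _ (Q a) (fun p => c p.1 |: (p.2 :\: a)) (fun w => wt q w * (E w)%:R)).
    move=> [i w] [i' w'] /and3P[/= aw /forallP ni _] /and3P[/= aw' /forallP ni' _] e.
    have ii : i = i'.
      have : c i \in c i' |: (w' :\: a) by rewrite -e setU11.
      by rewrite finset.in_setU1 (negbTE (ni' i)) orbF => /eqP/c_inj.
    congr (_, _) => //; rewrite -ii in e.
    have ww : w :\: a = w' :\: a.
      by rewrite -(finset.setU1K (ni i)) e finset.setU1K.
    by rewrite -(finset.setID w a) -(finset.setID w' a) ww !(finset.setIidPr _).
  by move=> w; rewrite mulr_ge0 ?wt_ge0.
move=> [i w] /and3P[/= aw /forallP ni ->]; rewrite mulr1 !wt_odds !mulrA.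
congr (_ * _); rewrite -exprS -exprD; congr (_ ^+ _).
by rewrite cardsU1 ni /= cardsD (finset.setIidPr aw) addnCA addnBA ?subset_leq_card// addKn.
Qed.

End surgery_weight.

Section surgery.
Variables (R : realType) (d K t R0 n s0 : nat) (c : R).
Hypothesis d3 : (3 <= d)%N.
Hypothesis K0 : (0 < K)%N.
Hypothesis t4 : (4 <= t)%N.
Hypothesis n0 : (0 < n)%N.
Hypothesis R0_large : (2 * K * t * (2 * t) + t + 3 <= R0)%N.
Hypothesis R0_radius : region_radius R t n + 2 <= R0%:R.
Hypothesis s0t : (2 * s0 <= t)%N.
Hypothesis cs0 : 2 <= c * s0%:R.
Local Notation T := (regular_tree R d).
Local Notation C := (fin_cell d K R0).
Local Notation root := (inl (tree_root d) : T).
Local Notation h := (mesh R K).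
Variables (X : set T) (tau : T -> \bar R).
Hypothesis Xtau : popping_times X tau.
Hypothesis Xspread : spread K t n X.
Hypothesis Xfar : forall s x, s0%:R <= s -> active X tau s x -> (2 + c) * s <= mdist root x.
Variable c0 : C.
Hypothesis c00 : val c0.1.1 = tree_root d.
Hypothesis notie : ~~ tie (tie_span R t n) c0 (occupancy K R0 X).

Let h0 : 0 < h := mesh_gt0 R K0.

Let h_half : h <= 2^-1.
Proof. by rewrite /mesh lef_pV2 ?posrE ?ltr0n ?ler_nat; lia. Qed.

(** An inner point, its partner and a further partner at the same distance are within $6s_0+1$ of
    the root, so ties among them are excluded. *)
Let radius_ge : 6 * s0%:R + 2 <= region_radius R t n.
Proof.
have st : 2 * s0%:R <= t%:R :> R by rewrite -natrM ler_nat.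
have n1 : 1 <= n%:R :> R by rewrite (ler_nat R 1).
have t0 : 0 <= t%:R :> R by [].
have : 1 * max_step R t <= n%:R * max_step R t by rewrite ler_wpM2r// /max_step; lra.
by rewrite /region_radius /max_step; lra.
Qed.

Let s0_ge0 : 0 <= s0%:R :> R. Proof. by []. Qed.

Let inner x := X x /\ mdist root x <= 2 * s0%:R + 1.

Let removed x := inner x \/ X x /\ exists y,
  [/\ inner y, y <> x, tau y = tau x & (mdist x y)%:E = (2%:E * tau x)%E].

(** By [cs0], whatever is active at time [s0] is at distance at least $2s_0+2$, outside the inner
    region. *)
Let inner_time x : inner x -> (tau x <= s0%:R%:E)%E.
Proof.
move=> [Xx rx]; rewrite leNgt; apply/negP => tx.
have := Xfar (lexx _) (conj Xx tx).
by have := cs0; have := s0_ge0; lra.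
Qed.

Let partner_dist x y : inner y -> tau y = tau x ->
  (mdist x y)%:E = (2%:E * tau x)%E -> mdist x y <= 2 * s0%:R.
Proof.
move=> iy e dxy; rewrite -lee_fin dxy -e EFinM.
by rewrite lee_pmul2l// inner_time.
Qed.

Let removed_near x : removed x -> mdist root x <= 4 * s0%:R + 1.
Proof.
have sp := s0_ge0; move=> [[_ ?]|[Xx [y [iy _ e dxy]]]]; first by lra.
have := partner_dist iy e dxy; rewrite metric_sym => dyx.
by have := metric_triangle root y x; case: iy => _; lra.
Qed.

Let removed_in x : removed x -> X x.
Proof. by move=> [[]|[]]. Qed.

Let removed_cells : {set C} :=
  [set c1 : C | `[< exists2 x, removed x & cellset (to_cell c1) x >]]%SET.

Section new_balloon.
Variables (i : 'I_d) (s : 'I_K).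
Local Notation u0 := (cell_center R ((tree_root d, i, s) : cell d K)).

Let u0_near : mdist root u0 <= 2^-1.
Proof. exact: (mdist_center_vertex R K0 ((tree_root d, i, s) : cell d K)). Qed.

Let X' : set T := [set x | x = u0 \/ X x /\ ~ removed x].
Let tau' (x : T) : \bar R := if x == u0 then +oo%E else tau x.

Let u0_removed x : X x -> mdist root x <= 1 -> removed x.
Proof. by move=> Xx rx; left; split => //; have := s0_ge0; lra. Qed.

(** After time [s0] the hypothesis [Xfar] leaves a margin 2, more than the offset of the new center
    from the root; before [s0] the emptied region is wide enough. *)
Let far_new (r : R) (y : T) : 0 <= r -> y <> u0 -> active X' tau' r y -> 2 * r < mdist u0 y.
Proof.
move=> r0 yu [[//|[Xy ny]] ty].
rewrite /tau' (introF eqP yu) in ty.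
have u0n := u0_near; have tri := metric_triangle root u0 y.
have [sr|rs] := leP s0%:R r.
  have := Xfar sr (conj Xy ty).
  have c0' : 0 <= c.
    rewrite leNgt; apply/negP => cn.
    have : c * s0%:R <= 0 by rewrite mulr_le0_ge0// ltW.
    by have := cs0; lra.
  have : c * s0%:R <= c * r by rewrite ler_wpM2l.
  by have := cs0; lra.
have : 2 * s0%:R + 1 < mdist root y.
  by rewrite ltNge; apply/negP => ry; apply: ny; left.
by lra.
Qed.

Let popping_new : popping_times X' tau'.
Proof.
have [h1 h2 h3] := Xtau; split.
- move=> x [->|[Xx _]]; rewrite /tau' ?eqxx//.
  by case: ifP => // _; exact: h1.
- move=> r x y r0 ax ay xy; have [xu|xu] := eqVneq x u0.
    by rewrite xu; apply: far_new => //; rewrite -xu; exact: nesym.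
  have [yu|yu] := eqVneq y u0.
    by rewrite yu metric_sym; apply: far_new => //; rewrite -yu.
  move: ax ay; rewrite /active /tau' /= (negbTE xu) (negbTE yu).
  move=> [[e|[Xx _]] tx]; first by rewrite e eqxx in xu.
  move=> [[e|[Xy _]] ty]; first by rewrite e eqxx in yu.
  exact: h2.
- move=> x; rewrite {1}/tau'; case: eqVneq => [//|xu] X'x tx.
  have {X'x} [Xx nx] : X x /\ ~ removed x by case: X'x => // e; rewrite e eqxx in xu.
  have [y [Xy yx ty dxy]] := h3 x Xx tx.
  have ny : ~ removed y.
    move=> [iy|[_ [z [iz zy tz dyz]]]]; first by apply: nx; right; split => //; exists y.
    have xz : x <> z by move=> e; apply: nx; rewrite e; left.
    have dist_eq : mdist x y = mdist y z.
      by apply: EFin_inj; rewrite dxy dyz ty.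
    have zn : mdist root z <= 2 * s0%:R + 1 by case: iz.
    have dz := partner_dist iz tz dyz.
    have t1 := metric_triangle root z y; have t2 := metric_triangle root y x.
    rewrite (metric_sym z) in t1; rewrite (metric_sym y) dist_eq in t2.
    have sp := s0_ge0; have rg := radius_ge; have hp : 0 < h := h0.
    have := no_tie d3 K0 t4 n0 R0_large R0_radius Xspread c00 notie Xx Xy (iz.1).
    rewrite dist_eq subrr normr0 => nt.
    suff : 4 * h < 0 by lra.
    by apply: nt; [lra | lra | lra | exact: nesym yx | exact: nesym zy | exact: xz].
  have yu : y <> u0.
    move=> e; apply: ny; apply: u0_removed => //; rewrite e.
    by have := u0_near; lra.
  exists y; rewrite /tau' (introF eqP yu) (negbTE xu); split => //.
  by right.
Qed.

Let near_new x (c1 : cell d K) : cellset c1 u0 -> X x -> cellset c1 x -> removed x.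
Proof.
move=> cu Xx cx; apply: u0_removed => //.
have e := cellset_disjoint K0 cu (cellset_center R K0 (tree_root d, i, s)).
rewrite e /cellset /= in cx.
have := metric_triangle root u0 x; have := u0_near; have hh := h_half; lra.
Qed.

Let spread_new : spread K t n X'.
Proof.
have [g1 g2] := Xspread; split.
  move=> x [->|[Xx _]] nx; last exact: g1.
  by exists (tree_root d, i, s); exact: cellset_center.
move=> x y c1 [->|[Xx rx]] [->|[Xy ry]] nx ny cx cy //.
- by case: ry; exact: near_new cx Xy cy.
- by case: rx; exact: near_new cy Xx cx.
- exact: g2 cx cy.
Qed.

Lemma surgery_new (c1 : C) : to_cell c1 = (tree_root d, i, s) ->
  suspicious R t n c0 (c1 |: (occupancy K R0 X :\: removed_cells)) &&
  (c1 \notin occupancy K R0 X :\: removed_cells).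
Proof.
move=> c1E.
have cu : cellset (to_cell c1) u0 by rewrite c1E; exact: cellset_center.
have sp := s0_ge0; have rg := radius_ge; have hp : 0 < h := h0; have hh := h_half.
have same_cell x z (c2 : C) : X x -> removed z -> cellset (to_cell c2) x -> cellset (to_cell c2) z -> x = z.
  move=> Xx rz cx cz; have zn := removed_near rz.
  have t1 := metric_triangle root z x; have t2 := metric_triangle z (cell_center R (to_cell c2)) x.
  have cz' := cz; rewrite /cellset /= metric_sym in cz'; have cx' := cx; rewrite /cellset /= in cx'.
  have nx : mdist root x <= region_radius R t n by lra.
  have nz : mdist root z <= region_radius R t n by lra.
  exact: Xspread.2 Xx (removed_in rz) nx nz cx cz.
have c1r : c1 \notin occupancy K R0 X :\: removed_cells.
  rewrite finset.in_setD negb_and negbK; case: (boolP (c1 \in occupancy K R0 X)); last by rewrite orbT.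
  move=> /mem_occupancy[x Xx cx]; rewrite orbF inE; apply/asboolP.
  by exists x => //; exact: near_new cu Xx cx.
rewrite c1r andbT (_ : c1 |: _ = occupancy K R0 X').
  apply: (active_suspicious d3 K0 t4 n0 R0_large R0_radius popping_new spread_new c00 _ _ (cellset_center R K0 (tree_root d, i, s))).
    by left.
  by rewrite /tau' eqxx ltry.
apply/setP => c2; rewrite finset.in_setU1 finset.in_setD; apply/idP/idP.
  move=> /orP[/eqP->|/andP[c2r /mem_occupancy[x Xx cx]]]; apply/mem_occupancy.
    by exists u0 => //; left.
  exists x => //; right; split => // rx; move/negP: c2r; apply.
  by rewrite inE; apply/asboolP; exists x.
move=> /mem_occupancy[x [->|[Xx nx]] cx].
  rewrite (_ : c2 = c1) ?eqxx//; apply: to_cell_inj; exact: cellset_disjoint cx cu.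
apply/orP; right; apply/andP; split; last by apply/mem_occupancy; exists x.
rewrite inE; apply/asboolP => -[z rz cz]; apply: nx.
by rewrite (same_cell x z c2).
Qed.

End new_balloon.

Lemma surgery (i : 'I_d) (cs : 'I_K -> C) :
  (forall s, to_cell (cs s) = (tree_root d, i, s)) ->
  exists a : {set C}, [/\ a \subset [set c1 : C | (size (val (val c1.1.1)) <= 4 * s0 + 2)%N]%SET,
    a \subset occupancy K R0 X & forall s,
    suspicious R t n c0 (cs s |: (occupancy K R0 X :\: a)) &&
    (cs s \notin occupancy K R0 X :\: a)].
Proof.
move=> csE; exists removed_cells; split; last by move=> s; apply: surgery_new; exact: csE.
- apply/fintype.subsetP => c1; rewrite !inE => -[x rx cx].
  have hh := h_half; have xn := removed_near rx.
  rewrite -(ler_nat R) natrD natrM; apply: le_trans (mdist_center_depth R K0 (to_cell c1)) _.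
  have := metric_triangle root x (cell_center R (to_cell c1)).
  by rewrite /cellset /= metric_sym in cx; lra.
- apply/fintype.subsetP => c1; rewrite inE => /asboolP[x rx cx].
  by apply/mem_occupancy; exists x => //; exact: removed_in.
Qed.

End surgery.

Section far_bound.
Variables (R : realType) (d : nat).
Hypothesis d3 : (3 <= d)%N.
Local Notation T := (regular_tree R d).

Lemma card_deep_cells (K R0 M : nat) :
  (#|[set c : fin_cell d K R0 | (size (val (val c.1.1)) <= M)%N]%SET| <= size (vball d M) * d * K)%N.
Proof.
pose A := [set v : fin_vertex d R0 | (size (val (val v)) <= M)%N]%SET.
rewrite (_ : [set c : fin_cell d K R0 | _]%SET =
    finset.setX (finset.setX A [set: 'I_d]%SET) [set: 'I_K]%SET); last first.
  by apply/setP => -[[v i] s]; rewrite !inE /= !andbT.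
rewrite !cardsX !cardsT !card_ord; apply: leq_mul => //; apply: leq_mul => //.
rewrite cardE -(size_map val); apply: uniq_leq_size.
  by rewrite map_inj_uniq ?fintype.enum_uniq//; exact: val_inj.
by move=> _ /mapP[v + ->]; rewrite mem_enum inE mem_vball.
Qed.

Variables (dW : measure_display) (W : measurableType dW) (P : probability W R).
Variables (Pi : W -> set T) (tau : W -> T -> \bar R).
Hypothesis hPP : poisson_point_process P (@length_measure R d) Pi.

Lemma far_outer_le (v : vertex d) (c : R) (s0 t : nat) (eps : R) : 2 <= c * s0%:R ->
  (2 * s0 <= t)%N -> (4 <= t)%N -> 0 < eps ->
  outer_le P [set w | popping_times (Pi w) (tau w) /\ forall s x, s0%:R <= s ->
      active (Pi w) (tau w) s x -> (2 + c) * s <= mdist (inl v : T) x]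
    ((2 * expR ((size (vball d (4 * s0 + 2)) * d)%:R / 2) + 1) * (star_bound R d t + eps) + eps).
Proof.
move=> cs0 s0t t4 e0; have d0 : (0 < d)%N by lia.
have [F [G [f [g [tr fr]]]]] := ex_translation R v.
have [n [K1 [n0 small]]] := suspicious_small d3 t4 e0.
have [N hN] := ex_nat_ge (region_radius R t n + 2).
pose V : R := (size (vball d N) * d)%:R.
have V0 : 0 <= V by rewrite ler0n.
have V1 : 0 < V + 1 by rewrite ltr_wpDl.
have [K2 hK2] := @mesh_small R (eps / (V + 1)) (divr_gt0 e0 V1).
pose K := (K1 + K2).+1; have K0 : (0 < K)%N by [].
pose R0 := (2 * K * t * (2 * t) + t + 3 + N)%N.
have R0l : (2 * K * t * (2 * t) + t + 3 <= R0)%N by rewrite leq_addr.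
have NR0 : (N <= R0)%N by rewrite leq_addl.
have R0r : region_radius R t n + 2 <= R0%:R by apply: le_trans hN _; rewrite ler_nat.
have [c0 c00] := @ex_root_cell d d3 K R0 K0.
have hq := cell_prob_itv R K0.
have K1K : (K1 <= K)%N by rewrite leqW// leq_addr.
have K2K : (K2 <= K)%N by rewrite leqW// leq_addl.
have sus := small K R0 c0 _ K1K K0 R0l hq; rewrite -/(star_bound R d t) in sus.
have hh := hK2 K K2K K0.
have N1 : region_radius R t n + 1 <= N%:R by have := hN; lra.
have o2 : outer_le P [set w | ~ spread K t n [set x | Pi w (F x)]] eps.
  apply: outer_le_trans (spread_outer_le hPP K0 tr d0 N1).
  have h0 := mesh_gt0 R K0; rewrite -/V.
  have : mesh R K * (V + 1) <= eps by rewrite -ler_pdivlMr.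
  have : 0 <= V * mesh R K by rewrite mulr_ge0// ltW.
  by lra.
have /boolp.choice[cs csE] (s : 'I_K) : exists c1 : fin_cell d K R0,
    to_cell c1 = (tree_root d, Ordinal d0, s) by exact: ex_fin_cell.
have cs_inj : injective cs.
  by move=> s s' /(congr1 (@to_cell d K R0)); rewrite !csE => -[].
pose deep := [set c1 : fin_cell d K R0 | (size (val (val c1.1.1)) <= 4 * s0 + 2)%N]%SET.
pose E := suspicious R t n c0.
pose D (o : {set fin_cell d K R0}) : bool := [exists a : {set fin_cell d K R0},
  [&& a \subset deep, a \subset o &
    [forall s, E (cs s |: (o :\: a)) && (cs s \notin o :\: a)]]].
have DE : Ex (cell_prob R K) (fun o => (D o)%:R) <=
    2 * expR ((size (vball d (4 * s0 + 2)) * d)%:R / 2) * Ex (cell_prob R K) (fun o => (E o)%:R).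
  have q1 : 1 - cell_prob R K = expR (- mesh R K) by rewrite /cell_prob opprB addrC subrK.
  have q01 : 0 <= cell_prob R K < 1.
    by case/andP: hq => -> _; rewrite -subr_gt0 q1 expR_gt0.
  have h0 := mesh_gt0 R K0.
  have oddsE : cell_prob R K / (1 - cell_prob R K) = expR (mesh R K) - 1.
    by rewrite q1 -expRN opprK /cell_prob mulrBl mul1r -expRD addNr expR0.
  have := @surgery_Ex R _ _ q01 _ cs cs_inj deep D E.
  rewrite oddsE card_ord q1 -expRN opprK -expRM_natl => le.
  have {}le := le _.
  have odds_ge : 2^-1 <= K%:R * (expR (mesh R K) - 1).
    rewrite -(mesh_half R K0) ler_pM2l ?ltr0n//.
    by have := expR_ge1Dx (mesh R K); lra.
  have E0 : 0 <= Ex (cell_prob R K) (fun o => (E o)%:R).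
    by apply: Ex_ge0 => [|o]; [case/andP: q01 => -> /ltW | rewrite ler0n].
  have D0 : 0 <= Ex (cell_prob R K) (fun o => (D o)%:R).
    by apply: Ex_ge0 => [|o]; [case/andP: q01 => -> /ltW | rewrite ler0n].
  have dle : expR (#|deep|%:R * mesh R K) <= expR ((size (vball d (4 * s0 + 2)) * d)%:R / 2).
    rewrite ler_expR -(mesh_half R K0) mulrA -natrM ler_pM2r// ler_nat.
    exact: card_deep_cells.
  have h1 := ler_wpM2r D0 odds_ge.
  have h2 := ler_wpM2r E0 dle.
  have h3 := le_trans h1 (le_trans (le _) h2).
  rewrite -mulrA -ler_pdivrMl// ; apply: h3.
  move=> o /existsP[a /and3P[a1 a2 /forallP a3]]; by exists a.
have o1 := occupancy_outer_le hPP K0 tr (fun o => D o || E o).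
apply: outer_le_sub (outer_le_trans _ (outer_leU o1 o2)); last first.
  rewrite lerD2r; have q01 : 0 <= cell_prob R K <= 1.
    case/andP: hq => -> /le_trans; apply.
    by rewrite /mesh invf_le1 ?ltr0n ?ler1n.
  apply: le_trans (Ex_orb D E q01) _; rewrite mulrDl mul1r.
  apply: lerD => //; apply: le_trans DE _; rewrite ler_wpM2l// mulr_ge0// expR_ge0.
move=> w [pop far].
have [sp|] := pselect (spread K t n [set x | Pi w (F x)]); [left|by right].
rewrite /= orbC; apply/orP; case: (boolP (E _)) => [|nE]; [by left|right].
have nt : ~~ tie (tie_span R t n) c0 (occupancy K R0 [set x | Pi w (F x)]).
  by move: nE; rewrite /E /suspicious !negb_or => /and3P[].
have Xfar s x : s0%:R <= s -> active [set x | Pi w (F x)] (tau w \o F) s x ->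
    (2 + c) * s <= mdist (inl (tree_root d) : T) x.
  by move=> ss ax; rewrite -(trans_dist tr) (trans_inl _ d0 tr) fr; exact: far ss ax.
have [a [a1 a2 a3]] := surgery d3 K0 t4 n0 R0l R0r s0t cs0 (popping_times_pullback tr pop) sp Xfar c00 nt csE.
by apply/existsP; exists a; rewrite a1 a2; apply/forallP => s; exact: a3.
Qed.

End far_bound.

(** * Escape of the balloons *)

Section borel_cantelli.
Variables (R : realType) (dW : measure_display) (W : measurableType dW).
Variable P : probability W R.

Lemma outer_le_bigcup (A : nat -> set W) (a : nat -> R) (b : R) :
  (forall n, outer_le P (A n) (a n)) -> (forall N, \sum_(0 <= n < N) a n <= b) ->
  outer_le P (\bigcup_n A n) b.
Proof.
move=> /boolp.choice[M MP] ab.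
have mM n : measurable (M n) by have [] := MP n.
have mU : measurable (\bigcup_n M n) by exact: bigcupT_measurable.
exists (\bigcup_n M n); split => //.
  by apply: subset_bigcup => n _; have [] := MP n.
have := @measure_sigma_subadditive _ _ _ P (\bigcup_n M n) M mM mU (@subset_refl _ _).
move=> /le_trans; apply; apply: lime_le; first exact: is_cvg_nneseries.
apply: nearW => N; apply: le_trans (_ : (\sum_(0 <= n < N) (a n)%:E <= _)%E).
  by apply: lee_sum => n _; have [] := MP n.
by rewrite sumEFin lee_fin.
Qed.

Lemma sum_inv_sqr (n N : nat) : (1 < n)%N ->
  \sum_(0 <= k < N) ((n + k)%:R ^+ 2)^-1 <= n.-1%:R^-1 :> R.
Proof.
move=> n1; suff h : \sum_(0 <= k < N) ((n + k)%:R ^+ 2)^-1 <= n.-1%:R^-1 - ((n + N).-1)%:R^-1 :> R.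
  by apply: le_trans h _; rewrite lerBlDr lerDl invr_ge0.
elim: N => [|N IH]; first by rewrite big_geq// addn0 subrr.
rewrite big_nat_recr//=; case: n n1 IH => // n n1; rewrite addnS !addSn /=.
set m := (n + N)%N => IH; have m0 : 0 < m%:R :> R by rewrite ltr0n /m; lia.
have e : m%:R^-1 - m.+1%:R^-1 = (m%:R * m.+1%:R)^-1 :> R by rewrite -natr1; field; lra.
have : (m.+1%:R ^+ 2)^-1 <= (m%:R * m.+1%:R)^-1 :> R.
  rewrite lef_pV2 ?posrE ?mulr_gt0 ?exprn_gt0 ?ltr0n//; last by move: m0; rewrite ltr0n.
  by rewrite expr2 ler_pM2r ?ltr0n// ler_nat.
rewrite -e => h; apply: le_trans (lerD IH h) _; by rewrite addrA subrK.
Qed.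

Lemma borel_cantelli_sqr (A : nat -> set W) (M : R) : 0 <= M ->
  (\forall n \near \oo, outer_le P (A n) (M / n%:R ^+ 2)) ->
  P.-negligible [set w | forall N, exists2 n, (N <= n)%N & A n w].
Proof.
move=> M0 [N0 _ hA]; apply: negligible_outer_le => e e0.
have [k hk] := ex_nat_ge (M / e).
pose n := (N0 + k).+2.
have ne : M * n.-1%:R^-1 <= e.
  have n0 : 0 < n.-1%:R :> R by rewrite ltr0n.
  rewrite ler_pdivrMr// mulrC -ler_pdivrMr//; apply: le_trans hk _.
  by rewrite ler_nat /n; lia.
apply: outer_le_sub (@outer_le_bigcup (fun j => A (n + j)%N) (fun j => M / (n + j)%:R ^+ 2) e _ _).
- move=> w /(_ n)[m nm Am]; exists (m - n)%N => //=; by rewrite subnKC.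
- by move=> j; apply: hA => /=; rewrite /n; lia.
- move=> N; rewrite -mulr_sumr; apply: le_trans ne; rewrite ler_wpM2l//.
  exact: sum_inv_sqr.
Qed.

End borel_cantelli.

Section star_count.
Variables (R : realType) (d : nat).
Hypothesis d3 : (3 <= d)%N.
Local Notation D := (d.-1%:R : R).

Lemma three_up_log n : (1 < n)%N -> (3 * up_log 2 n <= 2 * n + 3)%N.
Proof.
move=> n1; have := up_log_gtn (isT : (1 < 2)%N) n1.
have k0 : (0 < up_log 2 n)%N by rewrite up_log_gt0.
move: (up_log 2 n) k0 => [//|k] _ /= kn.
have h : (3 * k <= 2 * 2 ^ k + 2)%N by elim: k {kn} => // k IH; rewrite expnS; lia.
by lia.
Qed.

Definition escape_radius (n : nat) : nat := (2 * n + 3 - 3 * up_log 2 n)%N.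

Lemma star_count n : (4 <= n)%N ->
  (size (vball d (escape_radius n)))%:R * (star_bound R d n + (D ^+ (2 * (n - 4)))^-1) <=
  3 * D ^+ 11 * (4 + 6 * d%:R) / n%:R ^+ 2.
Proof.
move=> n4; have D2 : 2 <= D by rewrite (ler_nat R 2); lia.
have n0 : 0 < n%:R :> R by rewrite ltr0n; lia.
have Dp k : 0 < D ^+ k by rewrite exprn_gt0//; lra.
set m := escape_radius n.
have sm : (size (vball d m))%:R <= 3 * D ^+ m.
  by rewrite -natrX -natrM ler_nat; exact: size_vball_leq.
have Dm : D ^+ m * n%:R ^+ 3 <= D ^+ 11 * D ^+ (2 * (n - 4)).
  rewrite -exprD (_ : (11 + 2 * (n - 4))%N = (m + up_log 2 n * 3)%N); last first.
    by have := three_up_log (ltac:(lia) : (1 < n)%N); rewrite /m /escape_radius; lia.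
  rewrite exprD ler_pM2l// exprM lerXn2r ?nnegrE ?(ltW n0) ?(ltW (Dp _))//.
  rewrite -natrX ler_nat; apply: leq_trans (up_logP n (isT : (1 < 2)%N)) _.
  by rewrite leq_exp2r ?up_log_gt0//; lia.
have -> : star_bound R d n + (D ^+ (2 * (n - 4)))^-1 = (4 + 6 * ((n - 4) * d)%:R) / D ^+ (2 * (n - 4)).
  by rewrite /star_bound -[X in _ + X]mul1r -mulrDl; congr (_ / _); ring.
set Y := D ^+ (2 * (n - 4)) in Dm *; have Y0 : 0 < Y by exact: Dp.
have num : 4 + 6 * ((n - 4) * d)%:R <= (4 + 6 * d%:R) * n%:R :> R.
  have : (4 + 6 * ((n - 4) * d) <= (4 + 6 * d) * n)%N by nia.
  by rewrite -(ler_nat R) natrD natrM [in X in _ <= X]natrM natrD [in X in _ <= X]natrM.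
have num0 : 0 <= (4 + 6 * ((n - 4) * d)%:R) / Y :> R by rewrite divr_ge0// ltW.
apply: le_trans (ler_wpM2r num0 sm) _.
rewrite mulrA ler_pdivrMr//.
apply: (@le_trans _ _ (3 * D ^+ m * ((4 + 6 * d%:R) * n%:R))).
  by rewrite ler_wpM2l// mulr_ge0// ltW.
have -> : 3 * D ^+ 11 * (4 + 6 * d%:R) / n%:R ^+ 2 * Y = 3 * (4 + 6 * d%:R) * (D ^+ 11 * Y) / n%:R ^+ 2.
  by field; rewrite gt_eqF.
rewrite ler_pdivlMr ?exprn_gt0//.
have -> : 3 * D ^+ m * ((4 + 6 * d%:R) * n%:R) * n%:R ^+ 2 = 3 * (4 + 6 * d%:R) * (D ^+ m * n%:R ^+ 3).
  by ring.
by rewrite ler_wpM2l// mulr_ge0// addr_ge0// mulr_ge0.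
Qed.

Lemma star_bound_small (t0 : nat) (e : R) : 0 < e ->
  exists t, [/\ (t0 <= t)%N, (4 <= t)%N & star_bound R d t <= e].
Proof.
move=> e0; have [k hk] := ex_nat_ge ((3 + 6 * d%:R) / e).
pose m := (t0 + k).+1; exists (m + 4)%N; split; [by rewrite /m; lia|by lia|].
have D2 : 2 <= D by rewrite (ler_nat R 2); lia.
have n2 := natr_le_exp2 R m; have n1 : 1 <= (2 : R) ^+ m by rewrite exprn_ege1 ?ler1n.
have m0 : 0 < m%:R :> R by rewrite ltr0n.
rewrite /star_bound addnK mulnC exprM.
have h2 : 2 ^+ m * 2 ^+ m <= D ^+ (2 * m).
  by rewrite -exprD addnn -mul2n lerXn2r ?nnegrE//; lra.
rewrite -exprM mulnC ler_pdivrMr ?exprn_gt0//; last by lra.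
apply: (@le_trans _ _ (e * (2 ^+ m * 2 ^+ m))); last by rewrite ler_wpM2l// ltW.
have ke : 3 + 6 * d%:R <= e * m%:R.
  by rewrite [e * _]mulrC -ler_pdivrMr//; apply: le_trans hk _; rewrite ler_nat /m; lia.
have em : e * m%:R <= e * 2 ^+ m by rewrite ler_wpM2l// ltW.
have p0 : 0 <= 2 ^+ m :> R by rewrite exprn_ge0.
have h3 := ler_wpM2r p0 (le_trans ke em).
have md : m%:R * d%:R <= 2 ^+ m * d%:R :> R by rewrite ler_wpM2r.
by move: h3 md n1; rewrite natrM; move: (2 ^+ m) => p; lra.
Qed.

End star_count.

Section escape.
Variables (R : realType) (d : nat).
Hypothesis d3 : (3 <= d)%N.
Local Notation T := (regular_tree R d).
Variables (dW : measure_display) (W : measurableType dW) (P : probability W R).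
Variables (Pi : W -> set T) (tau : W -> T -> \bar R).
Hypothesis hPP : poisson_point_process P (@length_measure R d) Pi.
Local Notation act w t := (active (Pi w) (tau w) t).

Let d0 : (0 < d)%N. Proof. by lia. Qed.

Lemma escape_negligible (f : vertex d -> vertex d) :
  P.-negligible [set w | forall N, exists2 n, (N <= n)%N &
    popping_times (Pi w) (tau w) /\ exists2 u, u \in vball d (escape_radius n) &
      exists i, exists2 a : R, 0 <= a <= 2^-1 & act w n%:R (pt (f u) i a)].
Proof.
apply: (@borel_cantelli_sqr R _ _ P (fun n => [set w | popping_times (Pi w) (tau w) /\
    exists2 u, u \in vball d (escape_radius n) &
      exists i, exists2 a : R, 0 <= a <= 2^-1 & act w n%:R (pt (f u) i a)])
   (3 * d.-1%:R ^+ 11 * (4 + 6 * d%:R))).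
  by rewrite mulr_ge0 ?addr_ge0 ?mulr_ge0 ?exprn_ge0.
exists 4%N => // n /= n4.
apply: outer_le_trans (star_count R d3 n4) _.
have e0 : 0 < (d.-1%:R ^+ (2 * (n - 4)))^-1 :> R.
  by rewrite invr_gt0 exprn_gt0// ltr0n; lia.
apply: outer_le_sub (outer_le_seq (fun u _ => star_outer_le d3 tau hPP (f u) n4 e0)).
by move=> w [pop [u us h]]; exists u.
Qed.

Lemma up_log_le_ln (n : nat) (t : R) : (2 <= n)%N -> n%:R <= t ->
  (up_log 2 n)%:R <= ln t / ln 2 + 1 /\ 1 <= ln t / ln 2.
Proof.
move=> n2 nt; have n2' : 2 <= n%:R :> R by rewrite (ler_nat R 2).
have l2 : 0 < ln 2 :> R by apply: ln_gt0; rewrite ltr1n.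
have t2 : 2 <= t by exact: le_trans nt.
have t0 : 0 < t by apply: lt_le_trans t2.
split; last by rewrite ler_pdivlMr// mul1r ler_ln// posrE.
have k0 : (0 < up_log 2 n)%N by rewrite up_log_gt0.
rewrite -(prednK k0) -natr1 lerD2r ler_pdivlMr//.
rewrite mulr_natl -lnXn// ler_ln ?posrE ?exprn_gt0//.
apply: le_trans nt; rewrite -natrX ler_nat; apply: ltnW.
exact: up_log_gtn.
Qed.

Lemma escape_lower (o : T) : {ae P, forall w, popping_times (Pi w) (tau w)} ->
  {ae P, forall w, exists C : R, \forall t \near +oo,
     forall x, act w t x -> 2 * t - C * ln t <= mdist o x}.
Proof.
move=> hpop; have [v0 [i0 [a0 a01 oE]]] := ptE o d0.
have [F [G [f [g [tr fr]]]]] := ex_translation R v0.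
apply: (negligibleS _ (negligibleU hpop (escape_negligible f))) => w /= nlow.
apply: contrapT => /not_orP[/contrapT pop nesc]; apply: nlow.
have /existsNP[N hN] := nesc; exists (5 / ln 2).
exists (N + 4)%:R; split; first exact: num_real.
move=> t /= tN x [Px tx].
have t0 : 0 <= t by apply: le_trans (ltW tN).
pose n := Num.truncn t; have /andP[n1 n2] := truncn_itv t0; rewrite -/n in n1 n2.
have nN : (N + 4 <= n)%N by rewrite -ltnS -(ltr_nat R); exact: lt_trans tN n2.
have n4 : (4 <= n)%N := leq_trans (leq_addl N 4) nN.
have n2' : (2 <= n)%N := leq_trans (isT : (2 <= 4)%N) n4.
have ax : act w n%:R x by split => //; apply: le_lt_trans tx; rewrite lee_fin.
have [v [i [a a01' xE]]] := ptE x d0.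
have vn : (escape_radius n < size (val (g v)))%N.
  rewrite ltnNge -mem_vball; apply/negP => gv; apply: hN; exists n; first exact: leq_trans (leq_addr 4 N) nN.
  split => //; exists (g v) => //; exists i, a => //.
  by rewrite (trans_vVK tr) -xE.
have dv : mdist (inl v0 : T) (inl v) = (size (val (g v)))%:R.
  by rewrite -mdist_rootE -[RHS](trans_dist tr) !(trans_inl _ d0 tr) fr (trans_vVK tr).
have a1 : 0 <= a <= 1 by move: a01' => /andP[? ?]; apply/andP; split; lra.
have a2 : 0 <= a0 <= 1 by move: a01 => /andP[? ?]; apply/andP; split; lra.
have p1 := mdist_pt0 v i a1; have p2 := mdist_pt0 v0 i0 a2.
rewrite -xE metric_sym in p1; rewrite -oE in p2.
have q1 := metric_triangle (inl v0 : T) o (inl v : T).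
have q2 := metric_triangle o x (inl v : T).
have [u1 u2] := @up_log_le_ln n t n2' n1.
have er : 2 * n%:R + 3 - 3 * (up_log 2 n)%:R <= (escape_radius n)%:R :> R.
  rewrite /escape_radius natrB; last exact: three_up_log.
  by rewrite natrD !natrM.
have vn' : (escape_radius n)%:R + 1 <= (size (val (g v)))%:R :> R by rewrite natr1 ler_nat.
have e5 : 5 / ln 2 * ln t = 5 * (ln t / ln 2) by rewrite mulrAC mulrA.
apply: (@le_trans _ _ (2 * t - 5 * (ln t / ln 2))); first by rewrite e5.
move: a01 a01' n2 => /andP[_ b1] /andP[_ b2]; rewrite -natr1 => n2.
rewrite -dv in vn'; clear -p1 p2 q1 q2 u1 u2 er vn' b1 b2 n2; lra.
Qed.

End escape.

(** * The lower limit *)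

Section dist_set.
Variables (R : realType) (T : metricType R).

Lemma dist_set_ge (x : T) (A : set T) (b : R) :
  (forall y, A y -> b <= mdist x y) -> (b%:E <= dist_set x A)%E.
Proof. by move=> h; apply: le_ereal_inf_tmp => _ [y Ay <-]; rewrite lee_fin h. Qed.

Lemma dist_set_le (x : T) (A : set T) (y : T) : A y -> (dist_set x A <= (mdist x y)%:E)%E.
Proof. by move=> Ay; apply: ereal_inf_lbound; exists y. Qed.

End dist_set.

Lemma ln_small (R : realType) (C e : R) : 0 < e -> \forall t \near +oo, C * ln t <= e * t.
Proof.
move=> e0; pose a := 2 * `|C| / e; have a0 : 0 <= a by rewrite divr_ge0 ?mulr_ge0// ltW.
exists (1 + a ^+ 2); split; first exact: num_real.
move=> t /= at_; have t1 : 1 <= t by have := sqr_ge0 a; lra.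
have t0 : 0 <= t by lra.
have s0 : 0 < Num.sqrt t by rewrite sqrtr_gt0; lra.
have as_ : a <= Num.sqrt t by rewrite -(ger0_norm a0) -sqrtr_sqr ler_sqrt//; lra.
have lnE : ln t = 2 * ln (Num.sqrt t) by rewrite -[in LHS](sqr_sqrtr t0) lnXn// mulr_natl.
have l1 := ltW (ln_sublinear s0).
have C1 : C * ln t <= `|C| * ln t by rewrite ler_wpM2r ?ler_norm// ln_ge0.
apply: le_trans C1 _; rewrite lnE -[in leRHS](sqr_sqrtr t0) expr2.
have : `|C| * ln (Num.sqrt t) <= `|C| * Num.sqrt t by rewrite ler_wpM2l.
have : 2 * `|C| <= Num.sqrt t * e by rewrite -ler_pdivrMr.
move=> /(ler_wpM2r (ltW s0)); lra.
Qed.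

Lemma limf_einf_pinfty_le (R : realType) (f : R -> \bar R) (b : R) :
  (forall e, 0 < e -> \forall t \near +oo, ((b - e)%:E <= f t)%E) ->
  (b%:E <= limf_einf f (+oo)%R)%E.
Proof.
move=> h; rewrite limf_einfE; apply/lee_addgt0Pr => e e0.
pose V := [set t | ((b - e)%:E <= f t)%E]; have VF : nbhs (+oo)%R V := h e e0.
rewrite -leeBlDr// -EFinB; apply: (@le_trans _ _ (ereal_inf (f @` V))).
  by apply: le_ereal_inf_tmp => _ [t Vt <-].
by apply: ereal_sup_ubound; exists V.
Qed.

Lemma limf_einf_pinfty_ge (R : realType) (f : R -> \bar R) (b : R) :
  (forall e, 0 < e -> ~ \forall t \near +oo, ((b + e)%:E <= f t)%E) ->
  (limf_einf f (+oo)%R <= b%:E)%E.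
Proof.
move=> h; rewrite limf_einfE; apply: ge_ereal_sup => _ [V VF <-].
apply/lee_addgt0Pr => e e0; rewrite leNgt; apply/negP => lt.
apply: (h e e0); apply: filterS VF => t Vt; apply: le_trans (ltW lt) _.
by apply: ereal_inf_lbound; exists t.
Qed.

Section liminf.
Variables (R : realType) (d : nat).
Hypothesis d3 : (3 <= d)%N.
Local Notation T := (regular_tree R d).
Variables (dW : measure_display) (W : measurableType dW) (P : probability W R).
Variables (Pi : W -> set T) (tau : W -> T -> \bar R).
Hypothesis hPP : poisson_point_process P (@length_measure R d) Pi.
Local Notation act w t := (active (Pi w) (tau w) t).

Lemma far_negligible (v : vertex d) (c : R) (s0 : nat) : 2 <= c * s0%:R ->
  P.-negligible [set w | popping_times (Pi w) (tau w) /\ forall s x, s0%:R <= s ->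
      act w s x -> (2 + c) * s <= mdist (inl v : T) x].
Proof.
move=> cs0; apply: negligible_outer_le => e e0.
pose B : R := 2 * expR ((size (vball d (4 * s0 + 2)) * d)%:R / 2) + 1.
have B1 : 1 <= B by rewrite lerDr mulr_ge0// expR_ge0.
have e1 : 0 < e / (4 * B) by rewrite divr_gt0// mulr_gt0//; lra.
have [t [st t4 tb]] := star_bound_small d3 (2 * s0) e1.
apply: outer_le_trans (far_outer_le d3 tau hPP v cs0 st t4 e1); rewrite -/B.
have BE : B * (e / (4 * B)) = e / 4 by field; lra.
have BE2 : B * (e / (4 * B) + e / (4 * B)) = e / 2 by rewrite mulrDr BE; lra.
have h1 : B * (star_bound R d t + e / (4 * B)) <= B * (e / (4 * B) + e / (4 * B)).
  by rewrite ler_wpM2l ?lerD2r//; lra.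
have h2 : 1 * (e / (4 * B)) <= B * (e / (4 * B)) by rewrite ler_wpM2r// ltW.
by rewrite BE2 in h1; rewrite BE mul1r in h2; lra.
Qed.

Lemma not_far (o : T) : {ae P, forall w, popping_times (Pi w) (tau w)} ->
  {ae P, forall w, forall e : R, 0 < e ->
     ~ \forall t \near +oo, ((2 + e)%:E <= dist_set o (act w t) * t^-1%:E)%E}.
Proof.
move=> hpop; have d0 : (0 < d)%N by lia.
have [v [i [a a01 oE]]] := ptE o d0.
pose far k j := [set w | popping_times (Pi w) (tau w) /\
  forall s x, (2 * k.+1 + j)%:R <= s -> act w s x -> (2 + k.+1%:R^-1) * s <= mdist (inl v : T) x].
have far0 k : P.-negligible (\bigcup_j far k j).
  apply: negligible_bigcup => j; apply: far_negligible.
  by rewrite ler_pdivlMl// mulrC -natrM ler_nat leq_addr.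
apply: (negligibleS _ (negligibleU hpop (negligible_bigcup far0))) => w /= nw.
apply: contrapT => /not_orP[/contrapT pop nfar]; apply: nw => e e0 [M [_ hM]].
have [k hk] := ex_nat_ge (2 / e); have [m hm] := ex_nat_ge (M + 1).
apply: nfar; exists k => //; exists m => //; split => // s x ks ax.
have k1 : 0 < k.+1%:R :> R by rewrite ltr0n.
have sk : k.+1%:R <= s by apply: le_trans ks; rewrite ler_nat; lia.
have sm : M < s.
  have : m%:R <= s by apply: le_trans ks; rewrite ler_nat leq_addl.
  by lra.
have s0 : 0 < s by lra.
have := hM s sm; have := lee_wpmul2r (_ : (0 <= s^-1%:E)%E) (dist_set_le o ax).
rewrite lee_fin invr_ge0 (ltW s0) => /(_ isT) h1 /le_trans /(_ h1).
rewrite -EFinM lee_fin ler_pdivlMr// => h2.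
have a1 : 0 <= a <= 1 by move: a01 => /andP[? ?]; apply/andP; split; lra.
have p1 := mdist_pt0 v i a1; rewrite -oE metric_sym in p1.
have tri := metric_triangle o (inl v : T) x.
have ke : 2 * k.+1%:R^-1 <= e.
  rewrite ler_pdivrMr// mulrC -ler_pdivrMr//; apply: le_trans hk _.
  by rewrite ler_nat.
have h3 : 1 <= k.+1%:R^-1 * s by rewrite ler_pdivlMl// mulr1.
have h4 : 2 * k.+1%:R^-1 * s <= e * s by rewrite ler_wpM2r// ltW.
rewrite mulrDl; rewrite mulrDl in h2; rewrite -mulrA in h4.
move: a01 h3 h4 => /andP[_ a2]; move: (k.+1%:R^-1 * s) => u; lra.
Qed.

End liminf.

Theorem theorem3 (R : realType) (d : nat) (hd : (3 <= d)%N)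
    (dW : measure_display) (W : measurableType dW) (P : probability W R)
    (Pi : W -> set (regular_tree R d)) (tau : W -> regular_tree R d -> \bar R)
    (hPi : poisson_balloon_process P (@length_measure R d) Pi tau) :
  {ae P, forall w, transient (Pi w) (tau w)} /\
  (forall o : regular_tree R d,
     {ae P, forall w, exists C : R, \forall t \near +oo,
        ((2 * t - C * ln t)%:E <= dist_set o (active (Pi w) (tau w) t))%E} /\
     {ae P, forall w,
        limf_einf
          (fun t : R => (dist_set o (active (Pi w) (tau w) t) * t^-1%:E)%E) +oo
        = 2%:E}).
Proof.
have [hPP hpop] := hPi.
have low o := escape_lower hd hPP o hpop.
split.
  apply: filterS (low (inl (tree_root d))) => w [C [M1 [_ h1]]] x.
  have half : 0 < 2^-1 :> R by rewrite invr_gt0.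
  have [M2 [_ h2]] := ln_small C half.
  pose r := mdist (inl (tree_root d) : regular_tree R d) x.
  exists (Num.max (2 * r) (Num.max M1 M2)); split; first exact: num_real.
  move=> M; rewrite !gt_max => /and3P[rM M1M M2M] t /= [t0 cov].
  rewrite ger0_norm// leNgt; apply/negP => Mt.
  have : ((2 * t - C * ln t - r)%:E <= dist_set x (active (Pi w) (tau w) t))%E.
    apply: dist_set_ge => y ay; have := h1 t (lt_trans M1M Mt) y ay.
    by have := metric_triangle (inl (tree_root d) : regular_tree R d) x y; rewrite -/r; lra.
  move=> /le_trans /(_ cov); rewrite lee_fin.
  by have := h2 t (lt_trans M2M Mt); lra.
move=> o; split.
  apply: filterS (low o) => w [C hC]; exists C.
  by apply: filterS hC => t ht; exact: dist_set_ge.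
apply: filterS2 (low o) (not_far hd hPP o hpop) => w [C hC] far.
apply/eqP; rewrite eq_le; apply/andP; split; first exact: limf_einf_pinfty_ge.
apply: limf_einf_pinfty_le => e e0; have [M1 [_ h1]] := hC.
have [M2 [_ h2]] := ln_small C e0.
exists (Num.max 0 (Num.max M1 M2)); split; first exact: num_real.
move=> t; rewrite !gt_max => /and3P[t0 /h1 h3 /h2 h4].
have le : ((2 * t - C * ln t)%:E <= dist_set o (active (Pi w) (tau w) t))%E.
  exact: dist_set_ge.
have ti : (0 <= t^-1%:E)%E by rewrite lee_fin invr_ge0 ltW.
apply: le_trans (lee_wpmul2r ti le); rewrite -EFinM lee_fin ler_pdivlMr//.
by lra.
Qed.
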